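(* Let $f$ be an entire function such that $f(0)=1$. Let $G$ be a holomorphic function defined on a neighbourhood of $0$ such that $G(0)=0$ and $f(z)=e^{G(z)}$ for $z$ in a neighbourhood of zero. Write $$G(z)=-\sum_{n=1}^{+\infty}\frac1na_nz^n$$ and denote by $(z_m)_{m\ge0}$ an ordering of the zeroes of $f$. Then for all $r>0$ such that $f$ has no zero of modulus $r$, we have $$a_n=\sum_{|z_m|<r}\frac1{z_m^n}+o\left(\frac1{r^n}\right)\qquad(n\to+\infty).$$ Furthermore, the following properties are equivalent: (i) the order of $f$ is finite; (ii) there is a natural integer $n_0\geq 0$ such that for all integers $n\ge n_0+1$ the series $\sum_{m\ge0}\frac1{z_m^n}$ converges absolutely and its sum is $a_n$. If (i) or (ii) holds then the minimal value of $n_0$ so that (ii) holds is the genus of $f$.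
   Context: An ordering of the zeroes of an entire function $f$ is an enumeration $(z_m)_{m\ge0}$ of the zeroes of $f$, counted with multiplicity, such that $(|z_m|)_{m\ge0}$ is non-decreasing (the enumeration is finite if $f$ has finitely many zeroes). Put $\log_+x=\log\max(1,x)$. The order of $f$ is $\limsup_{r\to+\infty}\frac{\log_+\log_+(\sup_{|z|\le r}|f(z)|)}{\log r}$. If $f$ (with $f(0)\ne0$) has finite order, let $p$ be the smallest natural integer (possibly $0$) with $\sum_m|z_m|^{-(p+1)}<+\infty$; by Hadamard's factorization theorem there is a polynomial $Q$ with $f(z)=e^{Q(z)}\prod_mE(z/z_m,p)$, where $E(u,p)=(1-u)\exp\left(\sum_{k=1}^p\frac1ku^k\right)$. The genus of $f$ is $\max(\deg Q,p)$. The genus of an entire function of infinite order is infinite. *)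

(* Defs.v *)
From Stdlib Require Import Reals List.
From Coquelicot Require Import Coquelicot.
Open Scope R_scope.

Definition holomorphic_at (f : C -> C) (x : C) : Prop :=
  @ex_derive C_AbsRing C_NormedModule f x.

Definition entire (f : C -> C) : Prop := forall x : C, holomorphic_at f x.

Definition near (x : C) (P : C -> Prop) : Prop :=
  @locally C_UniformSpace x P.

Definition Cexp (x : C) : C :=
  (exp (Re x) * cos (Im x), exp (Re x) * sin (Im x)).

(* Vanishing order of f at w; it is 0 exactly when f w <> 0. *)
Definition vanishing_order (f : C -> C) (w : C) (k : nat) : Prop :=
  exists g : C -> C,
    entire g /\ g w <> RtoC 0 /\
    forall x : C, f x = Cmult (Cpow (Cminus x w) k) (g x).

(* A finite or infinite sequence of complex numbers is a map z : nat -> option C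
   whose domain is an initial segment of nat: z m = None means that there is no
   term of index m.  Each w occurs as often as its vanishing order, hence not at
   all if it is not a zero of f. *)
Definition zero_ordering (f : C -> C) (z : nat -> option C) : Prop :=
  (forall m : nat, z m = None -> z (S m) = None) /\
  (forall w : C, exists l : list nat,
     NoDup l /\ (forall m : nat, In m l <-> z m = Some w) /\
     vanishing_order f w (length l)) /\
  (forall (m m' : nat) (w w' : C),
     (m <= m')%nat -> z m = Some w -> z m' = Some w' -> Cmod w <= Cmod w').

(* 1 / z_m^n, extended by 0 past the end of a finite sequence. *)
Definition inv_pow (z : nat -> option C) (n m : nat) : C :=
  match z m with
  | Some w => Cinv (Cpow w n)
  | None => RtoC 0
  end.

Definition indices_in_disc (z : nat -> option C) (r : R) (l : list nat) : Prop :=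
  NoDup l /\
  forall m : nat, In m l <-> exists w : C, z m = Some w /\ Cmod w < r.

Definition sum_inv_pow (z : nat -> option C) (n : nat) (l : list nat) : C :=
  fold_right Cplus (RtoC 0) (map (inv_pow z n) l).

Definition log_plus (x : R) : R := ln (Rmax 1 x).

(* The supremum is finite when f is continuous, and real is then harmless. *)
Definition max_modulus (f : C -> C) (r : R) : R :=
  real (Lub_Rbar (fun y : R => exists x : C, Cmod x <= r /\ y = Cmod (f x))).

Definition LimSup_p_infty (h : R -> R) : Rbar :=
  Rbar_glb (fun s : Rbar =>
    exists A : R, s = Lub_Rbar (fun y : R => exists r : R, A < r /\ y = h r)).

Definition order (f : C -> C) : Rbar :=
  LimSup_p_infty (fun r : R => log_plus (log_plus (max_modulus f r)) / ln r).

Definition is_least (P : nat -> Prop) (n : nat) : Prop :=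
  P n /\ forall k : nat, P k -> (n <= k)%nat.

(* The zero polynomial is given degree 0; this does not affect the genus. *)
Definition polynomial_of_degree (Q : C -> C) (d : nat) : Prop :=
  exists q : nat -> C,
    (d = 0%nat \/ q d <> RtoC 0) /\
    forall x : C,
      Q x = @sum_n C_AbelianMonoid (fun k : nat => Cmult (q k) (Cpow x k)) d.

Definition weierstrass_factor (u : C) (p : nat) : C :=
  Cmult (Cminus (RtoC 1) u)
    (Cexp (@sum_n_m C_AbelianMonoid
             (fun k : nat => Cdiv (Cpow u k) (RtoC (INR k))) 1 p)).

Fixpoint partial_prod (u : nat -> C) (n : nat) : C :=
  match n with
  | O => RtoC 1
  | S n' => Cmult (partial_prod u n') (u n')
  end.

Definition is_infinite_prod (u : nat -> C) (l : C) : Prop :=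
  filterlim (partial_prod u) eventually (@locally C_UniformSpace l).

Definition hadamard_factor (z : nat -> option C) (p : nat) (x : C) (m : nat) : C :=
  match z m with
  | Some w => weierstrass_factor (Cdiv x w) p
  | None => RtoC 1
  end.

(* The genus of an entire function f with f 0 <> 0; None is the infinite genus. *)
Definition is_genus (f : C -> C) (g : option nat) : Prop :=
  match g with
  | Some k =>
      is_finite (order f) /\
      exists (z : nat -> option C) (p : nat) (Q : C -> C) (d : nat),
        zero_ordering f z /\
        is_least (fun p' : nat =>
          ex_series (fun m : nat => Cmod (inv_pow z (p' + 1) m))) p /\
        polynomial_of_degree Q d /\
        (forall x : C, exists P : C,
           is_infinite_prod (hadamard_factor z p x) P /\
           f x = Cmult (Cexp (Q x)) P) /\
        k = Nat.max d p
  | None => order f = p_infty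
  end.

Definition power_sum_identity
    (z : nat -> option C) (a : nat -> C) (n0 : nat) : Prop :=
  forall n : nat, (n0 + 1 <= n)%nat ->
    ex_series (fun m : nat => Cmod (inv_pow z n m)) /\
    @is_series C_AbsRing C_NormedModule (inv_pow z n) (a n).

(* Main.v *)
(* A function g holomorphic and zero-free in a disc |x| < R with g(0) = 1 is exp(L) there, L being
   a power series; this follows from Goursat's theorem and Cauchy's formula.  Applied to the cofactor
   g of the first N zeroes in f, where R bounds the modulus of the other zeroes from below, it
   identifies the coefficient of x^n in L as -(1/n) (a_n - sum_(m < N) z_m^(-n)).
   - The convergence of L beyond r gives the o(r^(-n)) estimate.
   - In finite order, |g| <= |f| on the circle |x| = 2R, so the Borel-Caratheodory inequality bounds
     that coefficient by O(R^(rho - n)), which tends to 0 for n > rho as N and R grow; Jensen's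
     bound on the number of zeroes gives the absolute convergence.
   - Conversely, if a_n is the full sum for all large n, then L differs from a polynomial Q, fixed,
     plus the exponents of the first N Weierstrass factors by a remainder bounded by the tail of
     sum |z_m|^(-(p+1)).  Hence the partial products converge to f exp(-Q), without any theory of
     infinite products, and f has finite order. *)
Require Import Defs.
From Stdlib Require Import Reals Arith List Lra Lia Classical ClassicalEpsilon FunctionalExtensionality.
From Coquelicot Require Import Coquelicot.
Open Scope R_scope.

(** * Limits and complex derivatives *)

(** The identity for the coefficients of L is proved near 0 only, where log f and the logarithms of
    the factors 1 - x/z_m are both available, while the estimates use the whole disc on which L
    converges. This passage from a neighbourhood of 0 to a large disc is how growth of f controls
    a_n. In finite order the radius R must separate the first N zeroes from the others. The removed
    ones must satisfy |z_m| <= R, so that |1 - x/z_m| >= 1 on |x| = 2R; the others must satisfy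
    |z_m| >= R, so that the cofactor has a logarithm on |x| < R. The ordering makes R = |z_N| fit
    both conditions. For the genus, let p be the least exponent of convergence. For n > p the n-th
    coefficient of Q is -(1/n) times the difference between a_n and the full sum of z_m^(-n). Hence
    (ii) holds with n0 exactly when n0 >= p and the coefficients of Q beyond n0 vanish, and the
    least such n0 is max(deg Q, p). No sharp growth exponent is required for this, so finite order
    enters only as |f(x)| <= exp(r^K) for |x| <= r, with r large and K a natural number. *)

Notation nb x := (@locally C_UniformSpace x).

Lemma nb_iff (x : C) (P : C -> Prop) :
  nb x P <-> exists d, 0 < d /\ forall y, Cmod (y - x) < d -> P y.
Proof.
  rewrite locally_C. split.
  - intros [d H]. exists d. split. apply cond_pos. intros y Hy. apply H. exact Hy.
  - intros [d [Hd H]]. exists (mkposreal d Hd). intros y Hy. apply H. exact Hy.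
Qed.

(** An epsilon form in [Cmod] over an arbitrary filter: the algebra of limits is then proved once
    for sequences, for complex points and for real parameters. *)
Definition Cto {T : Type} (F : (T -> Prop) -> Prop) (u : T -> C) (l : C) : Prop :=
  forall eps, 0 < eps -> F (fun t => Cmod (u t - l) < eps).

Lemma Cto_filterlim {T : Type} (F : (T -> Prop) -> Prop) {FF : Filter F} (u : T -> C) (l : C) :
  Cto F u l <-> filterlim u F (nb l).
Proof.
  split.
  - intros H P HP. apply nb_iff in HP. destruct HP as [d [Hd HP]].
    unfold filtermap. generalize (H d Hd). apply filter_imp. intros t Ht. apply HP, Ht.
  - intros H eps He. apply (H (fun y => Cmod (y - l) < eps)).
    apply nb_iff. exists eps. split; auto.
Qed.

Lemma Cmod_triangle_minus (a b : C) : Cmod (a - b) <= Cmod a + Cmod b.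
Proof.
  unfold Cminus. eapply Rle_trans. apply Cmod_triangle. rewrite Cmod_opp. lra.
Qed.

Lemma Cmod_rev_triangle (a b : C) : Cmod a - Cmod b <= Cmod (a - b).
Proof.
  generalize (Cmod_triangle (a - b) b). replace (a - b + b)%C with a by ring. lra.
Qed.

Lemma Cmod_minus_sym (a b : C) : Cmod (a - b) = Cmod (b - a).
Proof. rewrite <- (Cmod_opp (a - b)). f_equal. ring. Qed.

Section Limits.
Context {T : Type} (F : (T -> Prop) -> Prop) {FF : Filter F}.

Lemma Cto_const (c : C) : Cto F (fun _ => c) c.
Proof.
  intros eps He. apply filter_forall. intros _. replace (c - c)%C with (RtoC 0) by ring.
  rewrite Cmod_0. exact He.
Qed.

Lemma Cto_ext_loc (u v : T -> C) (l : C) :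
  F (fun t => u t = v t) -> Cto F u l -> Cto F v l.
Proof.
  intros H Hu eps He. generalize (filter_and _ _ H (Hu eps He)). apply filter_imp.
  intros t [E Ht]. rewrite <- E. exact Ht.
Qed.

Lemma Cto_ext (u v : T -> C) (l : C) :
  (forall t, u t = v t) -> Cto F u l -> Cto F v l.
Proof. intros H. apply Cto_ext_loc. apply filter_forall, H. Qed.

Lemma Cto_plus (u v : T -> C) (l m : C) :
  Cto F u l -> Cto F v m -> Cto F (fun t => u t + v t)%C (l + m)%C.
Proof.
  intros Hu Hv eps He.
  assert (He2 : 0 < eps / 2) by lra.
  generalize (filter_and _ _ (Hu _ He2) (Hv _ He2)). apply filter_imp.
  intros t [A B]. replace (u t + v t - (l + m))%C with ((u t - l) + (v t - m))%C by ring.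
  eapply Rle_lt_trans. apply Cmod_triangle. lra.
Qed.

Lemma Cto_mult (u v : T -> C) (l m : C) :
  Cto F u l -> Cto F v m -> Cto F (fun t => u t * v t)%C (l * m)%C.
Proof.
  intros Hu Hv eps He.
  set (K := Cmod l + Cmod m + 1).
  assert (HK : 1 <= K) by (unfold K; generalize (Cmod_ge_0 l) (Cmod_ge_0 m); lra).
  assert (He2 : 0 < Rmin 1 (eps / (2 * K))).
  { apply Rmin_case. lra. apply Rdiv_lt_0_compat; lra. }
  generalize (filter_and _ _ (Hu _ He2) (Hv _ He2)). apply filter_imp.
  intros t [A B].
  replace (u t * v t - l * m)%C with ((u t - l) * (v t - m) + (u t - l) * m + l * (v t - m))%C by ring.
  assert (A1 : Cmod (u t - l) < 1) by (eapply Rlt_le_trans; [apply A | apply Rmin_l]).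
  assert (A2 : Cmod (u t - l) < eps / (2*K)) by (eapply Rlt_le_trans; [apply A | apply Rmin_r]).
  assert (B2 : Cmod (v t - m) < eps / (2*K)) by (eapply Rlt_le_trans; [apply B | apply Rmin_r]).
  eapply Rle_lt_trans. apply Cmod_triangle.
  eapply Rle_lt_trans. apply Rplus_le_compat_r. apply Cmod_triangle.
  rewrite !Cmod_mult.
  generalize (Cmod_ge_0 l) (Cmod_ge_0 m) (Cmod_ge_0 (u t - l)) (Cmod_ge_0 (v t - m)).
  intros p1 p2 p3 p4.
  set (e := eps / (2*K)) in *.
  assert (E : eps = 2 * K * e) by (unfold e; field; lra).
  assert (0 < e) by (unfold e; apply Rdiv_lt_0_compat; lra).
  rewrite E. unfold K.
  assert (Cmod (u t - l) * Cmod (v t - m) <= 1 * e) by (apply Rmult_le_compat; lra).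
  assert (Cmod (u t - l) * Cmod m <= e * Cmod m) by (apply Rmult_le_compat_r; lra).
  assert (Cmod l * Cmod (v t - m) <= Cmod l * e) by (apply Rmult_le_compat_l; lra).
  nra.
Qed.

Lemma Cto_opp (u : T -> C) (l : C) : Cto F u l -> Cto F (fun t => - u t)%C (- l)%C.
Proof.
  intros Hu eps He. generalize (Hu eps He). apply filter_imp. intros t Ht.
  replace (- u t - - l)%C with (- (u t - l))%C by ring. rewrite Cmod_opp. exact Ht.
Qed.

Lemma Cto_minus (u v : T -> C) (l m : C) :
  Cto F u l -> Cto F v m -> Cto F (fun t => u t - v t)%C (l - m)%C.
Proof. intros Hu Hv. apply Cto_plus. exact Hu. apply Cto_opp, Hv. Qed.

Lemma Cto_neq0 (u : T -> C) (l : C) : Cto F u l -> l <> RtoC 0 -> F (fun t => u t <> RtoC 0).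
Proof.
  intros Hu Hl. apply Cmod_gt_0 in Hl. generalize (Hu _ Hl). apply filter_imp.
  intros t Ht E. rewrite E in Ht. replace (0 - l)%C with (- l)%C in Ht by ring.
  rewrite Cmod_opp in Ht. lra.
Qed.

Lemma Cto_inv (u : T -> C) (l : C) : Cto F u l -> l <> RtoC 0 -> Cto F (fun t => / u t)%C (/ l)%C.
Proof.
  intros Hu Hl eps He.
  pose proof (proj1 (Cmod_gt_0 l) Hl) as Hl'.
  assert (He2 : 0 < Rmin (Cmod l / 2) (eps * (Cmod l * Cmod l) / 2)).
  { apply Rmin_case. lra. apply Rdiv_lt_0_compat; [|lra]. repeat apply Rmult_lt_0_compat; lra. }
  generalize (Hu _ He2). apply filter_imp. intros t Ht.
  assert (A1 : Cmod (u t - l) < Cmod l / 2) by (eapply Rlt_le_trans; [apply Ht | apply Rmin_l]).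
  assert (A2 : Cmod (u t - l) < eps * (Cmod l * Cmod l) / 2) by (eapply Rlt_le_trans; [apply Ht | apply Rmin_r]).
  assert (Hm : Cmod l / 2 < Cmod (u t)).
  { generalize (Cmod_rev_triangle l (u t)). rewrite Cmod_minus_sym. lra. }
  assert (Hut : u t <> RtoC 0) by (apply Cmod_gt_0; lra).
  replace (/ u t - / l)%C with ((l - u t) * / (u t * l))%C by (field; split; assumption).
  rewrite Cmod_mult, Cmod_inv by (apply Cmult_neq_0; assumption).
  rewrite Cmod_mult, Cmod_minus_sym.
  apply Rmult_lt_reg_r with (Cmod (u t) * Cmod l).
  apply Rmult_lt_0_compat; lra.
  rewrite Rmult_assoc, Rinv_l, Rmult_1_r.
  2: apply Rgt_not_eq, Rmult_lt_0_compat; lra.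
  eapply Rlt_le_trans. apply A2.
  assert (0 < eps * Cmod l) by (apply Rmult_lt_0_compat; lra). nra.
Qed.

Lemma Cto_div (u v : T -> C) (l m : C) :
  Cto F u l -> Cto F v m -> m <> RtoC 0 -> Cto F (fun t => u t / v t)%C (l / m)%C.
Proof. intros Hu Hv Hm. apply Cto_mult. exact Hu. apply Cto_inv; assumption. Qed.

Lemma Cto_pow (u : T -> C) (l : C) (n : nat) :
  Cto F u l -> Cto F (fun t => u t ^ n)%C (l ^ n)%C.
Proof.
  intros Hu. induction n.
  - apply (Cto_const (RtoC 1)).
  - apply (Cto_ext (fun t => u t * u t ^ n)%C). intros; rewrite Cpow_S; ring.
    rewrite Cpow_S. apply Cto_mult; assumption.
Qed.

Lemma Cto_comp (u : T -> C) (l m : C) (g : C -> C) :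
  Cto F u l -> Cto (nb l) g m -> Cto F (fun t => g (u t)) m.
Proof.
  intros Hu Hg eps He. generalize (Hg eps He). intros H. apply nb_iff in H.
  destruct H as [d [Hd H]]. generalize (Hu d Hd). apply filter_imp. auto.
Qed.

End Limits.

Tactic Notation "capply" uconstr(t) := apply t; try typeclasses eauto.

Lemma Cto_unique {T : Type} (F : (T -> Prop) -> Prop) {FF : ProperFilter F} (u : T -> C) (l m : C) :
  Cto F u l -> Cto F u m -> l = m.
Proof.
  intros H1 H2. apply NNPP. intros N.
  assert (Hd : 0 < Cmod (l - m) / 2).
  { assert (0 < Cmod (l - m)); [|lra]. apply Cmod_gt_0. apply Cminus_eq_contra, N. }
  destruct (filter_ex _ (filter_and _ _ (H1 _ Hd) (H2 _ Hd))) as [t [A B]].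
  generalize (Cmod_triangle_minus (u t - m) (u t - l)).
  replace (u t - m - (u t - l))%C with (l - m)%C by ring. lra.
Qed.

Lemma nb_forall (x : C) (P : C -> Prop) : (forall y : C, P y) -> nb x P.
Proof. apply filter_forall. Qed.

Lemma Cto_id (x : C) : Cto (nb x) (fun y => y) x.
Proof. intros eps He. apply nb_iff. exists eps. auto. Qed.

Notation Ccont f x := (Cto (nb x) f (f x)).

(* Caratheodory's form: phi is the difference quotient, so product and chain rules are algebra. *)
Definition cderiv (f : C -> C) (x l : C) : Prop :=
  exists phi : C -> C, Cto (nb x) phi l /\ nb x (fun y => f y = f x + phi y * (y - x))%C.

Lemma cderiv_cont (f : C -> C) (x l : C) : cderiv f x l -> Ccont f x.
Proof.
  intros [phi [H1 H2]].
  capply (Cto_ext_loc _ (fun y => f x + phi y * (y - x))%C).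
  revert H2. apply filter_imp. auto.
  assert (H : Cto (nb x) (fun y => f x + phi y * (y - x))%C (f x + l * (x - x))%C).
  { capply Cto_plus. capply Cto_const. capply Cto_mult. exact H1.
    capply Cto_minus. apply Cto_id. capply Cto_const. }
  replace (f x + l * (x - x))%C with (f x) in H by ring. exact H.
Qed.

Lemma cderiv_ext_loc (f g : C -> C) (x l : C) :
  nb x (fun y => f y = g y) -> cderiv f x l -> cderiv g x l.
Proof.
  intros H [phi [H1 H2]]. exists phi. split. exact H1.
  assert (Hx := locally_singleton _ _ H).
  generalize (filter_and _ _ H H2). apply filter_imp. intros y [A B]. congruence.
Qed.

Lemma cderiv_const (c x : C) : cderiv (fun _ => c) x (RtoC 0).
Proof. exists (fun _ => RtoC 0). split. capply Cto_const. apply nb_forall. intros y. ring. Qed.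

Lemma cderiv_id (x : C) : cderiv (fun y => y) x (RtoC 1).
Proof. exists (fun _ => RtoC 1). split. capply Cto_const. apply nb_forall. intros y. ring. Qed.

Lemma cderiv_plus (f g : C -> C) (x l m : C) :
  cderiv f x l -> cderiv g x m -> cderiv (fun y => f y + g y)%C x (l + m)%C.
Proof.
  intros [p [P1 P2]] [q [Q1 Q2]]. exists (fun y => p y + q y)%C. split. (capply Cto_plus); assumption.
  generalize (filter_and _ _ P2 Q2). apply filter_imp. intros y [A B]. rewrite A, B. ring.
Qed.

Lemma cderiv_mult (f g : C -> C) (x l m : C) :
  cderiv f x l -> cderiv g x m -> cderiv (fun y => f y * g y)%C x (l * g x + f x * m)%C.
Proof.
  intros Hf Hg. assert (Cg := cderiv_cont _ _ _ Hg).
  destruct Hf as [p [P1 P2]]. destruct Hg as [q [Q1 Q2]].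
  exists (fun y => p y * g y + f x * q y)%C. split.
  capply Cto_plus. (capply Cto_mult); assumption. capply Cto_mult. capply Cto_const. assumption.
  generalize (filter_and _ _ P2 Q2). apply filter_imp. intros y [A B]. rewrite A, B. ring.
Qed.

Lemma cderiv_scal (c : C) (f : C -> C) (x l : C) :
  cderiv f x l -> cderiv (fun y => c * f y)%C x (c * l)%C.
Proof.
  intros Hf. replace (c * l)%C with (0 * f x + c * l)%C by ring.
  apply (cderiv_mult (fun _ => c)). apply cderiv_const. exact Hf.
Qed.

Lemma cderiv_opp (f : C -> C) (x l : C) : cderiv f x l -> cderiv (fun y => - f y)%C x (- l)%C.
Proof.
  intros [p [P1 P2]]. exists (fun y => - p y)%C. split. (capply Cto_opp); assumption.
  revert P2. apply filter_imp. intros y A. rewrite A. ring.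
Qed.

Lemma cderiv_minus (f g : C -> C) (x l m : C) :
  cderiv f x l -> cderiv g x m -> cderiv (fun y => f y - g y)%C x (l - m)%C.
Proof. intros Hf Hg. apply cderiv_plus. exact Hf. apply cderiv_opp, Hg. Qed.

Lemma cderiv_inv (f : C -> C) (x l : C) :
  cderiv f x l -> f x <> RtoC 0 -> cderiv (fun y => / f y)%C x (- l / (f x * f x))%C.
Proof.
  intros Hf Nz. assert (Cf := cderiv_cont _ _ _ Hf). destruct Hf as [p [P1 P2]].
  exists (fun y => - p y / (f y * f x))%C. split.
  - capply Cto_div. (capply Cto_opp); apply P1. capply Cto_mult. exact Cf. capply Cto_const.
    apply Cmult_neq_0; assumption.
  - generalize (filter_and _ _ P2 (Cto_neq0 _ _ _ Cf Nz)). apply filter_imp.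
    intros y [A B].
    replace (- p y / (f y * f x) * (y - x))%C with (- (p y * (y - x)) / (f y * f x))%C by (field; auto).
    replace (p y * (y - x))%C with (f y - f x)%C by (rewrite A; ring).
    field. auto.
Qed.

Lemma cderiv_comp (f g : C -> C) (x l m : C) :
  cderiv f x l -> cderiv g (f x) m -> cderiv (fun y => g (f y)) x (m * l)%C.
Proof.
  intros Hf Hg. assert (Cf := cderiv_cont _ _ _ Hf).
  destruct Hf as [p [P1 P2]]. destruct Hg as [q [Q1 Q2]].
  exists (fun y => q (f y) * p y)%C. split.
  - capply Cto_mult. apply (Cto_comp _ f (f x)); assumption. exact P1.
  - apply nb_iff in Q2. destruct Q2 as [d [Hd Q2]].
    generalize (filter_and _ _ P2 (Cf d Hd)). apply filter_imp. intros y [A B].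
    rewrite (Q2 _ B). rewrite A. ring.
Qed.

Lemma cderiv_pow (f : C -> C) (x l : C) (n : nat) :
  cderiv f x l -> exists m, cderiv (fun y => f y ^ n)%C x m.
Proof.
  intros Hf. induction n as [|n [m IH]].
  - exists (RtoC 0). apply (cderiv_const (RtoC 1)).
  - exists (l * f x ^ n + f x * m)%C.
    apply (cderiv_ext_loc (fun y => f y * f y ^ n)%C).
    apply nb_forall. intros; rewrite Cpow_S; ring.
    apply (cderiv_mult f (fun y => f y ^ n)%C); assumption.
Qed.

Lemma cderiv_intro (f : C -> C) (x l : C) :
  (forall eps, 0 < eps -> nb x (fun y => Cmod (f y - f x - l * (y - x)) <= eps * Cmod (y - x))) ->
  cderiv f x l.
Proof.
  intros H.
  (* [nb x] is not punctured, so the difference quotient must take the value [l] at [x] itself. *)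
  exists (fun y => if Ceq_dec y x then l else (f y - f x) / (y - x))%C. split.
  - intros eps He. assert (He2 : 0 < eps / 2) by lra. generalize (H _ He2). apply filter_imp.
    intros y Hy. destruct (Ceq_dec y x) as [E|N].
    + replace (l - l)%C with (RtoC 0) by ring. rewrite Cmod_0. lra.
    + assert (N' := Cminus_eq_contra _ _ N).
      replace ((f y - f x) / (y - x) - l)%C with ((f y - f x - l * (y - x)) / (y - x))%C by (field; exact N').
      rewrite Cmod_div by exact N'. apply Cmod_gt_0 in N'.
      apply Rle_lt_trans with (eps / 2); [|lra].
      apply Rmult_le_reg_r with (Cmod (y - x)). exact N'.
      unfold Rdiv at 1. rewrite Rmult_assoc, Rinv_l, Rmult_1_r; [exact Hy|lra].
  - apply nb_forall. intros y. destruct (Ceq_dec y x) as [E|N].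
    + subst. ring.
    + assert (N' := Cminus_eq_contra _ _ N). field. exact N'.
Qed.

Lemma cderiv_elim (f : C -> C) (x l : C) :
  cderiv f x l ->
  forall eps, 0 < eps -> nb x (fun y => Cmod (f y - f x - l * (y - x)) <= eps * Cmod (y - x)).
Proof.
  intros [p [P1 P2]] eps He. generalize (filter_and _ _ P2 (P1 eps He)). apply filter_imp.
  intros y [A B]. rewrite A. replace (f x + p y * (y - x) - f x - l * (y - x))%C with ((p y - l) * (y - x))%C by ring.
  rewrite Cmod_mult. apply Rmult_le_compat_r. apply Cmod_ge_0. lra.
Qed.

(** [ex_derive] uses the neighbourhoods given by the absolute value, [nb] those of the product
    structure; [locally_C] identifies them. *)
Lemma holomorphic_at_iff (f : C -> C) (x : C) : holomorphic_at f x <-> exists l, cderiv f x l.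
Proof.
  split.
  - intros [l [_ H]]. exists l. apply cderiv_intro. intros eps He.
    specialize (H x (fun P HP => HP) (mkposreal eps He)).
    apply locally_C in H. revert H. apply filter_imp. intros y Hy.
    simpl in Hy. change (Cmod (minus (minus (f y) (f x)) (scal (minus y x) l)) <= eps * Cmod (minus y x)) in Hy.
    change (minus y x) with (y - x)%C in Hy.
    change (scal (y - x)%C l) with ((y - x) * l)%C in Hy.
    replace (f y - f x - l * (y - x))%C with (f y - f x - (y - x) * l)%C by ring. exact Hy.
  - intros [l H]. exists l. split. apply is_linear_scal_l.
    intros x' Hx' eps.
    assert (E : x = x').
    { apply (@is_filter_lim_locally_unique C_AbsRing (AbsRing_NormedModule C_AbsRing)). exact Hx'. } subst x'.
    generalize (cderiv_elim _ _ _ H eps (cond_pos eps)). rewrite locally_C.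
    apply filter_imp. intros y Hy.
    change (Cmod ((f y - f x) - (y - x) * l) <= eps * Cmod (y - x)).
    replace (f y - f x - (y - x) * l)%C with (f y - f x - l * (y - x))%C by ring. exact Hy.
Qed.

(** * The complex exponential *)

Lemma Ceq (a b : C) : Re a = Re b -> Im a = Im b -> a = b.
Proof. destruct a, b; unfold Re, Im; simpl; intros; subst; reflexivity. Qed.

Lemma im_le_Cmod (c : C) : Rabs (Im c) <= Cmod c.
Proof. eapply Rle_trans. 2: apply Rmax_Cmod. apply Rmax_r. Qed.

Lemma Cmod_le_Re_Im (c : C) : Cmod c <= Rabs (Re c) + Rabs (Im c).
Proof.
  replace c with (Re c + Ci * Im c)%C at 1.
  eapply Rle_trans. apply Cmod_triangle. rewrite Cmod_mult, Cmod_Ci, !Cmod_R. lra.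
  apply Ceq; destruct c; unfold Re, Im; simpl; ring.
Qed.

Lemma Cexp_plus (x y : C) : Cexp (x + y) = (Cexp x * Cexp y)%C.
Proof.
  unfold Cexp. rewrite re_plus, im_plus, exp_plus, cos_plus, sin_plus.
  apply Ceq; unfold Re, Im; simpl; ring.
Qed.

Lemma Cexp_0 : Cexp 0 = RtoC 1.
Proof. unfold Cexp. apply Ceq; unfold Re, Im; simpl; rewrite exp_0, ?cos_0, ?sin_0; ring. Qed.

Lemma Cmod_Cexp (x : C) : Cmod (Cexp x) = exp (Re x).
Proof.
  unfold Cexp, Cmod; simpl.
  replace (_ + _) with (exp (Re x) * exp (Re x) * (Rsqr (sin (Im x)) + Rsqr (cos (Im x)))) by (unfold Rsqr; ring).
  rewrite sin2_cos2, Rmult_1_r. apply sqrt_square. left. apply exp_pos.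
Qed.

Lemma Cexp_neq0 (x : C) : Cexp x <> RtoC 0.
Proof. apply Cmod_gt_0. rewrite Cmod_Cexp. apply exp_pos. Qed.

Lemma Cexp_opp (x : C) : Cexp (- x) = (/ Cexp x)%C.
Proof.
  assert (H := Cexp_neq0 x).
  assert (E : (Cexp (- x) * Cexp x = 1)%C).
  { rewrite <- Cexp_plus. replace (- x + x)%C with (RtoC 0) by ring. apply Cexp_0. }
  replace (Cexp (- x)) with (Cexp (- x) * Cexp x / Cexp x)%C by (field; exact H).
  rewrite E. field. exact H.
Qed.

(** The inequality 1 - a <= exp(-a) gives exp(a) <= 1/(1 - a), and (1 - a)(1 + a + 2a^2) >= 1 for a
    <= 1/2. *)
Lemma exp_taylor2 (a : R) : Rabs a <= 1/2 -> Rabs (exp a - 1 - a) <= 2 * a ^ 2.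
Proof.
  intros Ha. apply Rabs_le_between in Ha.
  assert (H1 := exp_ineq1_le a). assert (H2 := exp_ineq1_le (- a)).
  assert (E : exp a * exp (- a) = 1) by (rewrite <- exp_plus, Rplus_opp_r; apply exp_0).
  assert (P := exp_pos a).
  rewrite Rabs_pos_eq by lra.
  assert (exp a * (1 - a) <= 1) by nra.
  assert ((1 - a) * (1 + a + 2 * a^2) >= 1) by nra.
  assert (exp a <= 1 + a + 2 * a ^ 2); [|lra].
  apply Rmult_le_reg_r with (1 - a); lra.
Qed.

Lemma abs_sin_le (b : R) : Rabs (sin b) <= Rabs b.
Proof.
  destruct (MVT_gen sin 0 b cos) as [c [_ H]].
  - intros x _. apply is_derive_sin.
  - intros x _. apply continuity_pt_filterlim. apply continuous_sin.
  - rewrite sin_0, !Rminus_0_r in H. rewrite H, Rabs_mult.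
    assert (Rabs (cos c) <= 1) by (apply Rabs_le; apply COS_bound).
    generalize (Rabs_pos b). nra.
Qed.

Lemma cos_taylor2 (b : R) : Rabs (cos b - 1) <= b ^ 2 / 2.
Proof.
  replace b with (2 * (b / 2)) at 1 by field. rewrite cos_2a_sin.
  assert (H := abs_sin_le (b / 2)).
  replace (1 - 2 * sin (b/2) * sin (b/2) - 1) with (- (2 * (sin (b/2))^2)) by ring.
  rewrite Rabs_Ropp, Rabs_pos_eq by (generalize (pow2_ge_0 (sin (b/2))); lra).
  rewrite <- (pow2_abs (sin (b/2))).
  replace (b ^ 2 / 2) with (2 * Rabs (b/2) ^ 2).
  generalize (Rabs_pos (sin (b/2))); nra.
  rewrite pow2_abs. field.
Qed.

Lemma sin_taylor2 (b : R) : Rabs b <= 1 -> Rabs (sin b - b) <= b ^ 2.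
Proof.
  intros Hb.
  destruct (MVT_gen (fun x => sin x - x) 0 b (fun x => cos x - 1)) as [c [Hc H]].
  - intros x _. auto_derive; auto. ring.
  - intros x _. apply continuity_pt_minus. apply continuity_sin. apply continuity_pt_id.
  - rewrite sin_0, !Rminus_0_r in H. rewrite H, Rabs_mult.
    assert (K := cos_taylor2 c).
    assert (Hc2 : Rabs c <= Rabs b).
    { unfold Rmin, Rmax in Hc. destruct (Rle_dec 0 b).
      rewrite !Rabs_pos_eq; lra. rewrite !Rabs_left1; lra. }
    rewrite <- (pow2_abs b). rewrite <- (pow2_abs c) in K.
    generalize (Rabs_pos c) (Rabs_pos b). intros.
    assert (Rabs (cos c - 1) <= Rabs b) by nra. simpl. rewrite Rmult_1_r.
    apply Rmult_le_compat_r; lra.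
Qed.

(** The real and imaginary parts of the remainder are combinations of the one-variable remainders;
    each part costs at most 3|h|^2. *)
Lemma Cexp_taylor2 (h : C) : Cmod h <= 1/2 -> Cmod (Cexp h - 1 - h) <= 6 * Cmod h ^ 2.
Proof.
  intros Hh. eapply Rle_trans. apply Cmod_le_Re_Im.
  assert (Ha := re_le_Cmod h). assert (Hb := im_le_Cmod h).
  destruct h as [a b]. unfold Cexp. simpl in *. unfold Re, Im in *; simpl in *.
  set (m := Cmod (a, b)) in *.
  assert (E1 := exp_taylor2 a ltac:(lra)). assert (C1 := cos_taylor2 b).
  assert (S1 := sin_taylor2 b ltac:(lra)). assert (S2 := abs_sin_le b).
  assert (Pm : 0 <= m) by apply Cmod_ge_0.
  rewrite <- (pow2_abs a) in E1. rewrite <- (pow2_abs b) in C1, S1.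
  assert (Pa := Rabs_pos a). assert (Pb := Rabs_pos b).
  assert (A2 : Rabs a ^ 2 <= m * m) by nra. assert (B2 : Rabs b ^ 2 <= m * m) by nra.
  assert (R1 : Rabs (exp a * cos b + - (1) + - a) <= 3 * (m * m)).
  { replace (exp a * cos b + - (1) + - a) with ((exp a - 1 - a) * cos b + (1 + a) * (cos b - 1)) by ring.
    eapply Rle_trans. apply Rabs_triang. rewrite !Rabs_mult.
    assert (Rabs (cos b) <= 1) by (apply Rabs_le; apply COS_bound).
    assert (Rabs (1 + a) <= 3 / 2).
    { eapply Rle_trans. apply Rabs_triang. rewrite Rabs_R1. lra. }
    assert (P1 := Rabs_pos (exp a - 1 - a)). assert (P2 := Rabs_pos (cos b)).
    assert (P3 := Rabs_pos (1 + a)). assert (P4 := Rabs_pos (cos b - 1)).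
    assert (Rabs (exp a - 1 - a) * Rabs (cos b) <= (2 * Rabs a ^ 2) * 1) by (apply Rmult_le_compat; lra).
    assert (Rabs (1 + a) * Rabs (cos b - 1) <= 3/2 * (Rabs b ^ 2 / 2)) by (apply Rmult_le_compat; lra).
    lra. }
  assert (R2 : Rabs (exp a * sin b + - 0 + - b) <= 3 * (m * m)).
  { replace (exp a * sin b + - 0 + - b) with ((exp a - 1 - a) * sin b + a * sin b + (sin b - b)) by ring.
    eapply Rle_trans. apply Rabs_triang. eapply Rle_trans. apply Rplus_le_compat_r, Rabs_triang.
    rewrite !Rabs_mult.
    assert (P1 := Rabs_pos (exp a - 1 - a)). assert (P2 := Rabs_pos (sin b)).
    assert (Rabs (exp a - 1 - a) * Rabs (sin b) <= (2 * Rabs a ^ 2) * (1/2)) by (apply Rmult_le_compat; lra).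
    assert (Rabs a * Rabs (sin b) <= m * m) by (apply Rmult_le_compat; lra).
    lra. }
  lra.
Qed.

Lemma cderiv_Cexp (x : C) : cderiv Cexp x (Cexp x).
Proof.
  apply cderiv_intro. intros eps He. apply nb_iff.
  set (K := 6 * Cmod (Cexp x)).
  assert (HK : 0 < K) by (unfold K; rewrite Cmod_Cexp; generalize (exp_pos (Re x)); lra).
  exists (Rmin (1/2) (eps / K)). split.
  apply Rmin_case. lra. apply Rdiv_lt_0_compat; lra.
  intros y Hy.
  assert (H1 : Cmod (y - x) < 1/2) by (eapply Rlt_le_trans; [apply Hy|apply Rmin_l]).
  assert (H2 : Cmod (y - x) < eps / K) by (eapply Rlt_le_trans; [apply Hy|apply Rmin_r]).
  replace (Cexp y) with (Cexp x * Cexp (y - x))%C.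
  2: { rewrite <- Cexp_plus. f_equal. ring. }
  replace (Cexp x * Cexp (y - x) - Cexp x - Cexp x * (y - x))%C
    with (Cexp x * (Cexp (y - x) - 1 - (y - x)))%C by ring.
  rewrite Cmod_mult. assert (T := Cexp_taylor2 (y - x) ltac:(lra)).
  apply Rmult_lt_compat_l with (r := K) in H2; [|exact HK].
  replace (K * (eps / K)) with eps in H2 by (field; lra).
  assert (P := Cmod_ge_0 (y - x)). assert (P2 := Cmod_ge_0 (Cexp x)).
  apply Rle_trans with (Cmod (Cexp x) * (6 * Cmod (y - x) ^ 2)).
  apply Rmult_le_compat_l; assumption. unfold K in *. nra.
Qed.

Lemma Ccont_Cexp (x : C) : Ccont Cexp x.
Proof. apply (cderiv_cont _ _ _ (cderiv_Cexp x)). Qed.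

(** The modulus forces a zero real part, and the sine has no other zero than 0 in (-1, 1). This is
    what makes two continuous logarithms with the same value at 0 agree nearby. *)
Lemma Cexp_eq1 (x : C) : Cexp x = RtoC 1 -> Cmod x < 1 -> x = RtoC 0.
Proof.
  intros H Hx.
  assert (E : Re x = 0).
  { assert (M := Cmod_Cexp x). rewrite H, Cmod_1, <- exp_0 in M. symmetry. apply exp_inv, M. }
  assert (S : sin (Im x) = 0).
  { assert (I : Im (Cexp x) = 0) by (rewrite H; reflexivity).
    unfold Cexp, Im in I; simpl in I. rewrite E, exp_0, Rmult_1_l in I. exact I. }
  assert (Hi := im_le_Cmod x). assert (P := PI2_1).
  assert (Hi2 : Rabs (Im x) < 1) by lra. apply Rabs_lt_between in Hi2.
  apply Ceq; [exact E|]. simpl.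
  destruct (Rtotal_order (Im x) 0) as [L|[L|L]]; [|exact L|].
  - generalize (sin_lt_0_var (Im x)). lra.
  - generalize (sin_gt_0 (Im x)). lra.
Qed.

Lemma polar (x : C) : x <> RtoC 0 -> exists w, Cexp w = x.
Proof.
  intros Hx. apply Cmod_gt_0 in Hx.
  set (r := Cmod x) in *.
  assert (E : Re x ^ 2 + Im x ^ 2 = r ^ 2) by (unfold r; rewrite Cmod2_alt; reflexivity).
  set (u := Re x / r). set (v := Im x / r).
  assert (E2 : u ^ 2 + v ^ 2 = 1).
  { unfold u, v. replace ((Re x / r)^2 + (Im x / r)^2) with ((Re x^2 + Im x ^2) / r^2) by (field; lra).
    rewrite E. field. lra. }
  assert (Bu : -1 <= u <= 1) by nra.
  (* [acos] covers the upper half circle only; the sign of [v] selects the half. *)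
  assert (T : exists t, cos t = u /\ sin t = v).
  { destruct (Rle_dec 0 v).
    - exists (acos u). split. apply cos_acos, Bu. rewrite sin_acos by exact Bu.
      rewrite <- (sqrt_Rsqr v) by assumption. f_equal. unfold Rsqr. lra.
    - exists (- acos u). rewrite cos_neg, sin_neg. split. apply cos_acos, Bu.
      rewrite sin_acos by exact Bu. replace v with (- - v) by ring. f_equal.
      rewrite <- (sqrt_Rsqr (- v)) by lra. f_equal. unfold Rsqr. lra. }
  destruct T as [t [Tc Ts]].
  exists (ln r, t).
  apply Ceq; unfold Cexp; simpl; rewrite exp_ln by exact Hx; rewrite ?Tc, ?Ts; unfold u, v;
    unfold Re, Im; simpl; field; lra.
Qed.

(** * Complex integrals *)

Notation is_cint := (@is_RInt C_R_NormedModule).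
Notation cint := (@RInt C_R_CompleteNormedModule).
Notation rcont u t := (Cto (@locally R_UniformSpace t) u (u t)).

Lemma norm_C_R (x : C) : @norm R_AbsRing C_R_NormedModule x = Cmod x.
Proof.
  unfold norm; simpl. unfold prod_norm, norm; simpl. unfold abs; simpl.
  unfold Cmod. simpl. rewrite !Rmult_1_r.
  rewrite <- !Rabs_mult. f_equal. rewrite !Rabs_pos_eq; auto; apply Rle_0_sqr.
Qed.

Lemma cint_unique (u : R -> C) (a b : R) (l m : C) : is_cint u a b l -> is_cint u a b m -> l = m.
Proof.
  intros H1 H2. apply (@is_RInt_unique C_R_CompleteNormedModule) in H1.
  apply (@is_RInt_unique C_R_CompleteNormedModule) in H2. congruence.
Qed.

Lemma cint_plus (u v : R -> C) (a b : R) (l m : C) :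
  is_cint u a b l -> is_cint v a b m -> is_cint (fun t => u t + v t)%C a b (l + m)%C.
Proof. apply (@is_RInt_plus C_R_NormedModule). Qed.

Lemma cint_minus (u v : R -> C) (a b : R) (l m : C) :
  is_cint u a b l -> is_cint v a b m -> is_cint (fun t => u t - v t)%C a b (l - m)%C.
Proof. apply (@is_RInt_minus C_R_NormedModule). Qed.

Lemma cint_Re (u : R -> C) (a b : R) (l : C) : is_cint u a b l -> is_RInt (fun t => Re (u t)) a b (Re l).
Proof. apply (is_RInt_fct_extend_fst (U := R_NormedModule) (V := R_NormedModule)). Qed.

Lemma cint_Im (u : R -> C) (a b : R) (l : C) : is_cint u a b l -> is_RInt (fun t => Im (u t)) a b (Im l).
Proof. apply (is_RInt_fct_extend_snd (U := R_NormedModule) (V := R_NormedModule)). Qed.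

Lemma cint_pair (u : R -> C) (a b : R) (l : C) :
  is_RInt (fun t => Re (u t)) a b (Re l) -> is_RInt (fun t => Im (u t)) a b (Im l) -> is_cint u a b l.
Proof.
  intros. replace l with (Re l, Im l) by (destruct l; reflexivity).
  apply (is_RInt_fct_extend_pair (U := R_NormedModule) (V := R_NormedModule)); assumption.
Qed.

(** The integral lives in a module over the reals, so a complex scalar has to be treated through
    real and imaginary parts. *)
Lemma cint_scal (c : C) (u : R -> C) (a b : R) (l : C) :
  is_cint u a b l -> is_cint (fun t => c * u t)%C a b (c * l)%C.
Proof.
  intros H. assert (H1 := cint_Re _ _ _ _ H). assert (H2 := cint_Im _ _ _ _ H).
  apply cint_pair.
  - apply (is_RInt_ext (fun t => minus (scal (Re c) (Re (u t))) (scal (Im c) (Im (u t))))).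
    intros t _. rewrite re_mult. reflexivity.
    rewrite re_mult. apply (is_RInt_minus (V := R_NormedModule)); apply (is_RInt_scal (V := R_NormedModule)); assumption.
  - apply (is_RInt_ext (fun t => plus (scal (Re c) (Im (u t))) (scal (Im c) (Re (u t))))).
    intros t _. rewrite im_mult. reflexivity.
    rewrite im_mult. apply (is_RInt_plus (V := R_NormedModule)); apply (is_RInt_scal (V := R_NormedModule)); assumption.
Qed.

Lemma cint_conj (u : R -> C) (a b : R) (l : C) :
  is_cint u a b l -> is_cint (fun t => Cconj (u t)) a b (Cconj l).
Proof.
  intros H. assert (H1 := cint_Re _ _ _ _ H). assert (H2 := cint_Im _ _ _ _ H).
  apply cint_pair. exact H1. apply (is_RInt_opp (V := R_NormedModule)). exact H2.
Qed.

Lemma cint_const (c : C) (a b : R) : is_cint (fun _ => c) a b (RtoC (b - a) * c)%C.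
Proof. rewrite <- scal_R_Cmult. apply (is_RInt_const (V := C_R_NormedModule)). Qed.

Lemma cint_ext (u v : R -> C) (a b : R) (l : C) :
  (forall t, Rmin a b <= t <= Rmax a b -> u t = v t) -> is_cint u a b l -> is_cint v a b l.
Proof. intros H. apply is_RInt_ext. intros t Ht. apply H. lra. Qed.

Lemma cint_Chasles (u : R -> C) (a b c : R) (l m : C) :
  is_cint u a b l -> is_cint u b c m -> is_cint u a c (l + m)%C.
Proof. apply (@is_RInt_Chasles C_R_NormedModule). Qed.

Lemma cint_bound (u : R -> C) (a b : R) (l : C) (M : R) :
  a <= b -> (forall t, a <= t <= b -> Cmod (u t) <= M) -> is_cint u a b l -> Cmod l <= (b - a) * M.
Proof.
  intros Hab HM H. rewrite <- norm_C_R. apply (norm_RInt_le_const (V := C_R_NormedModule) u); auto.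
  intros t Ht. rewrite norm_C_R. auto.
Qed.

Lemma cint_bound_fun (u : R -> C) (g : R -> R) (a b : R) (l : C) (lg : R) :
  a <= b -> (forall t, a <= t <= b -> Cmod (u t) <= g t) -> is_cint u a b l -> is_RInt g a b lg ->
  Cmod l <= lg.
Proof.
  intros Hab HM H. rewrite <- norm_C_R. apply (norm_RInt_le (V := C_R_NormedModule) u); auto.
  intros t Ht. rewrite norm_C_R. auto.
Qed.

Lemma cint_cont (u : R -> C) (a b : R) :
  (forall t, Rmin a b <= t <= Rmax a b -> rcont u t) -> is_cint u a b (cint u a b).
Proof.
  intros H. apply (@RInt_correct C_R_CompleteNormedModule).
  apply (@ex_RInt_continuous C_R_CompleteNormedModule). intros t Ht.
  apply (Cto_filterlim (@locally R_UniformSpace t)). apply H, Ht.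
Qed.

Lemma rcont_bounded (u : R -> C) (a b : R) :
  (forall t, a <= t <= b -> rcont u t) -> exists M, forall t, a <= t <= b -> Cmod (u t) <= M.
Proof.
  intros H. destruct (bounded_continuity (V := C_R_NormedModule) u a b) as [M HM].
  - intros t Ht. apply (Cto_filterlim (@locally R_UniformSpace t)). apply H, Ht.
  - exists M. intros t Ht. left. rewrite <- norm_C_R. auto.
Qed.

Lemma rcont_real (u : R -> R) (t : R) : continuous u t -> rcont (fun s => RtoC (u s)) t.
Proof.
  intros H eps He. generalize (H (fun y => Rabs (y - u t) < eps)). intros K.
  unfold filtermap in K.
  generalize (K ltac:(exists (mkposreal eps He); intros y Hy; exact Hy)).
  apply filter_imp. intros s Hs. rewrite <- RtoC_minus, Cmod_R. exact Hs.
Qed.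

Lemma rcont_pair (u v : R -> R) (t : R) :
  continuous u t -> continuous v t -> rcont (fun s => (u s, v s)) t.
Proof.
  intros Hu Hv. assert (A := rcont_real _ _ Hu). assert (B := rcont_real _ _ Hv).
  apply (Cto_ext _ (fun s => RtoC (u s) + Ci * RtoC (v s))%C).
  intros s. apply Ceq; unfold Re, Im; simpl; ring.
  replace (u t, v t) with (RtoC (u t) + Ci * RtoC (v t))%C by (apply Ceq; unfold Re, Im; simpl; ring).
  capply Cto_plus. exact A. capply Cto_mult. capply Cto_const. exact B.
Qed.

Lemma rcont_comp (g : C -> C) (u : R -> C) (t : R) : rcont u t -> Ccont g (u t) -> rcont (fun s => g (u s)) t.
Proof. intros Hu Hg. apply (Cto_comp _ u (u t)); assumption. Qed.

Definition periodic2pi (u : R -> C) : Prop := forall t, u (t + 2 * PI) = u t.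

(** By periodicity the integrals over [0, c] and [2 pi, c + 2 pi] are equal; splitting [0, c + 2 pi]
    in two ways then cancels them. *)
Lemma cint_period_shift (u : R -> C) (c : R) (l : C) :
  (forall t, rcont u t) -> periodic2pi u -> is_cint u c (c + 2 * PI) l -> is_cint u 0 (2 * PI) l.
Proof.
  intros Hc Hp H.
  assert (H1 := cint_cont u 0 c (fun t _ => Hc t)).
  assert (H2 : is_cint u (2 * PI) (c + 2 * PI) (cint u 0 c)).
  { assert (K : is_cint (fun y => scal 1 (u (1 * y + - (2 * PI)))) (2 * PI) (c + 2 * PI) (cint u 0 c)).
    { apply (is_RInt_comp_lin (V := C_R_NormedModule)).
      replace (1 * (2 * PI) + - (2 * PI)) with 0 by ring.
      replace (1 * (c + 2 * PI) + - (2 * PI)) with c by ring. exact H1. }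
    apply (cint_ext _ u) in K. exact K. intros t _. etransitivity. apply (@scal_one R_Ring C_R_ModuleSpace).
    rewrite <- (Hp (1 * t + - (2 * PI))). f_equal. ring. }
  assert (H3 := cint_cont u 0 (2*PI) (fun t _ => Hc t)).
  assert (E := cint_unique _ _ _ _ _ (cint_Chasles _ _ _ _ _ _ H1 H) (cint_Chasles _ _ _ _ _ _ H3 H2)).
  assert (E2 : l = cint u 0 (2 * PI)).
  { set (p := cint u 0 c : C) in *. set (q := cint u 0 (2 * PI) : C) in *.
    replace l with (p + l - p)%C by ring. rewrite E. ring. }
  rewrite E2. exact H3.
Qed.

(** * Goursat's theorem *)

Definition hor (g : C -> C) (y a b : R) : C := cint (fun s => g (s, y)) a b.
Definition ver (g : C -> C) (x c d : R) : C := cint (fun t => g (x, t)) c d.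
(** The counterclockwise contour integral of g(w) dw: dw is ds along horizontal sides and i dt along
    vertical ones. *)
Definition bdry (g : C -> C) (a b c d : R) : C :=
  (hor g c a b - hor g d a b + Ci * (ver g b c d - ver g a c d))%C.

Definition on_rect (a b c d : R) (P : C -> Prop) : Prop :=
  forall s t, a <= s <= b -> c <= t <= d -> P (s, t).

Lemma hor_cint (g : C -> C) (y a b : R) :
  a <= b -> (forall s, a <= s <= b -> Ccont g (s, y)) -> is_cint (fun s => g (s, y)) a b (hor g y a b).
Proof.
  intros Hab H. apply cint_cont. rewrite Rmin_left, Rmax_right by exact Hab. intros t Ht.
  apply (rcont_comp g (fun s => (s, y))). apply rcont_pair. apply continuous_id. apply continuous_const.
  apply H, Ht.
Qed.

Lemma ver_cint (g : C -> C) (x c d : R) :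
  c <= d -> (forall t, c <= t <= d -> Ccont g (x, t)) -> is_cint (fun t => g (x, t)) c d (ver g x c d).
Proof.
  intros Hab H. apply cint_cont. rewrite Rmin_left, Rmax_right by exact Hab. intros t Ht.
  apply (rcont_comp g (fun s => (x, s))). apply rcont_pair. apply continuous_const. apply continuous_id.
  apply H, Ht.
Qed.

Lemma on_rect_sub (a b c d a' b' c' d' : R) (P : C -> Prop) :
  a <= a' -> b' <= b -> c <= c' -> d' <= d -> on_rect a b c d P -> on_rect a' b' c' d' P.
Proof. intros H1 H2 H3 H4 H s t Hs Ht. apply H; lra. Qed.

Lemma bdry_split_x (g : C -> C) (a m b c d : R) :
  a <= m <= b -> c <= d -> on_rect a b c d (fun w => Ccont g w) ->
  bdry g a b c d = (bdry g a m c d + bdry g m b c d)%C.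
Proof.
  intros Hm Hcd H.
  assert (E : forall y, c <= y <= d -> hor g y a b = (hor g y a m + hor g y m b)%C).
  { intros y Hy. apply (cint_unique (fun s => g (s, y)) a b).
    - apply hor_cint. lra. intros; apply H; lra.
    - apply cint_Chasles with m; apply hor_cint; try lra; intros; apply H; lra. }
  unfold bdry. rewrite (E c), (E d) by lra. ring.
Qed.

Lemma bdry_split_y (g : C -> C) (a b c m d : R) :
  a <= b -> c <= m <= d -> on_rect a b c d (fun w => Ccont g w) ->
  bdry g a b c d = (bdry g a b c m + bdry g a b m d)%C.
Proof.
  intros Hab Hm H.
  assert (E : forall x, a <= x <= b -> ver g x c d = (ver g x c m + ver g x m d)%C).
  { intros x Hx. apply (cint_unique (fun t => g (x, t)) c d).
    - apply ver_cint. lra. intros; apply H; lra.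
    - apply cint_Chasles with m; apply ver_cint; try lra; intros; apply H; lra. }
  unfold bdry. rewrite (E a), (E b) by lra. ring.
Qed.

Lemma is_RInt_linear (p q a b : R) :
  is_RInt (fun s => p + q * s) a b (p * (b - a) + q * (b ^ 2 - a ^ 2) / 2).
Proof.
  replace (p * (b - a) + q * (b ^ 2 - a ^ 2) / 2)
    with (minus (p * b + q * b ^ 2 / 2) (p * a + q * a ^ 2 / 2))
    by (unfold minus, plus, opp; simpl; field).
  apply (is_RInt_derive (V := R_CompleteNormedModule) (fun s => p * s + q * s ^ 2 / 2)).
  - intros x _. auto_derive; auto. field.
  - intros x _. apply (ex_derive_continuous (V := R_NormedModule)). auto_derive. auto.
Qed.

(* An affine function has a polynomial primitive, whose increments along the four sides cancel. *)
Lemma bdry_affine (g : C -> C) (p q : C) (eta a b c d : R) :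
  a <= b -> c <= d -> on_rect a b c d (fun w => Ccont g w) ->
  on_rect a b c d (fun w => Cmod (g w - (p + q * w)) <= eta) ->
  Cmod (bdry g a b c d) <= 2 * eta * ((b - a) + (d - c)).
Proof.
  intros Hab Hcd Hc He.
  destruct p as [p1 p2]. destruct q as [q1 q2].
  set (aff := fun w : C => ((p1, p2) + (q1, q2) * w)%C) in *.
  set (J := fun y : R => ((p1 - q2 * y) * (b - a) + q1 * (b ^ 2 - a ^ 2) / 2,
                 (p2 + q1 * y) * (b - a) + q2 * (b ^ 2 - a ^ 2) / 2) : C).
  set (K := fun x : R => ((p1 + q1 * x) * (d - c) + - q2 * (d ^ 2 - c ^ 2) / 2,
                 (p2 + q2 * x) * (d - c) + q1 * (d ^ 2 - c ^ 2) / 2) : C).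
  assert (HJ : forall y, is_cint (fun s => aff (s, y)) a b (J y)).
  { intros y. apply cint_pair; unfold J, aff, Re, Im; simpl.
    - eapply is_RInt_ext. 2: apply is_RInt_linear. intros s _. simpl. ring.
    - eapply is_RInt_ext. 2: apply is_RInt_linear. intros s _. simpl. ring. }
  assert (HK : forall x, is_cint (fun t => aff (x, t)) c d (K x)).
  { intros x. apply cint_pair; unfold K, aff, Re, Im; simpl.
    - eapply is_RInt_ext. 2: apply is_RInt_linear. intros s _. simpl. ring.
    - eapply is_RInt_ext. 2: apply is_RInt_linear. intros s _. simpl. ring. }
  assert (EH : forall y, c <= y <= d -> Cmod (hor g y a b - J y) <= (b - a) * eta).
  { intros y Hy. apply (cint_bound (fun s => g (s, y) - aff (s, y))%C a b); [exact Hab| |].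
    - intros t Ht. apply He; lra.
    - apply cint_minus; auto. apply hor_cint; auto. }
  assert (EV : forall x, a <= x <= b -> Cmod (ver g x c d - K x) <= (d - c) * eta).
  { intros x Hx. apply (cint_bound (fun s => g (x, s) - aff (x, s))%C c d); [exact Hcd| |].
    - intros t Ht. apply He; lra.
    - apply cint_minus; auto. apply ver_cint; auto. }
  assert (Z : (J c - J d + Ci * (K b - K a) = 0)%C).
  { apply Ceq; unfold J, K, Re, Im; simpl; field. }
  replace (bdry g a b c d) with ((hor g c a b - J c) - (hor g d a b - J d)
     + Ci * ((ver g b c d - K b) - (ver g a c d - K a)))%C.
  2: { transitivity (bdry g a b c d - (J c - J d + Ci * (K b - K a)))%C.
       unfold bdry; ring. rewrite Z. ring. }
  eapply Rle_trans. apply Cmod_triangle. rewrite Cmod_mult, Cmod_Ci, Rmult_1_l.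
  assert (A1 := Cmod_triangle_minus (hor g c a b - J c) (hor g d a b - J d)).
  assert (A2 := Cmod_triangle_minus (ver g b c d - K b) (ver g a c d - K a)).
  assert (B1 := EH c ltac:(lra)). assert (B2 := EH d ltac:(lra)).
  assert (B3 := EV a ltac:(lra)). assert (B4 := EV b ltac:(lra)). lra.
Qed.

Record rect := Rect { xl : R; xr : R; yl : R; yr : R }.
Definition rb (g : C -> C) (q : rect) : C := bdry g (xl q) (xr q) (yl q) (yr q).

Definition quarter (i j : bool) (q : rect) : rect :=
  let mx := (xl q + xr q) / 2 in let my := (yl q + yr q) / 2 in
  Rect (if i then mx else xl q) (if i then xr q else mx)
       (if j then my else yl q) (if j then yr q else my).

(** A choice by decidable comparison makes the nested rectangles of Goursat's proof a plain
    iteration. The last quarter is taken without a test; [worst_bound] justifies it. *)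
Definition worst (g : C -> C) (q : rect) : rect :=
  let ok i j := Rle_dec (Cmod (rb g q) / 4) (Cmod (rb g (quarter i j q))) in
  if ok true true then quarter true true q
  else if ok true false then quarter true false q
  else if ok false true then quarter false true q
  else quarter false false q.

Lemma worst_is_quarter (g : C -> C) (q : rect) : exists i j, worst g q = quarter i j q.
Proof. unfold worst. repeat destruct Rle_dec; eauto. Qed.

(** The four quarter integrals add up to the whole one, so if three of them are below a quarter of
    its modulus, the fourth is not. *)
Lemma worst_bound (g : C -> C) (q : rect) :
  xl q <= xr q -> yl q <= yr q -> on_rect (xl q) (xr q) (yl q) (yr q) (fun w => Ccont g w) ->
  Cmod (rb g q) / 4 <= Cmod (rb g (worst g q)).
Proof.
  intros Hx Hy Hc.
  assert (E : rb g q = (rb g (quarter false false q) + rb g (quarter false true q)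
    + (rb g (quarter true false q) + rb g (quarter true true q)))%C).
  { unfold rb, quarter; simpl.
    rewrite (bdry_split_x g _ ((xl q + xr q) / 2)) by (auto; lra).
    rewrite (bdry_split_y g (xl q) _ _ ((yl q + yr q) / 2)); [|lra|lra|].
    rewrite (bdry_split_y g _ (xr q) _ ((yl q + yr q) / 2)); [reflexivity|lra|lra|].
    eapply on_rect_sub. 5: apply Hc. all: try lra.
    eapply on_rect_sub. 5: apply Hc. all: lra. }
  unfold worst. destruct Rle_dec as [r1|r1]; [exact r1|]. destruct Rle_dec as [r2|r2]; [exact r2|].
  destruct Rle_dec as [r3|r3]; [exact r3|].
  assert (T : Cmod (rb g q) <= Cmod (rb g (quarter false false q)) + Cmod (rb g (quarter false true q))
    + (Cmod (rb g (quarter true false q)) + Cmod (rb g (quarter true true q)))).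
  { rewrite E at 1. eapply Rle_trans. apply Cmod_triangle. apply Rplus_le_compat; apply Cmod_triangle. }
  lra.
Qed.

Lemma pow2_arch (M eps : R) : 0 < eps -> exists n, M / 2 ^ n < eps.
Proof.
  intros He. destruct (Rle_dec M 0).
  - exists 0%nat. simpl. lra.
  - destruct (Pow_x_infinity 2 ltac:(rewrite Rabs_pos_eq; lra) (M / eps + 1)) as [k Hn].
    specialize (Hn k (Nat.le_refl k)). rewrite Rabs_pos_eq in Hn by (apply pow_le; lra).
    exists k. assert (P : 0 < 2 ^ k) by (apply pow_lt; lra).
    apply Rmult_lt_reg_r with (2 ^ k). exact P. unfold Rdiv. rewrite Rmult_assoc, Rinv_l, Rmult_1_r by lra.
    apply Rmult_lt_reg_r with (/ eps). apply Rinv_0_lt_compat, He.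
    replace (eps * 2 ^ k * / eps) with (2 ^ k) by (field; lra). unfold Rdiv in Hn. lra.
Qed.

Lemma nested_limit (u v : nat -> R) :
  (forall n, u n <= u (S n)) -> (forall n, v (S n) <= v n) -> (forall n, u n <= v n) ->
  exists x, forall n, u n <= x <= v n.
Proof.
  intros Hu Hv Huv.
  assert (Mu : forall n k, u n <= u (n + k)%nat).
  { intros n k. induction k. rewrite Nat.add_0_r. lra. rewrite Nat.add_succ_r. eapply Rle_trans; eauto. }
  assert (Mv : forall n k, v (n + k)%nat <= v n).
  { intros n k. induction k. rewrite Nat.add_0_r. lra. rewrite Nat.add_succ_r. eapply Rle_trans; eauto. }
  assert (Uv : forall n m, u n <= v m).
  { intros n m. apply Rle_trans with (u (n + m)%nat). apply Mu.
    apply Rle_trans with (v (n + m)%nat). apply Huv. rewrite Nat.add_comm. apply Mv. }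
  destruct (completeness (fun x => exists n, x = u n)) as [x [H1 H2]].
  - exists (v 0%nat). intros y [n ->]. apply Uv.
  - exists (u 0%nat), 0%nat. reflexivity.
  - exists x. intros n. split. apply H1. exists n. reflexivity.
    apply H2. intros y [k ->]. apply Uv.
Qed.

Theorem goursat (g : C -> C) (a b c d : R) :
  a <= b -> c <= d -> on_rect a b c d (fun w => exists l, cderiv g w l) -> bdry g a b c d = RtoC 0.
Proof.
  intros Hab Hcd Hd.
  assert (Hc : on_rect a b c d (fun w => Ccont g w)).
  { intros s t Hs Ht. destruct (Hd s t Hs Ht) as [l Hl]. apply (cderiv_cont _ _ _ Hl). }
  set (q := fun n => Nat.iter n (worst g) (Rect a b c d)).
  set (L := (b - a) + (d - c)).
  assert (HL : 0 <= L) by (unfold L; lra).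
  assert (I : forall n, a <= xl (q n) /\ xl (q n) <= xr (q n) /\ xr (q n) <= b /\
     c <= yl (q n) /\ yl (q n) <= yr (q n) /\ yr (q n) <= d /\
     (xr (q n) - xl (q n)) + (yr (q n) - yl (q n)) = L / 2 ^ n).
  { induction n. simpl. unfold L. repeat split; lra || (simpl; field).
    change (q (S n)) with (worst g (q n)). destruct (worst_is_quarter g (q n)) as [i [j ->]].
    replace (L / 2 ^ S n) with (L / 2 ^ n / 2) by (simpl; field; apply pow_nonzero; lra).
    unfold quarter; destruct i, j; simpl; repeat split; lra. }
  assert (B : forall n, Cmod (bdry g a b c d) / 4 ^ n <= Cmod (rb g (q n))).
  { induction n. simpl. unfold rb; simpl. lra.
    change (q (S n)) with (worst g (q n)).
    eapply Rle_trans. 2: apply worst_bound; try apply I.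
    - simpl. replace (Cmod (bdry g a b c d) / (4 * 4 ^ n)) with (Cmod (bdry g a b c d) / 4 ^ n / 4).
      lra. field. apply pow_nonzero. lra.
    - eapply on_rect_sub. 5: apply Hc. all: apply I. }
  destruct (nested_limit (fun n => xl (q n)) (fun n => xr (q n))) as [x Hx].
  { intros n. change (q (S n)) with (worst g (q n)). destruct (worst_is_quarter g (q n)) as [i [j ->]].
    generalize (I n). unfold quarter; destruct i, j; simpl; lra. }
  { intros n. change (q (S n)) with (worst g (q n)). destruct (worst_is_quarter g (q n)) as [i [j ->]].
    generalize (I n). unfold quarter; destruct i, j; simpl; lra. }
  { intros n. apply I. }
  destruct (nested_limit (fun n => yl (q n)) (fun n => yr (q n))) as [y Hy].
  { intros n. change (q (S n)) with (worst g (q n)). destruct (worst_is_quarter g (q n)) as [i [j ->]].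
    generalize (I n). unfold quarter; destruct i, j; simpl; lra. }
  { intros n. change (q (S n)) with (worst g (q n)). destruct (worst_is_quarter g (q n)) as [i [j ->]].
    generalize (I n). unfold quarter; destruct i, j; simpl; lra. }
  { intros n. apply I. }
  apply NNPP. intros N. apply Cmod_gt_0 in N. set (m := Cmod (bdry g a b c d)) in *.
  destruct (Hd x y) as [l Hl].
  { generalize (Hx 0%nat). simpl. lra. }
  { generalize (Hy 0%nat). simpl. lra. }
  (* With h = L / 2^n, the affine estimate bounds m / 4^n by 2 (eps h) h, that is m <= 2 eps L^2,
     whereas m = 4 eps (L^2 + 1). The summand 1 keeps the denominator positive when L = 0. *)
  set (eps := m / (4 * (L ^ 2 + 1))).
  assert (Heps : 0 < eps) by (apply Rdiv_lt_0_compat; nra).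
  destruct (proj1 (nb_iff _ _) (cderiv_elim _ _ _ Hl eps Heps)) as [del [Hdel D]].
  destruct (pow2_arch L del Hdel) as [n Hn].
  assert (In := I n). assert (Hxn := Hx n). assert (Hyn := Hy n). assert (Bn := B n).
  set (h := L / 2 ^ n) in *.
  assert (Up : Cmod (rb g (q n)) <= 2 * (eps * h) * h).
  { unfold rb. replace h with ((xr (q n) - xl (q n)) + (yr (q n) - yl (q n))) at 2 by lra.
    apply bdry_affine with (p := (g (x, y) - l * (x, y))%C) (q := l); try lra.
    - destruct In as (i1 & i2 & i3 & i4 & i5 & i6 & i7). apply (on_rect_sub a b c d); try assumption.
    - intros s t Hs Ht.
      assert (S : Cmod ((s, t) - (x, y)) <= h).
      { eapply Rle_trans. apply Cmod_le_Re_Im. unfold Re, Im; simpl.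
        assert (Rabs (s + - x) <= xr (q n) - xl (q n)) by (apply Rabs_le; lra).
        assert (Rabs (t + - y) <= yr (q n) - yl (q n)) by (apply Rabs_le; lra). lra. }
      replace (g (s, t) - (g (x, y) - l * (x, y) + l * (s, t)))%C
        with (g (s, t) - g (x, y) - l * ((s, t) - (x, y)))%C by ring.
      eapply Rle_trans. apply D. lra. apply Rmult_le_compat_l; lra. }
  assert (P2 : 0 < 2 ^ n) by (apply pow_lt; lra).
  assert (E4 : 4 ^ n = 2 ^ n * 2 ^ n) by (rewrite <- Rpow_mult_distr; f_equal; ring).
  assert (m <= 2 * eps * L ^ 2).
  { replace (2 * (eps * h) * h) with (2 * eps * L ^ 2 / 4 ^ n) in Up by (unfold h; rewrite E4; field; lra).
    apply Rmult_le_reg_r with (/ 4 ^ n). apply Rinv_0_lt_compat, pow_lt; lra. unfold Rdiv in *. lra. }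
  assert (m = 4 * eps * (L ^ 2 + 1)) by (unfold eps; field; nra). nra.
Qed.

Lemma pos_lower_bound (l : list R) :
  (forall u, In u l -> 0 < u) -> exists e, 0 < e /\ forall u, In u l -> e <= u.
Proof.
  induction l as [|v l IH]; intros H.
  - exists 1. split. lra. contradiction.
  - destruct IH as [e [He H2]]. intros u Hu; apply H; right; exact Hu.
    assert (Hv := H v (or_introl eq_refl)).
    exists (Rmin e v). split. apply Rmin_glb_lt; assumption.
    intros u [<-|Hu]. apply Rmin_r. eapply Rle_trans. apply Rmin_l. auto.
Qed.

(** A small square around the exceptional point carries the whole integral, and continuity alone
    makes that integral small. This is needed for difference quotients, whose differentiability at
    the base point is not yet known. *)
Theorem goursat_except (g : C -> C) (a b c d : R) (x y : R) :
  a < x < b -> c < y < d -> on_rect a b c d (fun w => Ccont g w) ->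
  on_rect a b c d (fun w => w <> (x, y) -> exists l, cderiv g w l) ->
  bdry g a b c d = RtoC 0.
Proof.
  intros Hx Hy Hc Hd. apply NNPP. intros N. apply Cmod_gt_0 in N.
  destruct (proj1 (nb_iff _ _) (Hc x y ltac:(lra) ltac:(lra) 1 Rlt_0_1)) as [del [Hdel B]].
  set (M := Cmod (g (x, y)) + 1).
  assert (HM : 0 < M) by (unfold M; generalize (Cmod_ge_0 (g (x, y))); lra).
  set (m := Cmod (bdry g a b c d)) in *.
  (* The bound del/4 keeps the square inside the disc where |g| <= M; the bound m/(16 M) makes its
     integral, at most 8 M e, no larger than m/2. *)
  destruct (pos_lower_bound (x - a :: b - x :: y - c :: d - y :: del / 4 :: m / (16 * M) :: nil))
    as [e [He L]].
  { intros u Hu. simpl in Hu. decompose [or] Hu; subst; try lra; try contradiction.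
    apply Rdiv_lt_0_compat; lra. }
  assert (L1 := L (x - a) ltac:(simpl; tauto)). assert (L2 := L (b - x) ltac:(simpl; tauto)).
  assert (L3 := L (y - c) ltac:(simpl; tauto)). assert (L4 := L (d - y) ltac:(simpl; tauto)).
  assert (L5 := L (del / 4) ltac:(simpl; tauto)). assert (L6 := L (m / (16 * M)) ltac:(simpl; tauto)).
  assert (Z : forall a' b' c' d', a <= a' <= b' -> b' <= b -> c <= c' <= d' -> d' <= d ->
    (x < a' \/ b' < x \/ y < c' \/ d' < y) -> bdry g a' b' c' d' = RtoC 0).
  { intros a' b' c' d' H1 H2 H3 H4 H5. apply goursat; try lra. intros s t Hs Ht. apply Hd; try lra.
    intros E. injection E. intros. lra. }
  assert (E : bdry g a b c d = bdry g (x - e) (x + e) (y - e) (y + e)).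
  { rewrite (bdry_split_x g a (x - e) b) by (auto; lra).
    rewrite (bdry_split_x g (x - e) (x + e) b) by (try lra; apply (on_rect_sub a b c d); try lra; exact Hc).
    rewrite (bdry_split_y g (x - e) (x + e) c (y - e) d) by (try lra; apply (on_rect_sub a b c d); try lra; exact Hc).
    rewrite (bdry_split_y g (x - e) (x + e) (y - e) (y + e) d) by (try lra; apply (on_rect_sub a b c d); try lra; exact Hc).
    rewrite (Z a (x - e)), (Z (x + e) b), (Z (x - e) (x + e) c (y - e)), (Z (x - e) (x + e) (y + e) d) by lra.
    ring. }
  assert (U : m <= 2 * M * (((x + e) - (x - e)) + ((y + e) - (y - e)))).
  { unfold m. rewrite E. apply bdry_affine with (p := RtoC 0) (q := RtoC 0); try lra.
    - apply (on_rect_sub a b c d); [lra..|exact Hc].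
    - intros s t Hs Ht. replace (g (s, t) - (0 + 0 * (s, t)))%C with (g (s, t)) by ring.
      assert (S : Cmod ((s, t) - (x, y)) < del).
      { eapply Rle_lt_trans. apply Cmod_le_Re_Im. unfold Re, Im; simpl.
        assert (Rabs (s + - x) <= e) by (apply Rabs_le; lra).
        assert (Rabs (t + - y) <= e) by (apply Rabs_le; lra). lra. }
      apply B in S. generalize (Cmod_rev_triangle (g (s, t)) (g (x, y))). unfold M. lra. }
  apply Rmult_le_compat_r with (r := 16 * M) in L6; [|lra].
  replace (m / (16 * M) * (16 * M)) with m in L6 by (field; lra). lra.
Qed.

(** * Cauchy's formula *)

Definition cir (r t : R) : C := (r * cos t, r * sin t).

Lemma cir_Cexp (r t : R) : 0 < r -> cir r t = Cexp (ln r, t).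
Proof. intros Hr. unfold Cexp, cir. simpl. rewrite exp_ln by exact Hr. reflexivity. Qed.

Lemma Cmod_cir (r t : R) : 0 < r -> Cmod (cir r t) = r.
Proof. intros Hr. rewrite cir_Cexp, Cmod_Cexp by exact Hr. apply exp_ln, Hr. Qed.

Lemma cir_neq0 (r t : R) : 0 < r -> cir r t <> RtoC 0.
Proof. intros Hr. apply Cmod_gt_0. rewrite Cmod_cir; assumption. Qed.

Lemma rcont_cir (r t : R) : rcont (cir r) t.
Proof.
  apply rcont_pair; apply (ex_derive_continuous (V := R_NormedModule)); auto_derive; auto.
Qed.

Lemma cir_periodic (r : R) : periodic2pi (cir r).
Proof. intros t. unfold cir. rewrite cos_plus, sin_plus, cos_2PI, sin_2PI. f_equal; ring. Qed.

(** The range is closed and the sine also vanishes at pi and -pi, so the cosine has to decide: 1 - 2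
    sin^2(Im x / 2) = 1 with Im x / 2 in [-pi/2, pi/2]. *)
Lemma Cexp_eq1_PI (x : C) : Cexp x = RtoC 1 -> - PI <= Im x <= PI -> x = RtoC 0.
Proof.
  intros H Hx. apply Cexp_eq1. exact H.
  assert (E : Re x = 0).
  { assert (M := Cmod_Cexp x). rewrite H, Cmod_1, <- exp_0 in M. symmetry. apply exp_inv, M. }
  assert (S : cos (Im x) = 1).
  { assert (I : Re (Cexp x) = 1) by (rewrite H; reflexivity).
    unfold Cexp, Re in I; simpl in I. fold (Re x) in I. rewrite E, exp_0, Rmult_1_l in I. exact I. }
  replace (Im x) with (2 * (Im x / 2)) in S by field. rewrite cos_2a_sin in S.
  assert (S2 : sin (Im x / 2) = 0) by nra.
  assert (I0 : Im x = 0).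
  { assert (P := PI_RGT_0).
    destruct (Rtotal_order (Im x) 0) as [L|[L|L]]; [|exact L|].
    - generalize (sin_lt_0_var (Im x / 2)). lra.
    - generalize (sin_gt_0 (Im x / 2)). lra. }
  eapply Rle_lt_trans. apply Cmod_le_Re_Im. rewrite E, I0, Rabs_R0. lra.
Qed.

(* In the logarithmic coordinate w = log z the circles become vertical segments, the horizontal
   sides of the rectangle cancel by periodicity, and the left side tends to z = 0. *)
Lemma circle_mean_zero (k : C -> C) (r : R) (x : C) :
  0 < r -> Cmod x < r -> (forall z, Cmod z <= r -> Ccont k z) ->
  (forall z, Cmod z <= r -> z <> x -> exists l, cderiv k z l) -> k (RtoC 0) = RtoC 0 ->
  is_cint (fun t => k (cir r t)) 0 (2 * PI) (RtoC 0).
Proof.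
  intros Hr Hx Hc Hd H0.
  assert (PP := PI_RGT_0).
  (* [w0] is the only logarithm of [x] in a closed strip of height 2 pi centred at it. For x = 0
     there is none, and [w0] is any point to the left of Re w = ln r. *)
  assert (W : exists w0, Re w0 < ln r /\
     forall w, Im w0 - PI <= Im w <= Im w0 + PI -> Cexp w = x -> w = w0).
  { destruct (Ceq_dec x 0) as [E|N].
    - exists (ln r - 1, 0). simpl. split. lra. intros w _ Ew. rewrite E in Ew. destruct (Cexp_neq0 _ Ew).
    - destruct (polar x N) as [w0 Hw]. exists w0. split.
      + apply exp_lt_inv. rewrite exp_ln, <- Cmod_Cexp, Hw; assumption.
      + intros w Hw1 Hw2. assert (Z : (w - w0)%C = RtoC 0).
        { apply Cexp_eq1_PI. unfold Cminus. rewrite Cexp_plus, Cexp_opp, Hw2, Hw. apply Cinv_r, N.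
          unfold Cminus. rewrite im_plus, im_opp. lra. }
        apply Ceq_minus, Z. }
  destruct W as [w0 [Hw0 W]].
  set (g := fun w => k (Cexp w)). set (c := Im w0 - PI) in *.
  assert (Rad : forall s t, s <= ln r -> Cmod (Cexp (s, t)) <= r).
  { intros s t Hs. rewrite Cmod_Cexp. simpl. rewrite <- (exp_ln r) by exact Hr.
    destruct Hs as [Hs | ->]. left. apply exp_increasing, Hs. right. reflexivity. }
  assert (Cg : forall s t, s <= ln r -> Ccont g (s, t)).
  { intros s t Hs. apply (Cto_comp _ Cexp (Cexp (s, t))). apply Ccont_Cexp. apply Hc, Rad, Hs. }
  assert (V : forall s, s < Re w0 -> ver g (ln r) c (c + 2 * PI) = ver g s c (c + 2 * PI)).
  { intros s Hs.
    assert (B : bdry g s (ln r) c (c + 2 * PI) = RtoC 0).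
    { apply goursat_except with (x := Re w0) (y := Im w0).
      - lra.
      - unfold c. lra.
      - intros s' t' Hs' _. apply Cg. lra.
      - intros s' t' Hs' Ht' N. destruct (Hd (Cexp (s', t'))) as [l Hl].
        + apply Rad. lra.
        + intros E. apply N. rewrite (W (s', t')); [destruct w0; reflexivity| |exact E].
          simpl. unfold c in *. lra.
        + exists (l * Cexp (s', t'))%C. apply (cderiv_comp Cexp k). apply cderiv_Cexp. exact Hl. }
    assert (Hh : hor g (c + 2 * PI) s (ln r) = hor g c s (ln r)).
    { unfold hor. f_equal. extensionality t. unfold g. f_equal. apply (cir_periodic (exp t) c). }
    unfold bdry in B. rewrite Hh in B.
    assert (Z : (ver g (ln r) c (c + 2 * PI) - ver g s c (c + 2 * PI))%C = RtoC 0).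
    { set (u := (ver g (ln r) c (c + 2 * PI) - ver g s c (c + 2 * PI))%C) in *.
      replace u with ((hor g c s (ln r) - hor g c s (ln r) + Ci * u) / Ci)%C by (field; apply Ci_nz).
      rewrite B. field. apply Ci_nz. }
    apply Ceq_minus, Z. }
  assert (Iv : forall s, s <= ln r -> is_cint (fun t => g (s, t)) c (c + 2 * PI) (ver g s c (c + 2 * PI))).
  { intros s Hs. apply ver_cint. lra. intros t _. apply Cg, Hs. }
  assert (Z : ver g (ln r) c (c + 2 * PI) = RtoC 0).
  { apply NNPP. intros N. apply Cmod_gt_0 in N. set (m := Cmod (ver g (ln r) c (c + 2 * PI))) in *.
    set (eps := m / (4 * PI)). assert (He : 0 < eps) by (apply Rdiv_lt_0_compat; lra).
    assert (C0 : Ccont k (RtoC 0)) by (apply Hc; rewrite Cmod_0; lra).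
    destruct (proj1 (nb_iff _ _) (C0 eps He)) as [del [Hdel D]].
    (* Far enough to the left to pass [w0] and to have |exp(w)| < del; the integral there is at most
       2 pi eps = m/2. *)
    set (s := Rmin (Re w0) (ln del) - 1).
    assert (s < Re w0) by (unfold s; generalize (Rmin_l (Re w0) (ln del)); lra).
    assert (s < ln del) by (unfold s; generalize (Rmin_r (Re w0) (ln del)); lra).
    assert (U : m <= ((c + 2 * PI) - c) * eps).
    { unfold m. rewrite (V s) by lra. apply (cint_bound (fun t => g (s, t))). lra.
      - intros t _. left. specialize (D (Cexp (s, t))). rewrite H0 in D.
        replace (Cexp (s, t) - 0)%C with (Cexp (s, t)) in D by ring.
        replace (k (Cexp (s, t)) - 0)%C with (k (Cexp (s, t))) in D by ring.
        apply D. rewrite Cmod_Cexp. simpl. rewrite <- (exp_ln del) by exact Hdel. apply exp_increasing. assumption.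
      - apply Iv. lra. }
    assert (m = 4 * PI * eps) by (unfold eps; field; lra). nra. }
  assert (I := Iv (ln r) (Rle_refl _)). rewrite Z in I.
  apply (cint_ext _ (fun t => k (cir r t))) in I.
  2: { intros t _. unfold g. rewrite cir_Cexp by exact Hr. reflexivity. }
  apply cint_period_shift in I. exact I.
  - intros t. apply (rcont_comp k (cir r)). apply rcont_cir. apply Hc. rewrite Cmod_cir; lra.
  - intros t. f_equal. apply cir_periodic.
Qed.

Definition holo_on (r : R) (f : C -> C) : Prop := forall z, Cmod z < r -> exists l, cderiv f z l.

Lemma holo_on_cont (r : R) (f : C -> C) (z : C) : holo_on r f -> Cmod z < r -> Ccont f z.
Proof. intros H Hz. destruct (H z Hz) as [l Hl]. apply (cderiv_cont _ _ _ Hl). Qed.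

Lemma sub_neq0_of_Cmod (x z : C) : Cmod x < Cmod z -> (z - x)%C <> RtoC 0.
Proof. intros H. apply Cminus_eq_contra. intros E. subst. lra. Qed.

(** On the circle dz = i z dt, so dz/(z - x) is i times this kernel times dt; the factor 2 pi i of
    Cauchy's formula becomes 2 pi. *)
Definition Cauchy_kernel (x z : C) : C := (z / (z - x))%C.

Lemma rcont_kernel (r t : R) (x : C) : Cmod x < r -> rcont (fun t => Cauchy_kernel x (cir r t)) t.
Proof.
  intros Hx. assert (Hr : 0 < r) by (generalize (Cmod_ge_0 x); lra).
  unfold Cauchy_kernel. capply Cto_div. apply rcont_cir. capply Cto_minus. apply rcont_cir. capply Cto_const.
  apply sub_neq0_of_Cmod. rewrite Cmod_cir; assumption.
Qed.

(* The complex conjugate of z / (z - x) - 1 on the circle of radius r is x' z / (r^2 - x' z) with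
   x' the conjugate of x, which is holomorphic in the disc and vanishes at 0. *)
Lemma cint_kernel (r : R) (x : C) :
  Cmod x < r -> is_cint (fun t => Cauchy_kernel x (cir r t)) 0 (2 * PI) (RtoC (2 * PI)).
Proof.
  intros Hx. assert (Hr : 0 < r) by (generalize (Cmod_ge_0 x); lra).
  set (y := Cconj x).
  assert (N : forall z, Cmod z <= r -> (RtoC (r * r) - y * z)%C <> RtoC 0).
  { intros z Hz. apply sub_neq0_of_Cmod. unfold y. rewrite Cmod_mult, Cmod_conj, Cmod_R, Rabs_pos_eq by nra.
    generalize (Cmod_ge_0 x) (Cmod_ge_0 z). nra. }
  assert (D : forall z, Cmod z <= r -> exists l, cderiv (fun z => y * z / (RtoC (r * r) - y * z))%C z l).
  { intros z Hz. eexists. apply (cderiv_mult (fun z => y * z)%C).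
    apply cderiv_scal, cderiv_id. apply cderiv_inv. apply cderiv_minus. apply cderiv_const.
    apply cderiv_scal, cderiv_id. apply N, Hz. }
  assert (K : is_cint (fun t => y * cir r t / (RtoC (r * r) - y * cir r t))%C 0 (2 * PI) (RtoC 0)).
  { apply (circle_mean_zero (fun z => y * z / (RtoC (r * r) - y * z))%C r 0); auto.
    - rewrite Cmod_0. exact Hr.
    - intros z Hz. destruct (D z Hz) as [l Hl]. apply (cderiv_cont _ _ _ Hl).
    - unfold Cdiv. rewrite Cmult_0_r, Cmult_0_l. reflexivity. }
  apply cint_conj in K.
  assert (Z := cint_plus _ _ _ _ _ _ K (cint_const (RtoC 1) 0 (2 * PI))).
  apply (cint_ext _ (fun t => Cauchy_kernel x (cir r t))) in Z.
  - replace (RtoC (2 * PI)) with (Cconj 0 + RtoC (2 * PI - 0) * 1)%C. exact Z.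
    apply Ceq; simpl; ring.
  - intros t _. assert (M := Cmod_cir r t Hr).
    assert (N1 : (cir r t - x)%C <> RtoC 0) by (apply sub_neq0_of_Cmod; lra).
    assert (N2 := cir_neq0 r t Hr).
    assert (M2 : (cir r t * Cconj (cir r t))%C = RtoC (r * r)).
    { rewrite <- Cmod2_conj, M. f_equal. ring. }
    rewrite Cdiv_conj, Cmult_conj, Cminus_conj, Cmult_conj by (apply N; lra).
    replace (Cconj (RtoC (r * r))) with (RtoC (r * r)) by (apply Ceq; simpl; ring).
    unfold y. rewrite Cconj_conj, <- M2. unfold Cauchy_kernel.
    assert (N3 : Cconj (cir r t) <> RtoC 0) by (apply Cmod_gt_0; rewrite Cmod_conj; lra).
    field. split; [exact N1|].
    replace (cir r t * Cconj (cir r t) - x * Cconj (cir r t))%C with ((cir r t - x) * Cconj (cir r t))%C by ring.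
    apply Cmult_neq_0; assumption.
Qed.

Theorem cauchy_formula (f : C -> C) (R0 r : R) (x : C) :
  holo_on R0 f -> Cmod x < r < R0 ->
  is_cint (fun t => f (cir r t) * Cauchy_kernel x (cir r t))%C 0 (2 * PI) (RtoC (2 * PI) * f x)%C.
Proof.
  intros Hf [Hx HR]. assert (Hr : 0 < r) by (generalize (Cmod_ge_0 x); lra).
  destruct (Hf x ltac:(lra)) as [l Hl].
  (* The difference quotient of [f] at [x] times z, completed by its limit. The factor z, coming
     from dz, gives k(0) = 0, as [circle_mean_zero] requires. *)
  set (k := fun z => if Ceq_dec z x then (x * l)%C else ((f z - f x) * Cauchy_kernel x z)%C).
  assert (Dk : forall z, Cmod z <= r -> z <> x -> exists m, cderiv k z m).
  { intros z Hz N. destruct (Hf z ltac:(lra)) as [m Hm]. assert (N' := Cminus_eq_contra _ _ N).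
    eexists. apply (cderiv_ext_loc (fun z => (f z - f x) * (z * / (z - x)))%C).
    - apply nb_iff. exists (Cmod (z - x)). split. apply Cmod_gt_0, N'.
      intros y Hy. unfold k. destruct (Ceq_dec y x) as [E|E]; [|reflexivity].
      subst. rewrite Cmod_minus_sym in Hy. lra.
    - apply (cderiv_mult (fun z => f z - f x)%C (fun z => z * / (z - x))%C).
      apply cderiv_minus. exact Hm. apply cderiv_const.
      apply (cderiv_mult (fun z => z)). apply cderiv_id. apply cderiv_inv.
      apply cderiv_minus. apply cderiv_id. apply cderiv_const. exact N'. }
  assert (Ck : forall z, Cmod z <= r -> Ccont k z).
  { intros z Hz. destruct (Ceq_dec z x) as [E|N].
    - subst z. destruct Hl as [phi [P1 P2]].
      assert (Ex : k x = (x * l)%C) by (unfold k; destruct (Ceq_dec x x); congruence).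
      (* The slope [phi] represents [k] off [x] as z phi(z), which transfers its limit to [k]. *)
      assert (Ephi : nb x (fun z => (if Ceq_dec z x then x * l else z * phi z) = k z)%C).
      { revert P2. apply filter_imp. intros z Ez. unfold k. destruct (Ceq_dec z x) as [E|N]. reflexivity.
        rewrite Ez. unfold Cauchy_kernel. field. apply Cminus_eq_contra, N. }
      rewrite Ex. apply (Cto_ext_loc _ _ _ _ Ephi).
      assert (T : Cto (nb x) (fun z => z * phi z)%C (x * l)%C).
      { capply Cto_mult. apply Cto_id. exact P1. }
      intros eps He. generalize (T eps He). apply filter_imp. intros z Hz'.
      destruct (Ceq_dec z x); [|exact Hz']. replace (x * l - x * l)%C with (RtoC 0) by ring. rewrite Cmod_0. exact He.
    - destruct (Dk z Hz N) as [m Hm]. apply (cderiv_cont _ _ _ Hm). }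
  assert (K : is_cint (fun t => k (cir r t)) 0 (2 * PI) (RtoC 0)).
  { apply (circle_mean_zero k r x); auto. unfold k. destruct (Ceq_dec 0 x) as [E|N].
    rewrite <- E. ring. unfold Cauchy_kernel. field. intros E. apply N.
    replace x with (- (0 - x))%C by ring. change (RtoC 0 - x)%C with (0 - x)%C. rewrite E. ring. }
  assert (Z := cint_plus _ _ _ _ _ _ K (cint_scal (f x) _ _ _ _ (cint_kernel r x Hx))).
  replace (RtoC (2 * PI) * f x)%C with (0 + f x * RtoC (2 * PI))%C by ring.
  eapply cint_ext. 2: exact Z. intros t _. simpl. unfold k.
  destruct (Ceq_dec (cir r t) x) as [E|N].
  - exfalso. assert (M := Cmod_cir r t Hr). rewrite E in M. lra.
  - ring.
Qed.

(** * Power series *)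

(** The sum of the first n terms, with the empty sum at 0; [sum_n u n] has one term more. *)
Fixpoint psum (u : nat -> C) (n : nat) : C :=
  match n with O => RtoC 0 | S n' => (psum u n' + u n')%C end.

Notation csums u l := (Cto eventually (psum u) l).

Lemma psum_sum_n (u : nat -> C) (n : nat) : psum u (S n) = @sum_n C_AbelianMonoid u n.
Proof.
  induction n.
  - rewrite sum_O. simpl. apply Cplus_0_l.
  - rewrite sum_Sn, <- IHn. reflexivity.
Qed.

Lemma eventually_S (P : nat -> Prop) : eventually P <-> eventually (fun n => P (S n)).
Proof.
  split; intros [N H].
  - exists N. intros n Hn. apply H. lia.
  - exists (S N). intros [|n] Hn. lia. apply H. lia.
Qed.

Lemma Cto_S (u : nat -> C) (l : C) : Cto eventually u l -> Cto eventually (fun n => u (S n)) l.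
Proof. intros H eps He. apply (proj1 (eventually_S _) (H eps He)). Qed.

Lemma csums_is_series (u : nat -> C) (l : C) : csums u l <-> @is_series C_AbsRing C_NormedModule u l.
Proof.
  unfold is_series. rewrite <- (Cto_filterlim eventually (fun n => @sum_n C_AbelianMonoid u n) l).
  unfold Cto. split; intros H eps He; specialize (H eps He).
  - apply (proj1 (eventually_S _)) in H. revert H. apply filter_imp. intros n. rewrite psum_sum_n. auto.
  - apply eventually_S. revert H. apply filter_imp. intros n. rewrite psum_sum_n. auto.
Qed.

Lemma csums_unique (u : nat -> C) (l m : C) : csums u l -> csums u m -> l = m.
Proof. apply (Cto_unique eventually). Qed.

Lemma psum_ext (u v : nat -> C) (n : nat) : (forall k, (k < n)%nat -> u k = v k) -> psum u n = psum v n.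
Proof.
  induction n; intros H. reflexivity. simpl. rewrite IHn. rewrite H. reflexivity. lia. intros; apply H; lia.
Qed.

Lemma psum_plus (u v : nat -> C) (n : nat) : psum (fun k => u k + v k)%C n = (psum u n + psum v n)%C.
Proof. induction n; simpl. ring. rewrite IHn. ring. Qed.

Lemma psum_scal (c : C) (u : nat -> C) (n : nat) : psum (fun k => c * u k)%C n = (c * psum u n)%C.
Proof. induction n; simpl. ring. rewrite IHn. ring. Qed.

Lemma psum_minus (u v : nat -> C) (n : nat) : psum (fun k => u k - v k)%C n = (psum u n - psum v n)%C.
Proof. induction n; simpl. ring. rewrite IHn. ring. Qed.

Lemma psum_swap (u : nat -> nat -> C) (n m : nat) :
  psum (fun i => psum (u i) m) n = psum (fun j => psum (fun i => u i j) n) m.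
Proof.
  induction n; simpl.
  - induction m; simpl; auto. rewrite <- IHm. ring.
  - rewrite IHn, <- psum_plus. reflexivity.
Qed.

Lemma psum_shift (u : nat -> C) (n : nat) : psum u (S n) = (u O + psum (fun k => u (S k)) n)%C.
Proof. induction n. simpl. ring. change (psum u (S (S n))) with (psum u (S n) + u (S n))%C. rewrite IHn. simpl. ring. Qed.

(** [v] acts as a discrete primitive of a bound for |u|, and its increments telescope. *)
Lemma psum_dist (u : nat -> C) (v : nat -> R) (n m : nat) :
  (n <= m)%nat -> (forall k, (n <= k < m)%nat -> Cmod (u k) <= v (S k) - v k) ->
  Cmod (psum u m - psum u n) <= v m - v n.
Proof.
  intros Hnm. induction Hnm as [|m Hnm IH]; intros H.
  - replace (psum u n - psum u n)%C with (RtoC 0) by ring. rewrite Cmod_0. lra.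
  - simpl. replace (psum u m + u m - psum u n)%C with ((psum u m - psum u n) + u m)%C by ring.
    eapply Rle_trans. apply Cmod_triangle.
    assert (Cmod (psum u m - psum u n) <= v m - v n) by (apply IH; intros; apply H; lia).
    assert (Cmod (u m) <= v (S m) - v m) by (apply H; lia). lra.
Qed.

Lemma psum_geom_bound (u : nat -> C) (B q : R) (n m : nat) :
  0 <= q < 1 -> 0 <= B -> (n <= m)%nat -> (forall k, (n <= k)%nat -> Cmod (u k) <= B * q ^ k) ->
  Cmod (psum u m - psum u n) <= B * q ^ n / (1 - q).
Proof.
  intros Hq HB Hnm H.
  (* Minus the tail of the geometric series, whose increment at k is exactly B q^k. *)
  eapply Rle_trans. apply (psum_dist u (fun k => - (B * q ^ k / (1 - q)))). exact Hnm.
  - intros k Hk. eapply Rle_trans. apply H. lia. simpl. right. field. lra.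
  - simpl. assert (0 <= B * q ^ m / (1 - q)); [|lra].
    apply Rdiv_le_0_compat; [|lra]. apply Rmult_le_pos. exact HB. apply pow_le. lra.
Qed.

Lemma Cto_closed (u : nat -> C) (l a : C) (B : R) :
  Cto eventually u l -> eventually (fun n => Cmod (u n - a) <= B) -> Cmod (l - a) <= B.
Proof.
  intros Hu HB. apply Rnot_lt_le. intros N.
  assert (He : 0 < Cmod (l - a) - B) by lra.
  destruct (filter_ex _ (filter_and _ _ (Hu _ He) HB)) as [n [A1 A2]].
  generalize (Cmod_triangle_minus (u n - a) (u n - l)).
  replace (u n - a - (u n - l))%C with (l - a)%C by ring. lra.
Qed.

Lemma csums_geom (u : nat -> C) (B q : R) :
  0 <= q < 1 -> 0 <= B -> (forall k, Cmod (u k) <= B * q ^ k) ->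
  exists l, csums u l /\ forall n, Cmod (l - psum u n) <= B * q ^ n / (1 - q).
Proof.
  intros Hq HB H.
  assert (E : ex_series (V := C_CompleteNormedModule) u).
  { apply (ex_series_le u (fun k => B * q ^ k)). exact H.
    apply (ex_series_scal B (fun k => q ^ k)). apply ex_series_geom. rewrite Rabs_pos_eq; lra. }
  destruct E as [l Hl]. apply csums_is_series in Hl. exists l. split. exact Hl.
  intros n. apply (Cto_closed (psum u)). exact Hl. exists n. intros m Hm.
  apply psum_geom_bound; auto.
Qed.

Lemma csums_bounded (u : nat -> C) (l : C) : csums u l -> exists B, 0 <= B /\ forall n, Cmod (u n) <= B.
Proof.
  intros H. apply (Cto_filterlim eventually) in H.
  destruct (filterlim_bounded (V := C_NormedModule) (psum u) (ex_intro _ l H)) as [M HM].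
  change (forall n, Cmod (psum u n) <= M) in HM.
  exists (2 * M). split. generalize (HM 0%nat) (Cmod_ge_0 (psum u 0)). lra.
  intros n. replace (u n) with (psum u (S n) - psum u n)%C by (simpl; ring).
  eapply Rle_trans. apply Cmod_triangle_minus. generalize (HM n) (HM (S n)). lra.
Qed.

(** Bernoulli's inequality n h <= (1 + h)^n with s = q (1 + h) = (1 + q)/2. It absorbs the factor n
    produced by differentiating a power series. *)
Lemma nat_geom (q : R) : 0 <= q < 1 -> exists K s, 0 <= s < 1 /\ 0 <= K /\ forall n, INR n * q ^ n <= K * s ^ n.
Proof.
  intros Hq. destruct (Req_dec q 0) as [E|N].
  - exists 0, 0. repeat split; try lra. intros [|n]; simpl. lra. rewrite E. right. ring.
  - set (s := (1 + q) / 2). set (h := s / q - 1).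
    assert (Hh : 0 < h).
    { unfold h, s. replace ((1 + q) / 2 / q - 1) with ((1 - q) / (2 * q)) by (field; lra).
      apply Rdiv_lt_0_compat; lra. }
    exists (/ h), s. assert (0 < / h) by (apply Rinv_0_lt_compat, Hh). unfold s; repeat split; try lra. fold s.
    intros n. assert (B : INR n * h <= (1 + h) ^ n).
    { generalize (poly n h Hh). lra. }
    replace s with (q * (1 + h)) by (unfold h; field; exact N). rewrite Rpow_mult_distr.
    assert (0 <= q ^ n) by (apply pow_le; lra).
    apply Rmult_le_reg_l with h. exact Hh.
    replace (h * (/ h * (q ^ n * (1 + h) ^ n))) with (q ^ n * (1 + h) ^ n) by (field; lra). nra.
Qed.

Definition pterm (c : nat -> C) (x : C) (n : nat) : C := (c n * x ^ n)%C.
Definition pseries (r : R) (f : C -> C) (c : nat -> C) : Prop :=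
  forall x, Cmod x < r -> csums (pterm c x) (f x).
(** The radius of convergence is at least [r], put as boundedness of the terms on each smaller
    circle (Abel's criterion). *)
Definition pbound (r : R) (c : nat -> C) : Prop :=
  forall rho, 0 < rho < r -> exists M, 0 <= M /\ forall n, Cmod (c n) * rho ^ n <= M.

Lemma Cmod_pterm (c : nat -> C) (x : C) (n : nat) : Cmod (pterm c x n) = Cmod (c n) * Cmod x ^ n.
Proof. unfold pterm. rewrite Cmod_mult, Cmod_pow. reflexivity. Qed.

Lemma Cmod_RtoC_pos (r : R) : 0 <= r -> Cmod (RtoC r) = r.
Proof. intros. rewrite Cmod_R. apply Rabs_pos_eq. assumption. Qed.

Lemma pseries_pbound (r : R) (f : C -> C) (c : nat -> C) : pseries r f c -> pbound r c.
Proof.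
  intros H rho Hr. destruct (csums_bounded (pterm c (RtoC rho)) (f (RtoC rho))) as [B [HB K]].
  apply H. rewrite Cmod_RtoC_pos; lra. exists B. split. exact HB.
  intros n. specialize (K n). rewrite Cmod_pterm, Cmod_RtoC_pos in K by lra. exact K.
Qed.

(** Boundedness on a circle of radius s between rho and r gives decay with ratio rho/s. *)
Lemma pbound_geom (r rho : R) (c : nat -> C) :
  pbound r c -> 0 < rho < r -> exists M q, 0 <= M /\ 0 < q < 1 /\ forall n, Cmod (c n) * rho ^ n <= M * q ^ n.
Proof.
  intros H Hr. set (s := (rho + r) / 2). destruct (H s) as [M [HM K]]. unfold s; lra.
  assert (Hs : 0 < s) by (unfold s; lra).
  exists M, (rho / s). split. exact HM. split.
  split. apply Rdiv_lt_0_compat; lra. apply Rmult_lt_reg_r with s. exact Hs.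
  unfold Rdiv. rewrite Rmult_assoc, Rinv_l, Rmult_1_r by lra. unfold s; lra.
  intros n. replace (Cmod (c n) * rho ^ n) with (Cmod (c n) * s ^ n * (rho / s) ^ n).
  apply Rmult_le_compat_r. apply pow_le. apply Rdiv_le_0_compat; lra. apply K.
  unfold Rdiv. rewrite Rpow_mult_distr, pow_inv. field. apply pow_nonzero. lra.
Qed.

(* Arbitrary if the series diverges. *)
Definition psumlim (u : nat -> C) : C := epsilon (inhabits (RtoC 0)) (fun l => csums u l).

Lemma psumlim_correct (u : nat -> C) (l : C) : csums u l -> csums u (psumlim u).
Proof. intros H. exact (epsilon_spec (inhabits (RtoC 0)) (fun l => csums u l) (ex_intro _ l H)). Qed.

Lemma Cmod_between (x : C) (r : R) : Cmod x < r -> exists rho, 0 < rho < r /\ Cmod x < rho.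
Proof. intros H. exists ((Cmod x + r) / 2). generalize (Cmod_ge_0 x). lra. Qed.

Lemma pbound_pseries (r : R) (c : nat -> C) : pbound r c -> pseries r (fun x => psumlim (pterm c x)) c.
Proof.
  intros H x Hx. destruct (Cmod_between x r Hx) as [rho [H1 H2]].
  destruct (pbound_geom r rho c H H1) as [M [q [HM [Hq K]]]].
  destruct (csums_geom (pterm c x) M q) as [l [Hl _]]; auto. lra.
  - intros k. eapply Rle_trans. 2: apply K. rewrite Cmod_pterm. apply Rmult_le_compat_l. apply Cmod_ge_0.
    apply pow_incr. generalize (Cmod_ge_0 x). lra.
  - apply (psumlim_correct _ l Hl).
Qed.

(** By strong induction the series starts at degree n; at a small real point t its first term would
    dominate the rest. *)
Lemma pseries_zero (r : R) (e : nat -> C) :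
  0 < r -> pseries r (fun _ => RtoC 0) e -> forall n, e n = RtoC 0.
Proof.
  intros Hr H. assert (Hb := pseries_pbound _ _ _ H).
  destruct (pbound_geom r (r / 2) e Hb ltac:(lra)) as [M [q [HM [Hq K]]]].
  assert (K' : forall n, Cmod (e n) <= M * (2 / r) ^ n).
  { intros n. specialize (K n). assert (0 < (r / 2) ^ n) by (apply pow_lt; lra).
    apply Rmult_le_reg_r with ((r / 2) ^ n). assumption.
    rewrite Rmult_assoc, <- Rpow_mult_distr. replace (2 / r * (r / 2)) with 1 by (field; lra). rewrite pow1, Rmult_1_r.
    eapply Rle_trans. apply K. rewrite <- (Rmult_1_r M) at 2. apply Rmult_le_compat_l. exact HM.
    rewrite <- (pow1 n). apply pow_incr. lra. }
  intros n. induction n as [n IH] using lt_wf_ind.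
  apply NNPP. intros N. apply Cmod_gt_0 in N. set (m := Cmod (e n)) in *.
  (* For t <= r/4 the tail is at most twice its first bound, so m t^n <= T t^(n+1), while t <=
     m/(2T) makes T t at most m/2. *)
  set (T := 2 * M * (2 / r) ^ (S n) + 1).
  assert (HT : 1 <= T).
  { unfold T. assert (0 <= (2 / r) ^ S n) by (apply pow_le, Rdiv_le_0_compat; lra).
    assert (0 <= M * (2 / r) ^ S n) by (apply Rmult_le_pos; assumption). lra. }
  destruct (pos_lower_bound (r / 4 :: m / (2 * T) :: nil)) as [t [Ht L]].
  { intros u Hu. simpl in Hu. decompose [or] Hu; subst; try lra; try contradiction. apply Rdiv_lt_0_compat; lra. }
  assert (L1 := L (r / 4) ltac:(simpl; tauto)). assert (L2 := L (m / (2 * T)) ltac:(simpl; tauto)).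
  assert (Hx := H (RtoC t)). rewrite Cmod_RtoC_pos in Hx by lra. specialize (Hx ltac:(lra)).
  assert (P0 : psum (pterm e (RtoC t)) (S n) = pterm e (RtoC t) n).
  { simpl. replace (psum (pterm e (RtoC t)) n) with (psum (fun _ => RtoC 0) n).
    - assert (Z : forall j, psum (fun _ => RtoC 0) j = RtoC 0). { induction j; simpl; auto. rewrite IHj. ring. }
      rewrite Z. ring.
    - apply psum_ext. intros k Hk. unfold pterm. rewrite (IH k Hk). ring. }
  set (q2 := 2 / r * t).
  assert (Hq2 : 0 <= q2 <= 1/2).
  { unfold q2. split. apply Rmult_le_pos. apply Rdiv_le_0_compat; lra. lra.
    apply Rmult_le_reg_r with r. exact Hr. replace (2 / r * t * r) with (2 * t) by (field; lra). lra. }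
  assert (U : Cmod (RtoC 0 - psum (pterm e (RtoC t)) (S n)) <= M * q2 ^ (S n) / (1 - q2)).
  { apply (Cto_closed (psum (pterm e (RtoC t)))). exact Hx. exists (S n). intros j Hj.
    apply psum_geom_bound; auto. lra. intros k _. rewrite Cmod_pterm, Cmod_RtoC_pos by lra.
    unfold q2. rewrite Rpow_mult_distr, <- Rmult_assoc. apply Rmult_le_compat_r. apply pow_le. lra. apply K'. }
  rewrite P0 in U. replace (RtoC 0 - pterm e (RtoC t) n)%C with (- pterm e (RtoC t) n)%C in U by ring.
  rewrite Cmod_opp, Cmod_pterm, Cmod_RtoC_pos in U by lra. fold m in U.
  assert (U2 : M * q2 ^ S n / (1 - q2) <= 2 * M * q2 ^ S n).
  { assert (0 <= M * q2 ^ S n) by (apply Rmult_le_pos; [exact HM | apply pow_le; lra]).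
    apply Rmult_le_reg_r with (1 - q2). lra. unfold Rdiv. rewrite Rmult_assoc, Rinv_l by lra. nra. }
  assert (U3 : m * t ^ n <= 2 * M * (2 / r) ^ S n * t * t ^ n).
  { assert (E : q2 ^ S n = (2 / r) ^ S n * (t * t ^ n)) by (unfold q2; rewrite Rpow_mult_distr; reflexivity).
    rewrite E in *. lra. }
  assert (Pt : 0 < t ^ n) by (apply pow_lt; exact Ht).
  apply Rmult_le_reg_r in U3; [|exact Pt].
  assert (m <= T * t) by (unfold T; nra).
  apply Rmult_le_compat_l with (r := 2 * T) in L2; [|lra].
  replace (2 * T * (m / (2 * T))) with m in L2 by (field; lra). lra.
Qed.

Lemma pseries_unique (r : R) (f : C -> C) (c d : nat -> C) :
  0 < r -> pseries r f c -> pseries r f d -> forall n, c n = d n.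
Proof.
  intros Hr Hc Hd n. apply Ceq_minus.
  apply (pseries_zero r (fun n => c n - d n)%C Hr). intros x Hx.
  replace (RtoC 0) with (f x - f x)%C by ring.
  apply (Cto_ext _ (fun n => psum (pterm c x) n - psum (pterm d x) n)%C).
  - intros k. rewrite <- psum_minus. apply psum_ext. intros j _. unfold pterm. ring.
  - capply Cto_minus. apply Hc, Hx. apply Hd, Hx.
Qed.

Lemma pseries_at0 (r : R) (f : C -> C) (c : nat -> C) : 0 < r -> pseries r f c -> f (RtoC 0) = c O.
Proof.
  intros Hr H. specialize (H (RtoC 0) ltac:(rewrite Cmod_0; exact Hr)).
  apply (csums_unique _ _ _ H). intros eps He. exists 1%nat. intros [|n] Hn. lia.
  rewrite psum_shift.
  assert (Z : forall j, psum (fun k => pterm c 0 (S k)) j = RtoC 0).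
  { induction j; simpl; auto. rewrite IHj. unfold pterm. rewrite Cpow_S. ring. }
  rewrite Z. unfold pterm. simpl. replace (c O * 1 + 0 - c O)%C with (RtoC 0) by ring. rewrite Cmod_0. exact He.
Qed.

(** Second-order Taylor bound for powers, by induction on the exponent. The factor [rho] on the left
    stands for the exponent n - 1 on the right. *)
Lemma pow_increment (n : nat) (x k : C) (rho : R) :
  Cmod x <= rho -> Cmod (x + k) <= rho ->
  Cmod ((x + k) ^ S n - x ^ S n - INR (S n) * k * x ^ n) * rho <= INR (S n) * INR n * Cmod k ^ 2 * rho ^ n.
Proof.
  intros Hx Hxk. assert (Hr : 0 <= rho) by (generalize (Cmod_ge_0 x); lra).
  induction n.
  - rewrite Cpow_1_r, Cpow_1_r. simpl. replace (x + k - x - 1 * k * 1)%C with (RtoC 0) by ring.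
    rewrite Cmod_0. lra.
  - set (A := ((x + k) ^ S n - x ^ S n - INR (S n) * k * x ^ n)%C) in *.
    replace ((x + k) ^ S (S n) - x ^ S (S n) - INR (S (S n)) * k * x ^ S n)%C
      with ((x + k) * A + INR (S n) * k ^ 2 * x ^ n)%C.
    2: { unfold A. rewrite (S_INR (S n)), RtoC_plus, !Cpow_S. simpl (k ^ 0)%C. ring. }
    assert (T := Cmod_triangle ((x + k) * A) (INR (S n) * k ^ 2 * x ^ n)).
    rewrite !Cmod_mult, !Cmod_pow, (Cmod_RtoC_pos (INR (S n))) in T by apply pos_INR.
    assert (B1 : Cmod (x + k) * (Cmod A * rho) <= rho * (INR (S n) * INR n * Cmod k ^ 2 * rho ^ n)).
    { apply Rmult_le_compat; auto. apply Cmod_ge_0. apply Rmult_le_pos; [apply Cmod_ge_0|exact Hr]. }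
    assert (B2 : Cmod x ^ n <= rho ^ n) by (apply pow_incr; generalize (Cmod_ge_0 x); lra).
    assert (P1 := pos_INR n). rewrite (S_INR (S n)), (S_INR n) in *.
    assert (P2 : 0 <= (INR n + 1) * Cmod k ^ 2) by (apply Rmult_le_pos; [lra | apply pow2_ge_0]).
    assert (B3 : (INR n + 1) * Cmod k ^ 2 * Cmod x ^ n <= (INR n + 1) * Cmod k ^ 2 * rho ^ n)
      by (apply Rmult_le_compat_l; assumption).
    apply Rle_trans with ((Cmod (x + k) * Cmod A + (INR n + 1) * Cmod k ^ 2 * Cmod x ^ n) * rho).
    apply Rmult_le_compat_r; assumption.
    assert (P3 : 0 <= rho ^ n) by (apply pow_le; exact Hr).
    assert (B4 : (INR n + 1) * Cmod k ^ 2 * Cmod x ^ n * rho <= (INR n + 1) * Cmod k ^ 2 * rho ^ n * rho)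
      by (apply Rmult_le_compat_r; assumption).
    change (rho ^ S n) with (rho * rho ^ n).
    assert (Q : 0 <= (INR n + 1) * Cmod k ^ 2 * rho ^ n * rho)
      by (apply Rmult_le_pos; [apply Rmult_le_pos|]; assumption).
    nra.
Qed.

Definition dcoef (c : nat -> C) (n : nat) : C := (INR (S n) * c (S n))%C.

Lemma pbound_shift (r : R) (c : nat -> C) : pbound r c -> pbound r (fun n => c (S n)).
Proof.
  intros H rho Hr. destruct (H rho Hr) as [M [HM K]]. exists (M / rho). split. apply Rdiv_le_0_compat; lra.
  intros n. specialize (K (S n)). simpl in K. apply Rmult_le_reg_r with rho. lra.
  unfold Rdiv. rewrite (Rmult_assoc M), Rinv_l by lra. lra.
Qed.

Lemma pbound_dcoef (r : R) (c : nat -> C) : pbound r c -> pbound r (dcoef c).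
Proof.
  intros H. intros rho Hr. destruct (pbound_geom r rho (fun n => c (S n)) (pbound_shift _ _ H) Hr) as [M [q [HM [Hq K]]]].
  destruct (nat_geom q ltac:(lra)) as [B [s [Hs [HB G]]]].
  exists (M * (B + 1)). split. apply Rmult_le_pos; lra.
  intros n. unfold dcoef. rewrite Cmod_mult, Cmod_RtoC_pos by apply pos_INR.
  assert (P := pos_INR (S n)). rewrite Rmult_assoc.
  apply Rle_trans with (INR (S n) * (M * q ^ n)). apply Rmult_le_compat_l; auto.
  specialize (G n). assert (s ^ n <= 1) by (rewrite <- (pow1 n); apply pow_incr; lra).
  assert (q ^ n <= 1) by (rewrite <- (pow1 n); apply pow_incr; lra).
  assert (0 <= s ^ n) by (apply pow_le; lra).
  rewrite S_INR. replace ((INR n + 1) * (M * q ^ n)) with (M * (INR n * q ^ n + q ^ n)) by ring.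
  apply Rmult_le_compat_l. exact HM. nra.
Qed.

(** Summing [pow_increment] against the coefficients bounds the remainder by T |y - x|^2; the factor
    n is absorbed by [nat_geom]. *)
Lemma pseries_deriv (r : R) (F H : C -> C) (c : nat -> C) (x : C) :
  pseries r F c -> pseries r H (dcoef c) -> Cmod x < r -> cderiv F x (H x).
Proof.
  intros HF HH Hx. destruct (Cmod_between x r Hx) as [rho [Hr Hxr]].
  destruct (pbound_geom r rho (dcoef c) (pseries_pbound _ _ _ HH) Hr) as [M [q [HM [Hq K]]]].
  destruct (nat_geom q ltac:(lra)) as [B [s [Hs [HB G]]]].
  set (T := M * B / rho / (1 - s) + 1).
  assert (HMB : 0 <= M * B / rho).
  { apply Rdiv_le_0_compat. apply Rmult_le_pos; assumption. lra. }
  assert (HT : 0 < T).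
  { unfold T. assert (0 <= M * B / rho / (1 - s)); [|lra]. apply Rdiv_le_0_compat; [exact HMB|lra]. }
  assert (Q : forall y, Cmod y <= rho -> Cmod (F y - F x - H x * (y - x)) <= T * Cmod (y - x) ^ 2).
  { intros y Hy. set (k := (y - x)%C).
    set (u := fun n => (c (S n) * (y ^ S n - x ^ S n - INR (S n) * k * x ^ n))%C).
    assert (Hu : Cto eventually (fun n => psum u n) (F y - F x - k * H x)%C).
    { apply (Cto_ext _ (fun n => psum (pterm c y) (S n) - psum (pterm c x) (S n) - k * psum (pterm (dcoef c) x) n)%C).
      - intros n. rewrite !psum_shift.
        replace (pterm c y 0) with (pterm c x 0) by (unfold pterm; simpl; ring).
        transitivity (psum (fun j => pterm c y (S j)) n - psum (fun j => pterm c x (S j)) n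
          - k * psum (pterm (dcoef c) x) n)%C. ring.
        rewrite <- psum_scal, <- psum_minus, <- psum_minus. apply psum_ext. intros j _.
        unfold pterm, dcoef, u. ring.
      - capply Cto_minus. capply Cto_minus.
        + apply (Cto_S (psum (pterm c y))), HF; lra.
        + apply (Cto_S (psum (pterm c x))), HF; lra.
        + capply Cto_mult. capply Cto_const. apply HH; lra. }
    assert (Bu : forall n, Cmod (u n) <= (M * B / rho * Cmod k ^ 2) * s ^ n).
    { intros n. unfold u. rewrite Cmod_mult.
      assert (P := pow_increment n x k rho ltac:(lra)). replace (x + k)%C with y in P by (unfold k; ring).
      specialize (P Hy). set (D := Cmod (y ^ S n - x ^ S n - INR (S n) * k * x ^ n)) in *.
      specialize (K n). unfold dcoef in K. rewrite Cmod_mult, Cmod_RtoC_pos in K by apply pos_INR.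
      specialize (G n).
      apply Rmult_le_reg_r with rho. lra.
      replace (M * B / rho * Cmod k ^ 2 * s ^ n * rho) with (M * (B * s ^ n) * Cmod k ^ 2) by (field; lra).
      apply Rle_trans with (Cmod (c (S n)) * (INR (S n) * INR n * Cmod k ^ 2 * rho ^ n)).
      rewrite Rmult_assoc. apply Rmult_le_compat_l. apply Cmod_ge_0. exact P.
      apply Rle_trans with ((M * q ^ n) * (INR n * Cmod k ^ 2)).
      replace (Cmod (c (S n)) * (INR (S n) * INR n * Cmod k ^ 2 * rho ^ n))
        with ((INR (S n) * Cmod (c (S n)) * rho ^ n) * (INR n * Cmod k ^ 2)) by ring.
      apply Rmult_le_compat_r. apply Rmult_le_pos. apply pos_INR. apply pow2_ge_0. exact K.
      replace (M * q ^ n * (INR n * Cmod k ^ 2)) with (M * (INR n * q ^ n) * Cmod k ^ 2) by ring.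
      apply Rmult_le_compat_r. apply pow2_ge_0. apply Rmult_le_compat_l; assumption. }
    replace (F y - F x - H x * k)%C with (F y - F x - k * H x - 0)%C by ring.
    eapply Rle_trans.
    - apply (Cto_closed (psum u)). exact Hu. exists 0%nat. intros n _.
      apply (psum_geom_bound u (M * B / rho * Cmod k ^ 2) s 0 n); auto.
      apply Rmult_le_pos. exact HMB. apply pow2_ge_0. lia.
    - simpl (s ^ 0). unfold T. assert (0 <= Cmod k ^ 2) by apply pow2_ge_0.
      replace (M * B / rho * Cmod k ^ 2 * 1 / (1 - s)) with (M * B / rho / (1 - s) * Cmod k ^ 2) by (field; lra). fold k. nra. }
  apply cderiv_intro. intros eps He. apply nb_iff.
  exists (Rmin (rho - Cmod x) (eps / T)). split. apply Rmin_glb_lt. lra. apply Rdiv_lt_0_compat; assumption.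
  intros y Hy.
  assert (H1 : Cmod (y - x) < rho - Cmod x) by (eapply Rlt_le_trans; [apply Hy|apply Rmin_l]).
  assert (H2 : Cmod (y - x) < eps / T) by (eapply Rlt_le_trans; [apply Hy|apply Rmin_r]).
  eapply Rle_trans. apply Q. generalize (Cmod_rev_triangle y x). lra.
  apply Rmult_lt_compat_l with (r := T) in H2; [|exact HT].
  replace (T * (eps / T)) with eps in H2 by (field; lra).
  generalize (Cmod_ge_0 (y - x)). nra.
Qed.

Lemma pseries_holo (r : R) (F : C -> C) (c : nat -> C) : pseries r F c -> holo_on r F.
Proof.
  intros H x Hx. exists (psumlim (pterm (dcoef c) x)).
  apply (pseries_deriv r F (fun x => psumlim (pterm (dcoef c) x)) c x H); [|exact Hx].
  apply pbound_pseries, pbound_dcoef, (pseries_pbound _ _ _ H).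
Qed.

(** Cauchy's integral for the n-th Taylor coefficient; since dz = i z dt, the exponent n + 1 of the
    contour integral drops to n. *)
Definition mcoef (f : C -> C) (r : R) (n : nat) : C :=
  (cint (fun t => f (cir r t) / cir r t ^ n) 0 (2 * PI) / RtoC (2 * PI))%C.

Lemma two_PI_neq0 : RtoC (2 * PI) <> RtoC 0.
Proof. intros E. apply RtoC_inj in E. generalize PI_RGT_0. lra. Qed.

Lemma Cmult_div_cancel (c x : C) : c <> RtoC 0 -> (c * (x / c))%C = x.
Proof. intros. field. assumption. Qed.

Section CircleCoefficients.
Context (f : C -> C) (R0 r : R) (Hf : holo_on R0 f) (Hr : 0 < r < R0).

Lemma rcont_circle (t : R) : rcont (fun t => f (cir r t)) t.
Proof.
  apply (rcont_comp f (cir r)). apply rcont_cir. apply (holo_on_cont R0 f). exact Hf. rewrite Cmod_cir; lra.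
Qed.

Lemma rcont_fpow (n : nat) (t : R) : rcont (fun t => f (cir r t) / cir r t ^ n)%C t.
Proof.
  capply Cto_div. apply rcont_circle. capply Cto_pow. apply rcont_cir. apply Cpow_nz, cir_neq0. lra.
Qed.

Lemma mcoef_cint (n : nat) :
  is_cint (fun t => f (cir r t) / cir r t ^ n)%C 0 (2 * PI) (RtoC (2 * PI) * mcoef f r n)%C.
Proof.
  unfold mcoef. rewrite Cmult_div_cancel by apply two_PI_neq0. apply cint_cont. intros; apply rcont_fpow.
Qed.

(** The kernel satisfies K = 1 + (x/z) K. Each use splits off one coefficient and raises the power
    of z in the remainder by one. *)
Lemma taylor_rem (x : C) (N : nat) :
  Cmod x < r -> exists rem,
    is_cint (fun t => f (cir r t) / cir r t ^ N * Cauchy_kernel x (cir r t))%C 0 (2 * PI) (RtoC (2 * PI) * rem)%C /\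
    f x = (psum (pterm (mcoef f r) x) N + x ^ N * rem)%C.
Proof.
  intros Hx. induction N as [|N [rem [I E]]].
  - exists (f x). split.
    + eapply cint_ext. 2: apply (cauchy_formula f R0 r x Hf); lra.
      intros t _. simpl. field.
    + simpl. ring.
  - set (u := fun t => (f (cir r t) / cir r t ^ S N * Cauchy_kernel x (cir r t))%C).
    assert (Cu : forall t, rcont u t).
    { intros t. unfold u. capply Cto_mult. apply rcont_fpow. apply rcont_kernel. exact Hx. }
    assert (Iu := cint_cont u 0 (2 * PI) (fun t _ => Cu t)). set (J := cint u 0 (2 * PI) : C) in *.
    exists (J / RtoC (2 * PI))%C. split.
    + replace (RtoC (2 * PI) * (J / RtoC (2 * PI)))%C with J by (field; apply two_PI_neq0). exact Iu.
    + assert (Er : (RtoC (2 * PI) * rem = RtoC (2 * PI) * mcoef f r N + x * J)%C).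
      { apply (cint_unique _ _ _ _ _ I). eapply cint_ext.
        2: apply (cint_plus _ _ _ _ _ _ (mcoef_cint N) (cint_scal x _ _ _ _ Iu)).
        intros t _. simpl. unfold u, Cauchy_kernel. rewrite Cpow_S.
        assert (cir r t <> RtoC 0) by (apply cir_neq0; lra).
        assert ((cir r t - x)%C <> RtoC 0) by (apply sub_neq0_of_Cmod; rewrite Cmod_cir; lra).
        assert ((cir r t ^ N)%C <> RtoC 0) by (apply Cpow_nz; assumption).
        field. auto. }
      rewrite E. simpl. unfold pterm at 3.
      replace rem with (mcoef f r N + x * J / RtoC (2 * PI))%C.
      field. apply two_PI_neq0.
      replace rem with (RtoC (2 * PI) * rem / RtoC (2 * PI))%C by (field; apply two_PI_neq0).
      rewrite Er. field. apply two_PI_neq0.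
Qed.

Lemma circle_bound : exists M, 0 <= M /\ forall t, 0 <= t <= 2 * PI -> Cmod (f (cir r t)) <= M.
Proof.
  destruct (rcont_bounded (fun t => f (cir r t)) 0 (2 * PI)) as [M HM].
  intros; apply rcont_circle. exists M. split; auto.
  eapply Rle_trans. apply Cmod_ge_0. apply (HM 0). generalize PI_RGT_0; lra.
Qed.

Lemma taylor_rem_bound (x rem : C) (N : nat) (M : R) :
  Cmod x < r -> (forall t, 0 <= t <= 2 * PI -> Cmod (f (cir r t)) <= M) ->
  is_cint (fun t => f (cir r t) / cir r t ^ N * Cauchy_kernel x (cir r t))%C 0 (2 * PI) (RtoC (2 * PI) * rem)%C ->
  Cmod rem <= M / r ^ N * (r / (r - Cmod x)).
Proof.
  intros Hx HM I. assert (P := PI_RGT_0).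
  assert (B : Cmod (RtoC (2 * PI) * rem)%C <= (2 * PI - 0) * (M / r ^ N * (r / (r - Cmod x)))).
  { eapply cint_bound. lra. 2: exact I. intros t Ht. simpl.
    assert (Nz := cir_neq0 r t ltac:(lra)). assert (Mc := Cmod_cir r t ltac:(lra)).
    assert (Nx : (cir r t - x)%C <> RtoC 0) by (apply sub_neq0_of_Cmod; lra).
    assert (Rv := Cmod_rev_triangle (cir r t) x).
    rewrite Cmod_mult, Cmod_div by (apply Cpow_nz; exact Nz). unfold Cauchy_kernel.
    rewrite Cmod_div by exact Nx. rewrite Cmod_pow, Mc in *.
    assert (0 < r ^ N) by (apply pow_lt; lra).
    apply Rmult_le_compat.
    - apply Rdiv_le_0_compat. apply Cmod_ge_0. assumption.
    - apply Rdiv_le_0_compat; lra.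
    - apply Rmult_le_compat_r. left. apply Rinv_0_lt_compat. assumption. apply HM. lra.
    - apply Rmult_le_compat_l. lra. apply Rinv_le_contravar; lra. }
  rewrite Cmod_mult, Cmod_RtoC_pos in B by lra. rewrite Rminus_0_r in B.
  apply Rmult_le_reg_l in B; [exact B|lra].
Qed.

(** Cauchy's formula as a weak maximum principle. The loss r/(r - |x|) is 1 at the centre and at
    most 2 in the disc of half the radius, which suffices below. *)
Lemma sup_in_disc (x : C) (M : R) :
  Cmod x < r -> (forall t, 0 <= t <= 2 * PI -> Cmod (f (cir r t)) <= M) -> Cmod (f x) <= M * (r / (r - Cmod x)).
Proof.
  intros Hx HM. destruct (taylor_rem x 0 Hx) as [rem [I E]].
  assert (B := taylor_rem_bound x rem 0 M Hx HM I). rewrite E. simpl in *.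
  replace (0 + 1 * rem)%C with rem by ring. replace (M / 1) with M in B by field. exact B.
Qed.

Lemma mcoef_pseries : pseries r f (mcoef f r).
Proof.
  intros x Hx. destruct circle_bound as [M [HM B]].
  set (q := Cmod x / r). assert (Px := Cmod_ge_0 x).
  assert (Hq : 0 <= q < 1).
  { unfold q. split. apply Rdiv_le_0_compat; lra. apply Rmult_lt_reg_r with r. lra.
    unfold Rdiv. rewrite Rmult_assoc, Rinv_l; lra. }
  intros eps He.
  set (T := M * (r / (r - Cmod x)) + 1).
  assert (HT : 0 < T).
  { unfold T. assert (0 <= M * (r / (r - Cmod x))); [|lra]. apply Rmult_le_pos. lra. apply Rdiv_le_0_compat; lra. }
  destruct (pow_lt_1_zero q ltac:(rewrite Rabs_pos_eq; lra) (eps / T) (Rdiv_lt_0_compat _ _ He HT)) as [N HN].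
  exists N. intros n Hn. specialize (HN n Hn). rewrite Rabs_pos_eq in HN by (apply pow_le; lra).
  destruct (taylor_rem x n Hx) as [rem [I E]].
  assert (Br := taylor_rem_bound x rem n M Hx B I).
  replace (psum (pterm (mcoef f r) x) n - f x)%C with (- (x ^ n * rem))%C by (rewrite E; ring).
  rewrite Cmod_opp, Cmod_mult, Cmod_pow.
  assert (Pr : 0 < r ^ n) by (apply pow_lt; lra).
  assert (Eq : Cmod x ^ n = q ^ n * r ^ n).
  { unfold q. rewrite <- Rpow_mult_distr. f_equal. field. lra. }
  assert (Pq : 0 <= q ^ n) by (apply pow_le; lra).
  apply Rle_lt_trans with (q ^ n * T).
  - rewrite Eq. apply Rle_trans with (q ^ n * r ^ n * (M / r ^ n * (r / (r - Cmod x)))).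
    apply Rmult_le_compat_l. nra. exact Br.
    replace (q ^ n * r ^ n * (M / r ^ n * (r / (r - Cmod x)))) with (q ^ n * (M * (r / (r - Cmod x)))) by (field; split; lra).
    unfold T. nra.
  - apply Rmult_lt_compat_r with (r := T) in HN; [|exact HT].
    replace (eps / T * T) with eps in HN by (field; lra). exact HN.
Qed.
End CircleCoefficients.

(** Two radii give the same coefficients by uniqueness on the smaller disc, so a single series
    converges in the whole disc. *)
Theorem taylor (f : C -> C) (R0 : R) :
  0 < R0 -> holo_on R0 f -> exists c, pseries R0 f c /\ forall r, 0 < r < R0 -> forall n, mcoef f r n = c n.
Proof.
  intros HR Hf. exists (mcoef f (R0 / 2)).
  assert (E : forall r, 0 < r < R0 -> forall n, mcoef f r n = mcoef f (R0 / 2) n).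
  { intros r Hr n. apply (pseries_unique (Rmin r (R0 / 2)) f). apply Rmin_glb_lt; lra.
    - intros x Hx. apply (mcoef_pseries f R0 r Hf Hr). generalize (Rmin_l r (R0 / 2)). lra.
    - intros x Hx. apply (mcoef_pseries f R0 (R0 / 2) Hf). lra. generalize (Rmin_r r (R0 / 2)). lra. }
  split; [|exact E].
  intros x Hx. destruct (Cmod_between x R0 Hx) as [r [Hr Hxr]].
  assert (S := mcoef_pseries f R0 r Hf Hr x Hxr).
  replace (mcoef f (R0 / 2)) with (mcoef f r). exact S. extensionality n. apply E, Hr.
Qed.

(** * Logarithms of zero-free functions *)

Lemma cderiv_unique (f : C -> C) (x l m : C) : cderiv f x l -> cderiv f x m -> l = m.
Proof.
  intros Hl Hm. apply Ceq_minus. apply NNPP. intros N. apply Cmod_gt_0 in N.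
  set (d := Cmod (l - m)) in *.
  assert (He : 0 < d / 4) by lra.
  destruct (proj1 (nb_iff _ _) (filter_and _ _ (cderiv_elim _ _ _ Hl _ He) (cderiv_elim _ _ _ Hm _ He)))
    as [e [Pe H]].
  destruct (H (x + RtoC (e / 2))%C) as [H1 H2].
  { replace (x + RtoC (e / 2) - x)%C with (RtoC (e / 2)) by ring. rewrite Cmod_RtoC_pos; lra. }
  replace (x + RtoC (e / 2) - x)%C with (RtoC (e / 2)) in * by ring.
  rewrite Cmod_RtoC_pos in * by lra.
  set (D := (f (x + RtoC (e / 2))%C - f x)%C) in *.
  assert (T := Cmod_triangle_minus (D - m * RtoC (e / 2)) (D - l * RtoC (e / 2))).
  replace (D - m * RtoC (e / 2) - (D - l * RtoC (e / 2)))%C with ((l - m) * RtoC (e / 2))%C in T by ring.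
  rewrite Cmod_mult, Cmod_RtoC_pos in T by lra. fold d in T. nra.
Qed.

Lemma pseries_const (r : R) (c : C) : pseries r (fun _ => c) (fun n => match n with O => c | S _ => RtoC 0 end).
Proof.
  intros x _ eps He. exists 1%nat. intros [|n] Hn. lia. rewrite psum_shift.
  assert (Z : forall j, psum (fun k => pterm (fun n => match n with O => c | S _ => RtoC 0 end) x (S k)) j = RtoC 0).
  { induction j; simpl; auto. rewrite IHj. unfold pterm. ring. }
  rewrite Z. unfold pterm. simpl. replace (c * 1 + 0 - c)%C with (RtoC 0) by ring. rewrite Cmod_0. exact He.
Qed.

(** The derivative's power series is zero, hence all Taylor coefficients of positive index
    vanish. *)
Lemma zero_deriv_const (r : R) (f : C -> C) (x : C) :
  (forall z, Cmod z < r -> cderiv f z (RtoC 0)) -> Cmod x < r -> f x = f (RtoC 0).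
Proof.
  intros Hf Hx. assert (Hr : 0 < r) by (generalize (Cmod_ge_0 x); lra).
  destruct (taylor f r Hr) as [c [Hc _]]. { intros z Hz. exists (RtoC 0). apply Hf, Hz. }
  assert (Hd := pbound_pseries r (dcoef c) (pbound_dcoef _ _ (pseries_pbound _ _ _ Hc))).
  set (H := fun x => psumlim (pterm (dcoef c) x)) in *.
  assert (Z : forall z, Cmod z < r -> H z = RtoC 0).
  { intros z Hz. apply (cderiv_unique f z). apply (pseries_deriv r f H c); auto. apply Hf, Hz. }
  assert (Zc : forall n, dcoef c n = RtoC 0).
  { apply (pseries_zero r); auto. intros z Hz. rewrite <- (Z z Hz). apply Hd, Hz. }
  assert (E : c = fun n => match n with O => c O | S _ => RtoC 0 end).
  { extensionality n. destruct n. reflexivity. specialize (Zc n). unfold dcoef in Zc.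
    apply NNPP. intros N. revert Zc. apply Cmult_neq_0; [|exact N].
    intros K. apply RtoC_inj in K. revert K. apply not_0_INR. lia. }
  rewrite E in Hc. rewrite (csums_unique _ _ _ (Hc x Hx) (pseries_const r (c O) x Hx)).
  symmetry. apply (pseries_at0 r f _ Hr Hc).
Qed.

(** The derivative of g exp(-L) vanishes, and this product is 1 at 0. *)
Lemma exp_of_log_derivative (r : R) (g g' L : C -> C) :
  (forall z, Cmod z < r -> cderiv g z (g' z)) -> (forall z, Cmod z < r -> g z <> RtoC 0) ->
  (forall z, Cmod z < r -> cderiv L z (g' z * / g z)%C) -> g (RtoC 0) = RtoC 1 -> L (RtoC 0) = RtoC 0 ->
  forall x, Cmod x < r -> g x = Cexp (L x).
Proof.
  intros Dg Nz DL H1 L0 x Hx. set (phi := fun x => (g x * Cexp (- L x))%C).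
  assert (E : phi x = phi (RtoC 0)).
  { apply (zero_deriv_const r); [|exact Hx]. intros z Hz.
    replace (RtoC 0) with (g' z * Cexp (- L z) + g z * (Cexp (- L z) * - (g' z * / g z)))%C.
    apply (cderiv_mult g (fun x => Cexp (- L x))). apply Dg, Hz.
    apply (cderiv_comp (fun x => - L x)%C Cexp). apply cderiv_opp, DL, Hz. apply cderiv_Cexp.
    field. apply Nz, Hz. }
  unfold phi in E. rewrite L0, H1 in E. replace (- 0)%C with (RtoC 0) in E by ring. rewrite Cexp_0 in E.
  replace (g x) with (g x * Cexp (- L x) * Cexp (L x))%C.
  rewrite E. ring. rewrite <- Cmult_assoc, <- Cexp_plus. replace (- L x + L x)%C with (RtoC 0) by ring.
  rewrite Cexp_0. ring.
Qed.

(** The logarithmic derivative g'/g has a Taylor series in the disc; [b] integrates it term by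
    term. *)
Theorem holo_log (g : C -> C) (r : R) :
  0 < r -> holo_on r g -> (forall x, Cmod x < r -> g x <> RtoC 0) -> g (RtoC 0) = RtoC 1 ->
  exists (L : C -> C) (b : nat -> C),
    pseries r L b /\ b O = RtoC 0 /\ forall x, Cmod x < r -> g x = Cexp (L x).
Proof.
  intros Hr Hg Nz H1.
  destruct (taylor g r Hr Hg) as [c [Hc _]].
  assert (Hd := pbound_pseries r (dcoef c) (pbound_dcoef _ _ (pseries_pbound _ _ _ Hc))).
  set (G := fun x => psumlim (pterm (dcoef c) x)) in *.
  assert (Dg : forall x, Cmod x < r -> cderiv g x (G x)).
  { intros x Hx. apply (pseries_deriv r g G c); auto. }
  set (h := fun x => (G x * / g x)%C).
  assert (Hh : holo_on r h).
  { intros x Hx. destruct (pseries_holo r G _ Hd x Hx) as [m Hm]. eexists. apply (cderiv_mult G (fun x => / g x)%C).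
    exact Hm. apply cderiv_inv. apply Dg, Hx. apply Nz, Hx. }
  destruct (taylor h r Hr Hh) as [hc [Hhc _]].
  set (b := fun n => match n with O => RtoC 0 | S k => (hc k / RtoC (INR (S k)))%C end).
  assert (Nk : forall k, RtoC (INR (S k)) <> RtoC 0).
  { intros k K. apply RtoC_inj in K. revert K. apply not_0_INR. lia. }
  assert (Eb : dcoef b = hc).
  { extensionality n. unfold dcoef, b. apply Cmult_div_cancel, Nk. }
  assert (Pb : pbound r b).
  { intros rho Hrho. destruct (pseries_pbound _ _ _ Hhc rho Hrho) as [M [HM K]].
    exists (M * rho). split. apply Rmult_le_pos; lra. intros [|k].
    - simpl. rewrite Cmod_0. nra.
    - unfold b. rewrite Cmod_div by apply Nk. rewrite Cmod_RtoC_pos by apply pos_INR.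
      specialize (K k). simpl (rho ^ S k).
      assert (I1 : 1 <= INR (S k)) by (rewrite S_INR; generalize (pos_INR k); lra).
      assert (P : Cmod (hc k) / INR (S k) <= Cmod (hc k)).
      { apply Rmult_le_reg_r with (INR (S k)). lra. unfold Rdiv. rewrite Rmult_assoc, Rinv_l by lra.
        generalize (Cmod_ge_0 (hc k)). nra. }
      assert (0 <= rho ^ k) by (apply pow_le; lra).
      apply Rle_trans with (Cmod (hc k) * (rho * rho ^ k)). apply Rmult_le_compat_r. apply Rmult_le_pos; lra.
      exact P. nra. }
  assert (HL := pbound_pseries r b Pb). set (L := fun x => psumlim (pterm b x)) in *.
  exists L, b. split; [exact HL|]. split; [reflexivity|].
  assert (DL : forall x, Cmod x < r -> cderiv L x (h x)).
  { intros x Hx. apply (pseries_deriv r L h b); auto. rewrite Eb. exact Hhc. }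
  assert (L0 : L (RtoC 0) = RtoC 0) by apply (pseries_at0 r L b Hr HL).
  apply (exp_of_log_derivative r g G L); auto.
Qed.

(** The difference of the logarithms is continuous and zero at 0, so close to 0 it has modulus below
    1, and [Cexp_eq1] makes it vanish there. *)
Lemma log_unique (r : R) (L1 L2 : C -> C) (b1 b2 : nat -> C) :
  0 < r -> pseries r L1 b1 -> pseries r L2 b2 -> b1 O = RtoC 0 -> b2 O = RtoC 0 ->
  (forall x, Cmod x < r -> Cexp (L1 x) = Cexp (L2 x)) -> forall n, b1 n = b2 n.
Proof.
  intros Hr H1 H2 Z1 Z2 E n. apply Ceq_minus. set (D := fun x => (L1 x - L2 x)%C).
  assert (HD : pseries r D (fun n => b1 n - b2 n)%C).
  { intros x Hx. apply (Cto_ext _ (fun n => psum (pterm b1 x) n - psum (pterm b2 x) n)%C).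
    - intros k. rewrite <- psum_minus. apply psum_ext. intros j _. unfold pterm. ring.
    - capply Cto_minus. apply H1, Hx. apply H2, Hx. }
  assert (D0 : D (RtoC 0) = RtoC 0).
  { rewrite (pseries_at0 r D _ Hr HD), Z1, Z2. ring. }
  assert (CD : Ccont D (RtoC 0)).
  { apply (holo_on_cont r). apply (pseries_holo r D _ HD). rewrite Cmod_0. exact Hr. }
  destruct (proj1 (nb_iff _ _) (CD 1 Rlt_0_1)) as [d [Hd Small]].
  apply (pseries_zero (Rmin r d) (fun n => b1 n - b2 n)%C). apply Rmin_glb_lt; assumption.
  intros x Hx. assert (Hxr : Cmod x < r) by (eapply Rlt_le_trans; [apply Hx|apply Rmin_l]).
  replace (RtoC 0) with (D x). apply HD, Hxr.
  apply Cexp_eq1.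
  - unfold D, Cminus. rewrite Cexp_plus, Cexp_opp, E by exact Hxr. apply Cinv_r, Cexp_neq0.
  - specialize (Small x). rewrite D0 in Small. replace (D x - 0)%C with (D x) in Small by ring.
    apply Small. replace (x - 0)%C with x by ring. eapply Rlt_le_trans; [apply Hx|apply Rmin_r].
Qed.

(* Borel-Caratheodory: conj L integrates to 0 against z^(-n), so L may be replaced there by
   -2 (A - Re L), which has constant sign. *)
Lemma caratheodory (r rho A : R) (L : C -> C) (b : nat -> C) (n : nat) :
  pseries r L b -> b O = RtoC 0 -> (forall x, Cmod x < r -> Re (L x) <= A) -> 0 < rho < r ->
  Cmod (b (S n)) * rho ^ (S n) <= 2 * A.
Proof.
  intros HL b0 HA Hr. assert (PP := PI_RGT_0). assert (Hh := pseries_holo r L b HL).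
  assert (L0 : L (RtoC 0) = RtoC 0) by (rewrite (pseries_at0 r L b); auto; lra).
  set (k := S n).
  assert (Nz : forall t, (cir rho t ^ k)%C <> RtoC 0) by (intros; apply Cpow_nz, cir_neq0; lra).
  assert (Ic : forall F, holo_on r F -> is_cint (fun t => F (cir rho t) * cir rho t ^ k)%C 0 (2 * PI) (RtoC 0)).
  { intros F HF. apply (circle_mean_zero (fun z => F z * z ^ k)%C rho (RtoC 0)). lra. rewrite Cmod_0; lra.
    - intros z Hz. capply Cto_mult. apply (holo_on_cont r F); auto; lra. capply Cto_pow. apply Cto_id.
    - intros z Hz _. destruct (HF z ltac:(lra)) as [l Hl]. destruct (cderiv_pow (fun z => z) z _ k (cderiv_id z)) as [m Hm].
      eexists. apply (cderiv_mult F (fun z => z ^ k)%C); eassumption.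
    - unfold k. rewrite Cpow_S. ring. }
  (* On the circle the conjugate of z is rho^2 / z, so conjugating the mean of F z^k turns z^k into
     rho^(2k) / z^k. *)
  assert (Id : forall F, holo_on r F -> is_cint (fun t => Cconj (F (cir rho t)) / cir rho t ^ k)%C 0 (2 * PI) (RtoC 0)).
  { intros F HF. assert (J := cint_scal (/ (RtoC (rho * rho) ^ k))%C _ _ _ _ (cint_conj _ _ _ _ (Ic F HF))).
    replace (RtoC 0) with (/ RtoC (rho * rho) ^ k * Cconj 0)%C by (replace (Cconj 0) with (RtoC 0); [ring | apply Ceq; simpl; ring]).
    eapply cint_ext. 2: exact J. intros t _. cbv beta.
    rewrite Cmult_conj, Cpow_conj.
    assert (M2 : (cir rho t * Cconj (cir rho t))%C = RtoC (rho * rho)).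
    { rewrite <- Cmod2_conj, Cmod_cir by lra. f_equal. ring. }
    assert (N2 : Cconj (cir rho t) <> RtoC 0) by (apply Cmod_gt_0; rewrite Cmod_conj, Cmod_cir; lra).
    rewrite <- M2, Cpow_mult_l. field. split; [apply Nz | apply Cpow_nz, N2]. }
  destruct (taylor L r ltac:(lra) Hh) as [c [Hc Ec]].
  assert (Eb : mcoef L rho k = b k).
  { rewrite (Ec rho Hr). apply (pseries_unique r L); auto. lra. }
  assert (I1 := mcoef_cint L r rho Hh Hr k). rewrite Eb in I1.
  assert (I2 := Id L Hh).
  assert (I3 := Id (fun _ => RtoC (2 * A)) ltac:(intros z _; eexists; apply cderiv_const)).
  (* The integrand is (2A - conj L - L) / z^k = 2 (A - Re L) / z^k, whose modulus is 2 (A - Re L) /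
     rho^k without an absolute value. Its integral follows since L has mean L(0) = 0. *)
  assert (I := cint_minus _ _ _ _ _ _ (cint_minus _ _ _ _ _ _ I3 I2) I1).
  assert (J : is_cint (fun t => L (cir rho t)) 0 (2 * PI) (RtoC 0)).
  { apply (circle_mean_zero L rho (RtoC 0)); auto. lra. rewrite Cmod_0; lra.
    - intros z Hz. apply (holo_on_cont r L); auto. lra.
    - intros z Hz _. apply Hh. lra. }
  apply cint_Re in J.
  assert (Jg : is_RInt (fun t => 2 * (A - Re (L (cir rho t))) / rho ^ k) 0 (2 * PI) (2 * (2 * PI) * A / rho ^ k)).
  { replace (2 * (2 * PI) * A / rho ^ k) with (scal (2 / rho ^ k) (minus (scal (2 * PI - 0) A) 0)).
    2: { unfold scal, minus, plus, opp; simpl. unfold mult; simpl. field. split; [apply pow_nonzero|]; lra. }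
    eapply is_RInt_ext.
    2: { apply (is_RInt_scal (V := R_NormedModule)). apply (is_RInt_minus (V := R_NormedModule)).
         apply (is_RInt_const (V := R_NormedModule)). exact J. }
    intros t _. unfold scal, minus, plus, opp; simpl. unfold mult; simpl. field. split; [apply pow_nonzero|]; lra. }
  assert (Bd : Cmod (0 - 0 - RtoC (2 * PI) * b k) <= 2 * (2 * PI) * A / rho ^ k).
  { eapply cint_bound_fun. 3: exact I. 3: exact Jg. lra.
    intros t _. cbv beta.
    assert (Mz : Cmod (cir rho t) < r) by (rewrite Cmod_cir; lra).
    set (u := L (cir rho t)) in *.
    replace (Cconj (RtoC (2 * A)) / cir rho t ^ k - Cconj u / cir rho t ^ k - u / cir rho t ^ k)%C
      with (RtoC (2 * (A - Re u)) / cir rho t ^ k)%C.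
    - rewrite Cmod_div by apply Nz. rewrite Cmod_pow, Cmod_cir by lra.
      rewrite Cmod_RtoC_pos. lra. generalize (HA _ Mz). fold u. lra.
    - replace (RtoC (2 * (A - Re u))) with (Cconj (RtoC (2 * A)) - Cconj u - u)%C by (apply Ceq; unfold Re, Im; simpl; unfold Re; ring).
      field. apply Nz. }
  replace (0 - 0 - RtoC (2 * PI) * b k)%C with (- (RtoC (2 * PI) * b k))%C in Bd by ring.
  rewrite Cmod_opp, Cmod_mult, Cmod_RtoC_pos in Bd by lra.
  assert (Pp : 0 < rho ^ k) by (apply pow_lt; lra).
  apply Rmult_le_compat_r with (r := rho ^ k) in Bd; [|lra].
  replace (2 * (2 * PI) * A / rho ^ k * rho ^ k) with (2 * PI * (2 * A)) in Bd by (field; lra).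
  rewrite Rmult_assoc in Bd. apply Rmult_le_reg_l in Bd; [exact Bd | lra].
Qed.

(** * Division of an entire function by a linear factor *)

Lemma entire_iff (f : C -> C) : entire f <-> forall x, exists l, cderiv f x l.
Proof. split; intros H x; apply holomorphic_at_iff, H. Qed.

Lemma entire_holo_on (f : C -> C) (r : R) : entire f -> holo_on r f.
Proof. intros H x _. apply entire_iff, H. Qed.

Lemma entire_cont (f : C -> C) (x : C) : entire f -> Ccont f x.
Proof. intros H. destruct (proj1 (entire_iff f) H x) as [l Hl]. apply (cderiv_cont _ _ _ Hl). Qed.

(** Off [w] the quotient is differentiable by the quotient rule; near [w] it is the Taylor series at
    [w] with its zero constant term removed and the indices shifted. *)
Lemma entire_divide (g : C -> C) (w : C) :
  entire g -> g w = RtoC 0 -> exists h, entire h /\ forall x, g x = ((x - w) * h x)%C.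
Proof.
  intros Hg Z. assert (Hg' := proj1 (entire_iff g) Hg).
  set (gw := fun y => g (w + y)%C).
  assert (Hgw : holo_on 1 gw).
  { intros y _. destruct (Hg' (w + y)%C) as [l Hl]. eexists. apply (cderiv_comp (fun y => w + y)%C g).
    apply cderiv_plus. apply cderiv_const. apply cderiv_id. exact Hl. }
  destruct (taylor gw 1 Rlt_0_1 Hgw) as [c [Hc _]].
  assert (Pc := pbound_pseries 1 _ (pbound_shift _ _ (pseries_pbound _ _ _ Hc))).
  set (H := fun x => psumlim (pterm (fun n => c (S n)) x)) in *.
  assert (c0 : c O = RtoC 0).
  { rewrite <- (pseries_at0 1 gw c Rlt_0_1 Hc). unfold gw. replace (w + 0)%C with w by ring. exact Z. }
  assert (E : forall y, Cmod y < 1 -> gw y = (y * H y)%C).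
  { intros y Hy. apply (Cto_unique eventually (fun n => psum (pterm c y) (S n))).
    - apply (Cto_S (psum (pterm c y))), Hc, Hy.
    - apply (Cto_ext _ (fun n => y * psum (pterm (fun n => c (S n)) y) n)%C).
      + intros n. rewrite psum_shift. unfold pterm at 2. rewrite c0, Cmult_0_l, Cplus_0_l, <- psum_scal.
        apply psum_ext. intros j _. unfold pterm. rewrite Cpow_S. ring.
      + capply Cto_mult. capply Cto_const. apply Pc, Hy. }
  set (h := fun x => if Ceq_dec x w then H (RtoC 0) else (g x / (x - w))%C).
  exists h. split.
  - apply entire_iff. intros x. destruct (Ceq_dec x w) as [->|N].
    + destruct (pseries_holo 1 H _ Pc (RtoC 0)) as [l Hl]. rewrite Cmod_0. lra.
      eexists. apply (cderiv_ext_loc (fun x => H (x - w)%C)).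
      2: { apply (cderiv_comp (fun x => x - w)%C H). apply cderiv_minus. apply cderiv_id. apply cderiv_const.
           replace (w - w)%C with (RtoC 0) by ring. exact Hl. }
      apply nb_iff. exists 1. split. lra. intros y Hy. unfold h. destruct (Ceq_dec y w) as [->|N].
      f_equal. ring. assert (N' := Cminus_eq_contra _ _ N).
      replace (g y) with (gw (y - w)%C) by (unfold gw; f_equal; ring). rewrite E by exact Hy. field. exact N'.
    + assert (N' := Cminus_eq_contra _ _ N). destruct (Hg' x) as [l Hl]. eexists.
      apply (cderiv_ext_loc (fun x => g x * / (x - w))%C).
      2: { apply (cderiv_mult g (fun x => / (x - w))%C). exact Hl. apply cderiv_inv.
           apply cderiv_minus. apply cderiv_id. apply cderiv_const. exact N'. }
      apply nb_iff. exists (Cmod (x - w)). split. apply Cmod_gt_0, N'.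
      intros y Hy. unfold h. destruct (Ceq_dec y w) as [->|E']; [|reflexivity].
      rewrite Cmod_minus_sym in Hy. lra.
  - intros x. unfold h. destruct (Ceq_dec x w) as [->|N]. rewrite Z. ring.
    assert (N' := Cminus_eq_contra _ _ N). field. exact N'.
Qed.

(** * Dividing out zeroes *)

Definition lin_factor (z : nat -> option C) (x : C) (m : nat) : C :=
  match z m with Some w => (1 - x / w)%C | None => RtoC 1 end.

(** The Taylor coefficients of log(1 - x/w). *)
Definition log_lin_coef (w : C) (n : nat) : C :=
  match n with O => RtoC 0 | S _ => (- (/ (w ^ n) / RtoC (INR n)))%C end.

Lemma INR_S_neq0 (k : nat) : RtoC (INR (S k)) <> RtoC 0.
Proof. intros K. apply RtoC_inj in K. revert K. apply not_0_INR. lia. Qed.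

Lemma geom_pseries (w : C) :
  w <> RtoC 0 -> pseries (Cmod w) (fun x => - / (w - x))%C (fun n => - / (w ^ S n))%C.
Proof.
  intros Nw x Hx. assert (Nd := sub_neq0_of_Cmod x w Hx).
  assert (E : forall N, psum (pterm (fun n => - / (w ^ S n))%C x) N = (- / (w - x) + (x / w) ^ N * / (w - x))%C).
  { induction N. simpl. field. exact Nd. cbn [psum]. rewrite IHN. unfold pterm, Cdiv.
    rewrite !Cpow_mult_l, Cpow_inv, Cpow_inv, !Cpow_S by exact Nw.
    field. repeat split; try assumption; apply Cpow_nz, Nw. }
  apply (Cto_ext _ _ _ _ (fun N => eq_sym (E N))).
  assert (T : Cto eventually (fun N => (- / (w - x) + (x / w) ^ N * / (w - x))%C) (- / (w - x) + 0 * / (w - x))%C).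
  { capply Cto_plus. capply Cto_const. capply Cto_mult. 2: capply Cto_const.
    intros eps He. apply Cmod_gt_0 in Nw. assert (Px := Cmod_ge_0 x).
    assert (Hq : Rabs (Cmod x / Cmod w) < 1).
    { rewrite Rabs_pos_eq by (apply Rdiv_le_0_compat; lra). apply Rmult_lt_reg_r with (Cmod w). lra.
      unfold Rdiv. rewrite Rmult_assoc, Rinv_l; lra. }
    destruct (pow_lt_1_zero _ Hq eps He) as [N HN]. exists N. intros n Hn. specialize (HN n Hn).
    replace ((x / w) ^ n - 0)%C with ((x / w) ^ n)%C by ring. rewrite Cmod_pow, Cmod_div by (apply Cmod_gt_0, Nw).
    rewrite Rabs_pos_eq in HN; [exact HN|]. apply pow_le, Rdiv_le_0_compat; lra. }
  replace (- / (w - x) + 0 * / (w - x))%C with (- / (w - x))%C in T by ring. exact T.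
Qed.

Lemma log_lin_factor (w : C) :
  w <> RtoC 0 -> exists L, pseries (Cmod w) L (log_lin_coef w) /\
    forall x, Cmod x < Cmod w -> (1 - x / w)%C = Cexp (L x).
Proof.
  intros Nw. assert (Pw := proj1 (Cmod_gt_0 w) Nw).
  assert (Ed : dcoef (log_lin_coef w) = (fun n => - / (w ^ S n))%C).
  { extensionality n. unfold dcoef, log_lin_coef. field. split; [apply Cpow_nz, Nw || apply INR_S_neq0 ..]. }
  assert (Pb : pbound (Cmod w) (log_lin_coef w)).
  { intros rho Hr. exists 1. split. lra. intros [|n].
    - simpl. rewrite Cmod_0. lra.
    - unfold log_lin_coef. rewrite Cmod_opp, Cmod_div, Cmod_inv, Cmod_pow, Cmod_RtoC_pos
        by (apply pos_INR || apply INR_S_neq0 || apply Cpow_nz, Nw).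
      assert (I1 : 1 <= INR (S n)) by (rewrite S_INR; generalize (pos_INR n); lra).
      assert (P1 : 0 < Cmod w ^ S n) by (apply pow_lt, Pw).
      assert (P2 : rho ^ S n <= Cmod w ^ S n) by (apply pow_incr; lra).
      assert (P3 : 0 <= rho ^ S n) by (apply pow_le; lra).
      apply Rmult_le_reg_r with (Cmod w ^ S n * INR (S n)). apply Rmult_lt_0_compat; lra.
      replace (/ Cmod w ^ S n / INR (S n) * rho ^ S n * (Cmod w ^ S n * INR (S n))) with (rho ^ S n) by (field; lra).
      nra. }
  assert (HL := pbound_pseries _ _ Pb). set (L := fun x => psumlim (pterm (log_lin_coef w) x)) in *.
  exists L. split. exact HL.
  apply (exp_of_log_derivative (Cmod w) (fun x => 1 - x / w)%C (fun _ => - / w)%C L).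
  - intros z Hz. replace (- / w)%C with (0 - (1 * / w + z * 0))%C by ring.
    apply cderiv_minus. apply cderiv_const. apply (cderiv_mult (fun z => z) (fun _ => / w)%C).
    apply cderiv_id. apply cderiv_const.
  - intros z Hz E. assert (N := sub_neq0_of_Cmod z w Hz). apply N.
    replace (w - z)%C with ((1 - z / w) * w)%C by (field; exact Nw). rewrite E. ring.
  - intros z Hz. apply (pseries_deriv (Cmod w) L (fun z => - / w * / (1 - z / w))%C (log_lin_coef w) z HL); [|exact Hz].
    rewrite Ed. intros y Hy. assert (N := sub_neq0_of_Cmod y w Hy).
    replace (- / w * / (1 - y / w))%C with (- / (w - y))%C. apply (geom_pseries w Nw y Hy).
    field. repeat split; try assumption.
  - field. exact Nw.
  - apply (pseries_at0 (Cmod w) L _ Pw HL).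
Qed.

Lemma partial_prod_ext (u v : nat -> C) (n : nat) :
  (forall m, (m < n)%nat -> u m = v m) -> partial_prod u n = partial_prod v n.
Proof. induction n; intros H; simpl. reflexivity. rewrite IHn, H by (intros; auto with arith). reflexivity. Qed.

Lemma partial_prod_mult (u v : nat -> C) (n : nat) :
  partial_prod (fun m => u m * v m)%C n = (partial_prod u n * partial_prod v n)%C.
Proof. induction n; simpl. ring. rewrite IHn. ring. Qed.

Lemma partial_prod_Cexp (u : nat -> C) (n : nat) : partial_prod (fun m => Cexp (u m)) n = Cexp (psum u n).
Proof. induction n; simpl. symmetry; apply Cexp_0. rewrite IHn, Cexp_plus. reflexivity. Qed.

Lemma partial_prod_lower (u : nat -> C) (c : R) (n : nat) :
  0 <= c -> (forall m, (m < n)%nat -> c <= Cmod (u m)) -> c ^ n <= Cmod (partial_prod u n).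
Proof.
  intros Hc. induction n; intros H; simpl. rewrite Cmod_1. lra.
  rewrite Cmod_mult, Rmult_comm. apply Rmult_le_compat; auto. apply pow_le, Hc.
Qed.

Lemma lin_factor_0 (z : nat -> option C) (m : nat) : lin_factor z (RtoC 0) m = RtoC 1.
Proof. unfold lin_factor. destruct (z m); [unfold Cdiv|]; ring. Qed.

Lemma prod_lin_factor_0 (z : nat -> option C) (n : nat) : partial_prod (lin_factor z (RtoC 0)) n = RtoC 1.
Proof. induction n; simpl. reflexivity. rewrite IHn, lin_factor_0. ring. Qed.

(** Allows powers of x - w to be cancelled first and the resulting identity to be read at [w]. *)
Lemma cont_eq_of_punctured (u v : C -> C) (w : C) :
  Ccont u w -> Ccont v w -> (forall x, x <> w -> u x = v x) -> u w = v w.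
Proof.
  intros Hu Hv E. apply Ceq_minus. apply NNPP. intros N. apply Cmod_gt_0 in N.
  set (d := Cmod (u w - v w)) in *. assert (He : 0 < d / 4) by lra.
  destruct (proj1 (nb_iff _ _) (filter_and _ _ (Hu _ He) (Hv _ He))) as [e [Pe H]].
  assert (Ew : (w + RtoC (e / 2) - w)%C = RtoC (e / 2)) by ring.
  destruct (H (w + RtoC (e / 2))%C) as [H1 H2].
  { rewrite Ew, Cmod_RtoC_pos; lra. }
  rewrite (E (w + RtoC (e / 2))%C) in H1.
  2: { intros K. rewrite K in Ew. assert (Z : Cmod (RtoC (e / 2)) = 0).
       { rewrite <- Ew. replace (w - w)%C with (RtoC 0) by ring. apply Cmod_0. }
       rewrite Cmod_RtoC_pos in Z; lra. }
  set (y := v (w + RtoC (e / 2))%C) in *.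
  assert (T := Cmod_triangle_minus (y - v w) (y - u w)).
  replace (y - v w - (y - u w))%C with (u w - v w)%C in T by ring. fold d in T. lra.
Qed.

Section Zeroes.
Context (f : C -> C) (z : nat -> option C) (Hf : entire f) (f0 : f (RtoC 0) = RtoC 1) (Hz : zero_ordering f z).

Lemma zero_of_index (m : nat) (w : C) : z m = Some w -> f w = RtoC 0 /\ w <> RtoC 0.
Proof.
  intros E. destruct Hz as [_ [H _]]. destruct (H w) as [l [_ [Hl [h [_ [_ Ef]]]]]].
  assert (F : f w = RtoC 0).
  { rewrite Ef. apply Hl in E. destruct l. contradiction. simpl length. rewrite Cpow_S. ring. }
  split. exact F. intros K. subst. rewrite f0 in F. apply C1_nz, F.
Qed.

Lemma ordering_mono (m m' : nat) (w w' : C) : (m <= m')%nat -> z m = Some w -> z m' = Some w' -> Cmod w <= Cmod w'.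
Proof. apply Hz. Qed.

Lemma ordering_initial (m m' : nat) (w' : C) : (m <= m')%nat -> z m' = Some w' -> exists w, z m = Some w.
Proof.
  intros Hm E. destruct (z m) as [w|] eqn:Em. eauto. exfalso.
  assert (N : forall k, z (m + k)%nat = None).
  { induction k. rewrite Nat.add_0_r. exact Em. rewrite Nat.add_succ_r. apply Hz, IHk. }
  specialize (N (m' - m)%nat). replace (m + (m' - m))%nat with m' in N by lia. congruence.
Qed.

(** The order of [w] in the partial product is counted by the list of its indices below [N].
    Continuity of [A] is all that the comparison of orders in [cofactor_zero] uses. *)
Lemma prod_lin_factor_at (N : nat) (w : C) :
  w <> RtoC 0 -> exists (A : C -> C) (l : list nat),
    NoDup l /\ (forall m, In m l <-> (m < N)%nat /\ z m = Some w) /\ Ccont A w /\ A w <> RtoC 0 /\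
    forall x, partial_prod (lin_factor z x) N = ((x - w) ^ length l * A x)%C.
Proof.
  intros Nw. induction N as [|N [A [l [H1 [H2 [H3 [H4 H5]]]]]]].
  - exists (fun _ => RtoC 1), nil. split. constructor. split. intros m; simpl; lia.
    split. capply Cto_const. split. exact C1_nz. intros x. simpl. ring.
  - destruct (z N) as [v|] eqn:EN.
    + assert (Nv : v <> RtoC 0) by apply (zero_of_index N v EN).
      destruct (Ceq_dec v w) as [->|N'].
      * exists (fun x => A x * - / w)%C, (N :: l). split.
        { constructor. intros K. apply H2 in K. lia. exact H1. }
        split. { intros m. simpl. rewrite H2. split.
          intros [<-|[K1 K2]]. split; [lia|exact EN]. split; [lia|exact K2].
          intros [K1 K2]. destruct (Nat.eq_dec N m). left; assumption. right. split; [lia|exact K2]. }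
        split. { capply Cto_mult. exact H3. capply Cto_const. }
        split. { apply Cmult_neq_0. exact H4. intros K. apply C1_nz. replace (RtoC 1) with (- (- / w * w))%C by (field; exact Nw). rewrite K. ring. }
        intros x. simpl. rewrite H5. unfold lin_factor at 1. rewrite EN. field. exact Nw.
      * exists (fun x => A x * (1 - x / v))%C, l. split. exact H1.
        split. { intros m. rewrite H2. split; intros [K1 K2]; split; auto.
          destruct (Nat.eq_dec m N). subst. congruence. lia. }
        split. { capply Cto_mult. exact H3. capply Cto_minus. capply Cto_const. capply Cto_div. apply Cto_id. capply Cto_const. exact Nv. }
        split. { apply Cmult_neq_0. exact H4. replace (1 - w / v)%C with ((v - w) / v)%C by (field; exact Nv).
          intros K. apply (Cminus_eq_contra _ _ N'). replace (v - w)%C with ((v - w) / v * v)%C by (field; exact Nv). rewrite K. ring. }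
        intros x. simpl. rewrite H5. unfold lin_factor at 1. rewrite EN. ring.
    + exists A, l. split. exact H1.
      split. { intros m. rewrite H2. split; intros [K1 K2]; split; auto.
          destruct (Nat.eq_dec m N). subst. congruence. lia. }
      split. exact H3. split. exact H4. intros x. simpl. rewrite H5. unfold lin_factor at 1. rewrite EN. ring.
Qed.

(** Cancelling the common power of x - w leaves (x - w)^i h = A g, where i counts the indices of [w]
    from [N] on; at [w] the left side vanishes exactly when i > 0. *)
Lemma cofactor_zero (N : nat) (g : C -> C) (w : C) :
  entire g -> (forall x, f x = partial_prod (lin_factor z x) N * g x)%C ->
  (g w = RtoC 0 <-> exists m, (N <= m)%nat /\ z m = Some w).
Proof.
  intros Hg Ef. destruct (Ceq_dec w 0) as [E|Nw].
  { split.
    - intros K. exfalso. apply C1_nz. rewrite <- f0, Ef, prod_lin_factor_0. rewrite E in K. rewrite K. ring.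
    - intros [m [_ K]]. destruct (zero_of_index m w K) as [_ N']. contradiction. }
  destruct (prod_lin_factor_at N w Nw) as [A [lN [H1 [H2 [H3 [H4 H5]]]]]].
  destruct Hz as [_ [H _]]. destruct (H w) as [l [L1 [L2 [h [Hh [Nh Eh]]]]]].
  assert (I : incl lN l) by (intros m Hm; apply L2; apply H2 in Hm; apply Hm).
  assert (Le := NoDup_incl_length H1 I).
  set (i := (length l - length lN)%nat).
  assert (Q : ((w - w) ^ i * h w = A w * g w)%C).
  { apply (cont_eq_of_punctured (fun x => (x - w) ^ i * h x)%C (fun x => A x * g x)%C).
    - capply Cto_mult. capply Cto_pow. capply Cto_minus. apply Cto_id. capply Cto_const. apply entire_cont, Hh.
    - capply Cto_mult. exact H3. apply entire_cont, Hg.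
    - intros x Nx. assert (Np := Cpow_nz _ (length lN) (Cminus_eq_contra _ _ Nx)).
      assert (E : (f x = (x - w) ^ length lN * ((x - w) ^ i * h x))%C).
      { rewrite Eh. replace (length l) with (length lN + i)%nat by (unfold i; lia). rewrite Cpow_add_r. ring. }
      rewrite Ef, H5 in E.
      replace ((x - w) ^ i * h x)%C with ((x - w) ^ length lN * ((x - w) ^ i * h x) / (x - w) ^ length lN)%C by (field; exact Np).
      rewrite <- E. field. exact Np. }
  replace (w - w)%C with (RtoC 0) in Q by ring.
  split.
  - intros G. apply NNPP. intros Nm.
    assert (I2 : incl l lN).
    { intros m Hm. apply L2 in Hm. apply H2. split; [|exact Hm].
      apply not_le. intros K. apply Nm. exists m. split; [lia|exact Hm]. }
    assert (Le2 := NoDup_incl_length L1 I2). replace i with 0%nat in Q by (unfold i; lia).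
    rewrite G in Q. apply Nh. replace (h w) with (0 ^ 0 * h w)%C by (simpl; ring). rewrite Q. ring.
  - intros [m [Hm Em]].
    assert (Lt : (length (m :: lN) <= length l)%nat).
    { apply NoDup_incl_length. constructor. intros K. apply H2 in K. lia. exact H1.
      intros j [<-|Hj]. apply L2, Em. apply I, Hj. }
    simpl in Lt. replace i with (S (i - 1)) in Q by (unfold i; lia). rewrite Cpow_S in Q.
    replace (g w) with (A w * g w / A w)%C by (field; exact H4). rewrite <- Q. field. exact H4.
Qed.

Lemma zero_factorization (N : nat) :
  exists g, entire g /\ forall x, (f x = partial_prod (lin_factor z x) N * g x)%C.
Proof.
  induction N as [|N [g [Hg Ef]]].
  - exists f. split. exact Hf. intros x. simpl. ring.
  - destruct (z N) as [w|] eqn:EN.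
    + assert (G : g w = RtoC 0) by (apply (cofactor_zero N g w Hg Ef); exists N; auto).
      assert (Nw : w <> RtoC 0) by apply (zero_of_index N w EN).
      (* The factor -w turns x - w into (1 - x/w)(-w). *)
      destruct (entire_divide g w Hg G) as [h [Hh Eg]]. exists (fun x => - w * h x)%C. split.
      * apply entire_iff. intros x. destruct (proj1 (entire_iff h) Hh x) as [l Hl].
        eexists. apply cderiv_scal. exact Hl.
      * intros x. rewrite Ef, Eg. simpl. unfold lin_factor at 3. rewrite EN. field. exact Nw.
    + exists g. split. exact Hg. intros x. rewrite Ef. simpl. unfold lin_factor at 3. rewrite EN. ring.
Qed.

(** On |x| = 3r each factor has modulus at least 3r/|w| - 1 >= 2, so the cofactor is at most M/2^N
    there, and its value at the centre is 1. *)
Lemma jensen_count (N : nat) (r M : R) :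
  0 < r -> (forall m, (m < N)%nat -> exists w, z m = Some w /\ Cmod w <= r) ->
  (forall x, Cmod x <= 3 * r -> Cmod (f x) <= M) -> 2 ^ N <= M.
Proof.
  intros Hr Hw HM. destruct (zero_factorization N) as [g [Hg Ef]].
  assert (P2 : 0 < 2 ^ N) by (apply pow_lt; lra).
  assert (B : Cmod (g (RtoC 0)) <= M / 2 ^ N * (3 * r / (3 * r - Cmod (RtoC 0)))).
  { apply (sup_in_disc g (4 * r) (3 * r)). apply entire_holo_on, Hg. lra. rewrite Cmod_0. lra.
    intros t _. assert (Mc := Cmod_cir (3 * r) t ltac:(lra)). set (x := cir (3 * r) t) in *.
    assert (Lb : 2 ^ N <= Cmod (partial_prod (lin_factor z x) N)).
    { apply partial_prod_lower. lra. intros m Hm. destruct (Hw m Hm) as [w [Ew Bw]].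
      unfold lin_factor. rewrite Ew. assert (Nw : w <> RtoC 0) by apply (zero_of_index m w Ew).
      assert (Pw := proj1 (Cmod_gt_0 w) Nw).
      assert (T := Cmod_rev_triangle (x / w) 1). rewrite Cmod_1, Cmod_div, Mc in T by exact Nw.
      rewrite (Cmod_minus_sym 1 (x / w)).
      assert (3 <= 3 * r / Cmod w); [|lra]. apply Rmult_le_reg_r with (Cmod w). exact Pw.
      unfold Rdiv. rewrite Rmult_assoc, Rinv_l; lra. }
    apply Rmult_le_reg_l with (2 ^ N). exact P2. replace (2 ^ N * (M / 2 ^ N)) with M by (field; lra).
    apply Rle_trans with (Cmod (f x)). rewrite Ef, Cmod_mult. apply Rmult_le_compat_r. apply Cmod_ge_0. exact Lb.
    apply HM. lra. }
  assert (G0 : g (RtoC 0) = RtoC 1).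
  { rewrite <- f0, Ef, prod_lin_factor_0. ring. }
  rewrite G0, Cmod_1, Cmod_0 in B. replace (M / 2 ^ N * (3 * r / (3 * r - 0))) with (M / 2 ^ N) in B by (field; lra).
  apply Rmult_le_compat_l with (r := 2 ^ N) in B; [|lra]. replace (2 ^ N * (M / 2 ^ N)) with M in B by (field; lra). lra.
Qed.

Lemma disc_bound (r : R) : exists M, forall x, Cmod x <= r -> Cmod (f x) <= M.
Proof.
  set (s := Rabs r + 1). assert (Hs : 0 < s /\ r < s) by (unfold s; generalize (Rabs_pos r) (RRle_abs r); lra).
  assert (HF : holo_on (4 * s) f) by (apply entire_holo_on, Hf).
  destruct (circle_bound f (4 * s) (2 * s) HF ltac:(lra)) as [M [HM B]].
  exists (M * 2). intros x Hx. eapply Rle_trans.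
  apply (sup_in_disc f (4 * s) (2 * s) HF ltac:(lra) x M ltac:(lra) B).
  apply Rmult_le_compat_l. exact HM. apply Rmult_le_reg_r with (2 * s - Cmod x). lra.
  unfold Rdiv. rewrite Rmult_assoc, Rinv_l; lra.
Qed.

(** By monotonicity a zero of index m in the disc brings m + 1 zeroes of no larger modulus, so
    2^(m+1) is bounded. *)
Lemma finitely_many (r : R) : exists N, forall m w, z m = Some w -> Cmod w < r -> (m < N)%nat.
Proof.
  destruct (Rle_dec r 0) as [L|L].
  { exists 0%nat. intros m w _ Hw. generalize (Cmod_ge_0 w). lra. }
  destruct (disc_bound (3 * r)) as [M HM].
  destruct (Pow_x_infinity 2 ltac:(rewrite Rabs_pos_eq; lra) (M + 1)) as [N HN].
  exists N. intros m w Ew Hw. apply not_le. intros K.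
  specialize (HN (S m) ltac:(lia)). rewrite Rabs_pos_eq in HN by (apply pow_le; lra).
  assert (2 ^ S m <= M); [|lra].
  apply (jensen_count (S m) r M). lra.
  - intros j Hj. destruct (ordering_initial j m w ltac:(lia) Ew) as [v Ev]. exists v. split. exact Ev.
    generalize (ordering_mono j m v w ltac:(lia) Ev Ew). lra.
  - exact HM.
Qed.

Definition zero_free_from (N : nat) (r : R) : Prop := forall m w, (N <= m)%nat -> z m = Some w -> r <= Cmod w.

Lemma cofactor_log (N : nat) (r : R) :
  0 < r -> zero_free_from N r -> exists (g L : C -> C) (b : nat -> C),
    entire g /\ (forall x, f x = partial_prod (lin_factor z x) N * g x)%C /\
    pseries r L b /\ b O = RtoC 0 /\ forall x, Cmod x < r -> g x = Cexp (L x).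
Proof.
  intros Hr HN. destruct (zero_factorization N) as [g [Hg Ef]].
  destruct (holo_log g r Hr (entire_holo_on g r Hg)) as [L [b [H1 [H2 H3]]]].
  - intros x Hx K. apply (cofactor_zero N g x Hg Ef) in K. destruct K as [m [Hm Em]].
    generalize (HN m x Hm Em). lra.
  - rewrite <- f0, Ef, prod_lin_factor_0. ring.
  - exists g, L, b. auto.
Qed.

Context (G : C -> C) (a : nat -> C)
  (f_expG : near (RtoC 0) (fun x : C => f x = Cexp (G x)))
  (G_series : near (RtoC 0) (fun x : C =>
     @is_series C_AbsRing C_NormedModule
       (fun n : nat =>
          Copp (Cmult (Cdiv (a (S n)) (RtoC (INR (S n)))) (Cpow x (S n))))
       (G x))).

(** Reindexes the given series, which starts at degree 1, as a power series with constant term 0. *)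
Definition log_coef (n : nat) : C := match n with O => RtoC 0 | S _ => (- (a n / RtoC (INR n)))%C end.

Lemma log_pseries : exists r, 0 < r /\ pseries r G log_coef /\ forall x, Cmod x < r -> f x = Cexp (G x).
Proof.
  destruct (proj1 (nb_iff _ _) (filter_and _ _ f_expG G_series)) as [r [Hr H]].
  assert (H' : forall x, Cmod x < r -> f x = Cexp (G x) /\ csums (pterm log_coef x) (G x)).
  { intros x Hx. destruct (H x) as [H1 H2]. replace (x - 0)%C with x by ring. exact Hx. split. exact H1.
    apply csums_is_series in H2. intros eps He. apply eventually_S. generalize (H2 eps He). apply filter_imp.
    intros n Hn. rewrite psum_shift. unfold pterm at 1. simpl (log_coef 0). rewrite Cmult_0_l, Cplus_0_l.
    erewrite psum_ext. exact Hn. intros k _. unfold pterm, log_coef. ring. }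
  exists r. split. exact Hr. split; intros x Hx; apply H', Hx.
Qed.

Definition zero_log_coef (N : nat) (n : nat) : C :=
  psum (fun m => match z m with Some w => log_lin_coef w n | None => RtoC 0 end) N.

(** Some positive radius is enough, since logarithms are compared near 0 only. *)
Lemma prod_log (N : nat) : exists r L, 0 < r /\ pseries r L (zero_log_coef N) /\
  forall x, Cmod x < r -> partial_prod (lin_factor z x) N = Cexp (L x).
Proof.
  induction N as [|N [r [L [Hr [H1 H2]]]]].
  - exists 1, (fun _ => RtoC 0). split. lra. split.
    + intros x _. apply (Cto_ext _ (fun _ => RtoC 0)). 2: capply Cto_const.
      intros n. induction n; simpl; auto. rewrite <- IHn. unfold pterm, zero_log_coef. simpl. ring.
    + intros x _. simpl. symmetry. apply Cexp_0.
  - destruct (z N) as [w|] eqn:EN.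
    + assert (Nw : w <> RtoC 0) by apply (zero_of_index N w EN). assert (Pw := proj1 (Cmod_gt_0 w) Nw).
      destruct (log_lin_factor w Nw) as [L' [K1 K2]].
      exists (Rmin r (Cmod w)), (fun x => L x + L' x)%C. split. apply Rmin_glb_lt; assumption. split.
      * intros x Hx.
        apply (Cto_ext _ (fun n => psum (pterm (zero_log_coef N) x) n + psum (pterm (log_lin_coef w) x) n)%C).
        intros n. rewrite <- psum_plus. apply psum_ext. intros k _. unfold pterm, zero_log_coef. simpl. rewrite EN. ring.
        capply Cto_plus. apply H1. eapply Rlt_le_trans; [apply Hx|apply Rmin_l].
        apply K1. eapply Rlt_le_trans; [apply Hx|apply Rmin_r].
      * intros x Hx. simpl. rewrite H2 by (eapply Rlt_le_trans; [apply Hx|apply Rmin_l]).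
        unfold lin_factor. rewrite EN. rewrite Cexp_plus, <- K2. reflexivity.
        eapply Rlt_le_trans; [apply Hx|apply Rmin_r].
    + exists r, L. split. exact Hr. split.
      * replace (zero_log_coef (S N)) with (zero_log_coef N). exact H1.
        extensionality n. unfold zero_log_coef. simpl. rewrite EN. ring.
      * intros x Hx. simpl. rewrite H2 by exact Hx. unfold lin_factor. rewrite EN. ring.
Qed.

(** Near 0 the logarithm of [f] is that of the product plus [L], by [log_unique]. The resulting
    identity of coefficients concerns [b] itself, which is controlled on the whole disc of radius
    [r]. *)
Lemma cofactor_log_coef (N : nat) (r : R) (g L : C -> C) (b : nat -> C) (n : nat) :
  0 < r -> (forall x, f x = partial_prod (lin_factor z x) N * g x)%C ->
  pseries r L b -> b O = RtoC 0 -> (forall x, Cmod x < r -> g x = Cexp (L x)) ->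
  (a (S n) - psum (inv_pow z (S n)) N = - (INR (S n) * b (S n)))%C.
Proof.
  intros Hr Ef HL b0 Eg.
  destruct log_pseries as [r1 [Hr1 [G1 G2]]]. destruct (prod_log N) as [r2 [P [Hr2 [P1 P2]]]].
  set (s := Rmin r (Rmin r1 r2)).
  assert (Hs : 0 < s) by (unfold s; repeat apply Rmin_glb_lt; assumption).
  assert (S1 : s <= r) by (unfold s; apply Rmin_l).
  assert (S2 : s <= r1) by (unfold s; eapply Rle_trans; [apply Rmin_r|apply Rmin_l]).
  assert (S3 : s <= r2) by (unfold s; eapply Rle_trans; [apply Rmin_r|apply Rmin_r]).
  assert (E : log_coef (S n) = (zero_log_coef N (S n) + b (S n))%C).
  { apply (log_unique s G (fun x => P x + L x)%C log_coef (fun n => zero_log_coef N n + b n)%C Hs).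
    - intros x Hx. apply G1. lra.
    - intros x Hx.
      apply (Cto_ext _ (fun n => psum (pterm (zero_log_coef N) x) n + psum (pterm b x) n)%C).
      intros k. rewrite <- psum_plus. apply psum_ext. intros j _. unfold pterm. ring.
      capply Cto_plus. apply P1. lra. apply HL. lra.
    - reflexivity.
    - rewrite b0. unfold zero_log_coef.
      assert (Z : forall k, psum (fun m => match z m with Some w => log_lin_coef w 0 | None => RtoC 0 end) k = RtoC 0).
      { induction k. reflexivity. cbn [psum]. rewrite IHk. destruct (z k); unfold log_lin_coef; ring. }
      rewrite Z. ring.
    - intros x Hx. rewrite <- G2, Ef, P2, Eg, Cexp_plus by lra. reflexivity. }
  assert (Ez : zero_log_coef N (S n) = (- (/ INR (S n)) * psum (inv_pow z (S n)) N)%C).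
  { unfold zero_log_coef. rewrite <- psum_scal. apply psum_ext. intros m _. unfold inv_pow.
    destruct (z m) as [w|] eqn:Em; [|ring]. unfold log_lin_coef. field.
    split; [apply Cpow_nz; apply (zero_of_index m w Em) | apply INR_S_neq0]. }
  rewrite Ez in E. unfold log_coef in E. assert (Nn := INR_S_neq0 n).
  replace (b (S n)) with (- (a (S n) / INR (S n)) - (- / INR (S n) * psum (inv_pow z (S n)) N))%C by (rewrite E; ring).
  field. exact Nn.
Qed.
End Zeroes.

(** * Order of growth and power sums *)

Fixpoint rsum (u : nat -> R) (n : nat) : R :=
  match n with O => 0 | S n' => rsum u n' + u n' end.

Lemma rsum_sum_n (u : nat -> R) (n : nat) : rsum u (S n) = sum_n u n.
Proof.
  induction n. rewrite sum_O. simpl. ring. rewrite sum_Sn, <- IHn. reflexivity.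
Qed.

Lemma ex_series_bounded (u : nat -> R) (B : R) :
  (forall n, 0 <= u n) -> (forall n, rsum u n <= B) -> ex_series u.
Proof.
  intros Hu HB. destruct (ex_finite_lim_seq_incr (sum_n u) B) as [l Hl].
  - intros n. rewrite sum_Sn. unfold plus; simpl. generalize (Hu (S n)). lra.
  - intros n. rewrite <- rsum_sum_n. apply HB.
  - exists l. exact Hl.
Qed.

Lemma rsum_tail (u : nat -> R) :
  (forall n, 0 <= u n) -> ex_series u ->
  exists s, (forall n, rsum u n <= s) /\ forall eps, 0 < eps -> exists N, forall n, (N <= n)%nat -> s - rsum u n < eps.
Proof.
  intros Hu [s Hs]. exists s.
  assert (L : forall n, rsum u n <= s).
  { assert (L : forall n, sum_n u n <= s).
    { apply is_lim_seq_incr_compare. exact Hs. intros n. rewrite sum_Sn. unfold plus; simpl. generalize (Hu (S n)). lra. }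
    intros [|n]. simpl. specialize (L 0%nat). rewrite sum_O in L. generalize (Hu 0%nat). lra.
    rewrite rsum_sum_n. apply L. }
  split. exact L. intros eps He.
  assert (Hs' : is_lim_seq (sum_n u) s) by exact Hs. apply is_lim_seq_spec in Hs'.
  destruct (Hs' (mkposreal eps He)) as [N HN].
  exists (S N). intros [|n] Hn. lia. rewrite rsum_sum_n. specialize (HN n ltac:(lia)). simpl in HN.
  apply Rabs_lt_between in HN. lra.
Qed.

Lemma Rbar_glb_correct (E : Rbar -> Prop) : Rbar_is_glb E (Rbar_glb E).
Proof. unfold Rbar_glb. destruct (Rbar_ex_glb E) as [l Hl]. exact Hl. Qed.

Lemma exp_ge_0 (x : R) : 0 <= x -> 1 <= exp x.
Proof. intros H. generalize (exp_ineq1_le x). lra. Qed.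

Lemma exp_ln_pow (K : nat) (r : R) : 0 < r -> exp (INR K * ln r) = r ^ K.
Proof. intros Hr. rewrite <- Rpower_pow by exact Hr. reflexivity. Qed.

Lemma log_plus_le (x t : R) : 0 <= t -> x <= exp t -> log_plus x <= t.
Proof.
  intros Ht Hx. unfold log_plus. rewrite <- (ln_exp t). apply ln_le.
  generalize (Rmax_l 1 x). lra. apply Rmax_lub. apply exp_ge_0, Ht. exact Hx.
Qed.

Lemma log_plus_inv (x t : R) : log_plus x <= t -> x <= exp t.
Proof.
  unfold log_plus. intros H. assert (P := Rmax_l 1 x). apply Rle_trans with (Rmax 1 x). apply Rmax_r.
  rewrite <- (exp_ln (Rmax 1 x)) by lra. destruct H as [H|H]. left. apply exp_increasing, H. right. f_equal. exact H.
Qed.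

Lemma log_plus_ge_0 (x : R) : 0 <= log_plus x.
Proof. unfold log_plus. rewrite <- ln_1. apply ln_le. lra. apply Rmax_l. Qed.

(** Finite order without iterated logarithms or upper limits; a natural exponent is enough. *)
Definition finite_growth (f : C -> C) : Prop :=
  exists (K : nat) (r0 : R), forall r x, r0 <= r -> Cmod x <= r -> Cmod (f x) <= exp (r ^ K).

Lemma max_modulus_lub (f : C -> C) (r : R) :
  entire f -> 0 <= r -> is_lub_Rbar (fun y => exists x, Cmod x <= r /\ y = Cmod (f x)) (max_modulus f r).
Proof.
  intros Hf Hr. unfold max_modulus.
  assert (H := Lub_Rbar_correct (fun y => exists x, Cmod x <= r /\ y = Cmod (f x))).
  set (s := Lub_Rbar _) in *. destruct (disc_bound f Hf r) as [M HM].
  destruct H as [H1 H2].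
  assert (U : Rbar_le s M). { apply H2. intros y [x [Hx ->]]. apply HM, Hx. }
  assert (L : Rbar_le (Cmod (f (RtoC 0))) s). { apply H1. exists (RtoC 0). rewrite Cmod_0. auto. }
  destruct s; try contradiction. split; assumption.
Qed.

Lemma order_finite_iff (f : C -> C) : entire f -> is_finite (order f) <-> finite_growth f.
Proof.
  intros Hf. unfold order, LimSup_p_infty.
  set (h := fun r => log_plus (log_plus (max_modulus f r)) / ln r).
  set (E := fun s : Rbar => exists A : R, s = Lub_Rbar (fun y : R => exists r : R, A < r /\ y = h r)).
  change (is_finite (Rbar_glb E) <-> finite_growth f).
  destruct (Rbar_glb_correct E) as [G1 G2]. split.
  - intros Hfin.
    assert (X : exists s, E s /\ s <> p_infty).
    { apply NNPP. intros N. assert (Rbar_le p_infty (Rbar_glb E)).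
      { apply G2. intros s Hs. destruct s; simpl; auto; apply N; eexists; split; try exact Hs; discriminate. }
      rewrite <- Hfin in H. exact H. }
    destruct X as [s [[A Es] Ns]].
    destruct (Lub_Rbar_correct (fun y => exists r, A < r /\ y = h r)) as [U _]. rewrite <- Es in U.
    assert (B : exists B : R, forall r, A < r -> h r <= B).
    { destruct s as [b| |]; [|congruence|].
      - exists b. intros r Hr. apply (U (h r)). eauto.
      - exfalso. apply (U (h (A + 1))). exists (A + 1). split; auto; lra. }
    destruct B as [B HB]. destruct (INR_unbounded B) as [K HK].
    (* A + 1 puts r strictly beyond A, and r >= 2 makes ln r positive. *)
    exists K, (Rmax (A + 1) 2). intros r x Hr Hx.
    assert (R1 : A + 1 <= r) by (eapply Rle_trans; [apply Rmax_l|exact Hr]).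
    assert (R2 : 2 <= r) by (eapply Rle_trans; [apply Rmax_r|exact Hr]).
    apply Rle_trans with (max_modulus f r).
    + apply (max_modulus_lub f r Hf ltac:(lra)). eauto.
    + apply log_plus_inv. rewrite <- exp_ln_pow by lra. apply log_plus_inv.
      specialize (HB r ltac:(lra)). unfold h in HB.
      assert (Pl : 0 < ln r) by (rewrite <- ln_1; apply ln_increasing; lra).
      apply Rmult_le_reg_r with (/ ln r). apply Rinv_0_lt_compat, Pl.
      rewrite Rmult_assoc, Rinv_r by lra. unfold Rdiv in HB. lra.
  - intros [K [r0 H]].
    (* A finite upper bound leaves minus infinity possible; the quotient is nonnegative for r > 1,
       which excludes it. *)
    assert (Lo : Rbar_le 0 (Rbar_glb E)).
    { apply G2. intros s [A ->]. destruct (Lub_Rbar_correct (fun y => exists r, A < r /\ y = h r)) as [U _].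
      set (r := Rmax A 1 + 1). assert (A < r /\ 1 < r) as [Ra Rb] by (unfold r; generalize (Rmax_l A 1) (Rmax_r A 1); lra).
      eapply Rbar_le_trans. 2: apply (U (h r)); eauto. simpl. unfold h. apply Rdiv_le_0_compat. apply log_plus_ge_0.
      rewrite <- ln_1. apply ln_increasing; lra. }
    assert (Up : Rbar_le (Rbar_glb E) (INR K)).
    { set (A := Rmax r0 1). eapply Rbar_le_trans. apply (G1 (Lub_Rbar (fun y => exists r, A < r /\ y = h r))).
      exists A. reflexivity.
      apply Lub_Rbar_correct. intros y [r [Hr ->]]. simpl.
      assert (r0 < r /\ 1 < r) as [Ra Rb] by (unfold A in Hr; generalize (Rmax_l r0 1) (Rmax_r r0 1); lra).
      assert (Pl : 0 < ln r) by (rewrite <- ln_1; apply ln_increasing; lra).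
      assert (Mm : max_modulus f r <= exp (r ^ K)).
      { apply (proj2 (max_modulus_lub f r Hf ltac:(lra)) (Finite (exp (r ^ K)))).
        intros y [x [Hx ->]]. apply H; lra. }
      unfold h. apply Rmult_le_reg_r with (ln r). exact Pl. unfold Rdiv. rewrite Rmult_assoc, Rinv_l, Rmult_1_r by lra.
      apply log_plus_le. apply Rmult_le_pos. apply pos_INR. lra. rewrite exp_ln_pow by lra.
      apply log_plus_le. apply pow_le. lra. exact Mm. }
    destruct (Rbar_glb E); try contradiction. reflexivity.
Qed.

Lemma fold_right_Cplus (l : list C) (c : C) : fold_right Cplus c l = (fold_right Cplus (RtoC 0) l + c)%C.
Proof. induction l; simpl. ring. rewrite IHl. ring. Qed.

Lemma sum_inv_pow_seq (z : nat -> option C) (n N : nat) : sum_inv_pow z n (seq 0 N) = psum (inv_pow z n) N.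
Proof.
  unfold sum_inv_pow. induction N. reflexivity.
  rewrite seq_S, map_app, fold_right_app. simpl. rewrite fold_right_Cplus, IHN. ring.
Qed.

(** * Asymptotics and convergence of the power sums *)

Section Ordering.
Context (f : C -> C) (z : nat -> option C) (Hf : entire f) (f0 : f (RtoC 0) = RtoC 1) (Hz : zero_ordering f z).

Lemma disc_cut (r : R) :
  exists N, (forall m, (m < N)%nat <-> exists w, z m = Some w /\ Cmod w < r) /\ zero_free_from z N r.
Proof.
  destruct (finitely_many f z Hf f0 Hz r) as [N0 H0].
  (* [N] is the first index whose zero is missing or outside the disc; the ordering then keeps all
     later zeroes outside. *)
  assert (X : exists N, ~ (exists w, z N = Some w /\ Cmod w < r) /\
     forall m, (m < N)%nat -> exists w, z m = Some w /\ Cmod w < r).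
  { assert (Y : forall k, (forall m, (m < k)%nat -> exists w, z m = Some w /\ Cmod w < r) \/
       exists N, ~ (exists w, z N = Some w /\ Cmod w < r) /\ forall m, (m < N)%nat -> exists w, z m = Some w /\ Cmod w < r).
    { induction k as [|k [IH|IH]]; [left; lia| |right; exact IH].
      destruct (classic (exists w, z k = Some w /\ Cmod w < r)) as [Yk|Nk].
      left. intros m Hm. destruct (Nat.eq_dec m k). subst; exact Yk. apply IH; lia.
      right. exists k. auto. }
    destruct (Y (S N0)) as [H|H]; [|exact H].
    exfalso. destruct (H N0 ltac:(lia)) as [w [E1 E2]]. generalize (H0 N0 w E1 E2). lia. }
  destruct X as [N [N1 N2]]. exists N.
  assert (ZF : zero_free_from z N r).
  { intros m w Hm Em. apply Rnot_lt_le. intros K. apply N1.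
    destruct (ordering_initial f z Hz N m w Hm Em) as [v Ev]. exists v. split. exact Ev.
    generalize (ordering_mono f z Hz N m v w Hm Ev Em). lra. }
  split; [|exact ZF]. intros m. split. apply N2. intros [w [Ew Hw]]. apply not_le. intros K.
  generalize (ZF m w K Ew). lra.
Qed.

Lemma zero_free_eventually (r : R) : exists N0, forall N, (N0 <= N)%nat -> zero_free_from z N r.
Proof.
  destruct (disc_cut r) as [N0 [_ H]]. exists N0. intros N HN m w Hm. apply H. lia.
Qed.

(** The modulus of z_N separates the first N zeroes from the rest; when there is no z_N, any bound
    for the first N zeroes does. *)
Lemma radius_at (N : nat) (r : R) :
  zero_free_from z N r -> exists R', r <= R' /\ zero_free_from z N R' /\
    forall m w, (m < N)%nat -> z m = Some w -> Cmod w <= R'.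
Proof.
  intros HN. destruct (z N) as [v|] eqn:EN.
  - exists (Cmod v). split. apply (HN N v (Nat.le_refl N) EN). split.
    + intros m w Hm Em. apply (ordering_mono f z Hz N m v w Hm EN Em).
    + intros m w Hm Em. apply (ordering_mono f z Hz m N w v ltac:(lia) Em EN).
  - assert (X : forall n, exists R', r <= R' /\ forall m w, (m < n)%nat -> z m = Some w -> Cmod w <= R').
    { induction n as [|n [R' [H1 H2]]]. exists r. split. lra. intros; lia.
      destruct (z n) as [u|] eqn:En.
      - exists (Rmax R' (Cmod u)). split. eapply Rle_trans; [exact H1|apply Rmax_l].
        intros m w Hm Em. destruct (Nat.eq_dec m n). subst. replace w with u by congruence. apply Rmax_r.
        eapply Rle_trans; [apply (H2 m w); [lia|exact Em]|apply Rmax_l].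
      - exists R'. split. exact H1. intros m w Hm Em. destruct (Nat.eq_dec m n). subst. congruence.
        apply (H2 m w); [lia|exact Em]. }
    destruct (X N) as [R' [H1 H2]]. exists R'. split. exact H1. split; [|exact H2].
    intros m w Hm Em. destruct (ordering_initial f z Hz N m w Hm Em). congruence.
Qed.

Context (G : C -> C) (a : nat -> C)
  (f_expG : near (RtoC 0) (fun x : C => f x = Cexp (G x)))
  (G_series : near (RtoC 0) (fun x : C =>
     @is_series C_AbsRing C_NormedModule
       (fun n : nat =>
          Copp (Cmult (Cdiv (a (S n)) (RtoC (INR (S n)))) (Cpow x (S n))))
       (G x))).

Lemma power_sums_asymptotic (r : R) :
  0 < r -> (forall w : C, f w = RtoC 0 -> Cmod w <> r) ->
  exists l : list nat, indices_in_disc z r l /\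
    @is_domin nat R_AbsRing C_AbsRing R_NormedModule C_NormedModule eventually
      (fun n : nat => 1 / r ^ n) (fun n : nat => Cminus (a n) (sum_inv_pow z n l)).
Proof.
  intros Hr Nr. destruct (disc_cut r) as [N [HN ZF]]. exists (seq 0 N). split.
  { split. apply seq_NoDup. intros m. rewrite in_seq, <- HN. lia. }
  (* The absence of zeroes of modulus [r] makes the inequality strict, and the gap between r and R'
     yields the ratio q < 1 below. *)
  assert (X : exists R', r < R' /\ zero_free_from z N R').
  { destruct (z N) as [v|] eqn:EN.
    - exists (Cmod v). split.
      + assert (H := ZF N v (Nat.le_refl N) EN). assert (H2 := Nr v). destruct (zero_of_index f z f0 Hz N v EN) as [H3 _].
        specialize (H2 H3). lra.
      + intros m w Hm Em. apply (ordering_mono f z Hz N m v w Hm EN Em).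
    - exists (r + 1). split. lra. intros m w Hm Em. destruct (ordering_initial f z Hz N m w Hm Em). congruence. }
  destruct X as [R' [HR ZF']].
  destruct (cofactor_log f z Hf f0 Hz N R' ltac:(lra) ZF') as [g [L [b [Hg [Ef [HL [b0 Eg]]]]]]].
  destruct (pbound_geom R' r (dcoef b) (pbound_dcoef _ _ (pseries_pbound _ _ _ HL)) ltac:(lra)) as [M [q [HM [Hq B]]]].
  intros eps. assert (He := cond_pos eps).
  assert (HT : 0 < M * r + 1) by nra.
  destruct (pow_lt_1_zero q ltac:(rewrite Rabs_pos_eq; lra) (eps / (M * r + 1)) (Rdiv_lt_0_compat _ _ He HT)) as [n1 Hn1].
  exists (S n1). intros [|n] Hn. lia. specialize (Hn1 n ltac:(lia)). rewrite Rabs_pos_eq in Hn1 by (apply pow_le; lra).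
  rewrite sum_inv_pow_seq.
  rewrite (cofactor_log_coef f z f0 Hz G a f_expG G_series N R' g L b n ltac:(lra) Ef HL b0 Eg).
  change (Cmod (- (INR (S n) * b (S n))) <= eps * Rabs (1 / r ^ S n)).
  rewrite Cmod_opp. fold (dcoef b n). assert (Pr : 0 < r ^ S n) by (apply pow_lt, Hr).
  rewrite Rabs_pos_eq by (apply Rdiv_le_0_compat; lra).
  apply Rmult_le_reg_r with (r ^ S n). exact Pr.
  replace (eps * (1 / r ^ S n) * r ^ S n) with (pos eps) by (field; lra).
  specialize (B n). change (r ^ S n) with (r * r ^ n).
  apply Rmult_lt_compat_r with (r := M * r + 1) in Hn1; [|exact HT].
  replace (eps / (M * r + 1) * (M * r + 1)) with (pos eps) in Hn1 by (field; lra).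
  assert (0 <= q ^ n) by (apply pow_le; lra).
  replace (Cmod (dcoef b n) * (r * r ^ n)) with (r * (Cmod (dcoef b n) * r ^ n)) by ring.
  apply Rle_trans with (r * (M * q ^ n)). apply Rmult_le_compat_l; lra. nra.
Qed.

Lemma inv_pow_Some (n m : nat) (w : C) : z m = Some w -> Cmod (inv_pow z n m) = / Cmod w ^ n.
Proof.
  intros E. unfold inv_pow. rewrite E, Cmod_inv. rewrite Cmod_pow. reflexivity.
  apply Cpow_nz. apply (zero_of_index f z f0 Hz m w E).
Qed.

Lemma inv_pow_None (n m : nat) : z m = None -> Cmod (inv_pow z n m) = 0.
Proof. intros E. unfold inv_pow. rewrite E. apply Cmod_0. Qed.

(* 2^(m+1) <= |f| on |x| = 3|z_m| bounds m linearly in |z_m|^K, so |z_m|^(-2K) is O(1/m^2). *)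
Lemma finite_growth_summable (K : nat) (r0 : R) :
  (forall r x, r0 <= r -> Cmod x <= r -> Cmod (f x) <= exp (r ^ K)) ->
  forall n, (2 * K <= n)%nat -> ex_series (fun m => Cmod (inv_pow z n m)).
Proof.
  intros HK n Hn. set (r1 := Rmax r0 1).
  assert (Hr1 : r0 <= r1 /\ 1 <= r1) by (unfold r1; split; [apply Rmax_l|apply Rmax_r]).
  destruct (zero_free_eventually r1) as [N HN]. specialize (HN N (Nat.le_refl N)).
  (* Since ln 2 > 1/2, the count gives k + 1 <= 2 (3r)^K. Squaring contributes 4 (3^K)^2, and
     (k+1)(k+2) <= 2 (k+1)^2 the remaining factor 2. *)
  apply (ex_series_incr_n _ N). set (D := 8 * (3 ^ K) ^ 2).
  assert (P3 : 0 < 3 ^ K) by (apply pow_lt; lra).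
  (* The majorant is D/((k+1)(k+2)), in telescoping form. *)
  apply (ex_series_le (V := R_CompleteNormedModule) _ (fun k => D * (/ INR (S k) - / INR (S (S k))))).
  - intros k. change (Rabs (Cmod (inv_pow z n (N + k))) <= D * (/ INR (S k) - / INR (S (S k)))).
    rewrite Rabs_pos_eq by apply Cmod_ge_0.
    assert (Q1 : 1 <= INR (S k)) by (rewrite S_INR; generalize (pos_INR k); lra).
    assert (Q2 : / INR (S k) - / INR (S (S k)) = / (INR (S k) * (INR (S k) + 1))) by (rewrite (S_INR (S k)); field; lra).
    rewrite Q2. destruct (z (N + k)%nat) as [w|] eqn:Em.
    2: { rewrite inv_pow_None by exact Em. apply Rmult_le_pos. unfold D. nra. left. apply Rinv_0_lt_compat. nra. }
    rewrite (inv_pow_Some _ _ w Em). set (r := Cmod w).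
    assert (Hr : r1 <= r) by (apply (HN (N + k)%nat w); [lia|exact Em]).
    assert (J : 2 ^ S (N + k) <= exp ((3 * r) ^ K)).
    { apply (jensen_count f z Hf f0 Hz (S (N + k)) r). lra.
      - intros j Hj. destruct (ordering_initial f z Hz j (N + k)%nat w ltac:(lia) Em) as [v Ev]. exists v. split. exact Ev.
        apply (ordering_mono f z Hz j (N + k)%nat v w ltac:(lia) Ev Em).
      - intros x Hx. apply HK; lra. }
    assert (J2 : INR (S (N + k)) * ln 2 <= (3 * r) ^ K).
    { rewrite <- (ln_exp ((3 * r) ^ K)). rewrite <- ln_pow by lra. apply ln_le. apply pow_lt; lra. exact J. }
    assert (L2 := ln_lt_2).
    assert (J3 : INR (S k) <= 2 * (3 ^ K * r ^ K)).
    { rewrite Rpow_mult_distr in J2. assert (INR (S k) <= INR (S (N + k))) by (apply le_INR; lia). nra. }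
    assert (Pr : 1 <= r ^ K) by (apply pow_R1_Rle; lra).
    assert (J4 : (r ^ K) ^ 2 <= r ^ n).
    { rewrite <- pow_mult, Nat.mul_comm. apply Rle_pow. lra. exact Hn. }
    assert (J5 : INR (S k) * (INR (S k) + 1) <= D * r ^ n).
    { assert (INR (S k) * (INR (S k) + 1) <= 2 * INR (S k) ^ 2) by nra.
      assert (INR (S k) ^ 2 <= 4 * (3 ^ K) ^ 2 * (r ^ K) ^ 2).
      { replace (4 * (3 ^ K) ^ 2 * (r ^ K) ^ 2) with ((2 * (3 ^ K * r ^ K)) ^ 2) by ring. apply pow_incr. lra. }
      assert (0 < (3 ^ K) ^ 2) by (apply pow_lt, P3). unfold D.
      assert (4 * (3 ^ K) ^ 2 * (r ^ K) ^ 2 <= 4 * (3 ^ K) ^ 2 * r ^ n) by (apply Rmult_le_compat_l; lra). lra. }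
    assert (Pn : 0 < r ^ n) by (apply pow_lt; lra).
    apply Rmult_le_reg_r with (r ^ n * (INR (S k) * (INR (S k) + 1))). apply Rmult_lt_0_compat; nra.
    replace (/ r ^ n * (r ^ n * (INR (S k) * (INR (S k) + 1)))) with (INR (S k) * (INR (S k) + 1)) by (field; lra).
    replace (D * / (INR (S k) * (INR (S k) + 1)) * (r ^ n * (INR (S k) * (INR (S k) + 1)))) with (D * r ^ n) by (field; lra).
    exact J5.
  - apply (ex_series_scal D (fun k => / INR (S k) - / INR (S (S k)))).
    apply (ex_series_bounded _ 1).
    + intros k. assert (Q1 : 1 <= INR (S k)) by (rewrite S_INR; generalize (pos_INR k); lra).
      assert (/ INR (S (S k)) <= / INR (S k)) by (apply Rinv_le_contravar; [lra|apply le_INR; lia]). lra.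
    + intros k. assert (E : rsum (fun k => / INR (S k) - / INR (S (S k))) k = 1 - / INR (S k)).
      { induction k. simpl. field. cbn [rsum]. rewrite IHk. ring. }
      rewrite E. assert (0 < / INR (S k)) by (apply Rinv_0_lt_compat, lt_0_INR; lia). lra.
Qed.

Lemma finite_growth_sum (K : nat) (r0 : R) :
  (forall r x, r0 <= r -> Cmod x <= r -> Cmod (f x) <= exp (r ^ K)) ->
  forall n, (K <= n)%nat -> Cto eventually (psum (inv_pow z (S n))) (a (S n)).
Proof.
  intros HK n Hn eps He.
  (* Borel-Caratheodory on the circle of radius r/2 gives |b_(n+1)| (r/2)^(n+1) <= 2 (1 + (2r)^K) <=
     4 (2r)^K. As K <= n, one power of r remains and the error is at most T/r. *)
  set (T := 4 * INR (S n) * 2 ^ K * 2 ^ S n).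
  assert (In : 0 < INR (S n)) by (apply lt_0_INR; lia).
  assert (HT : 0 < T) by (unfold T; repeat apply Rmult_lt_0_compat; try lra; try (apply pow_lt; lra)).
  set (r1 := Rmax (Rmax r0 1) (T / eps + 1)).
  assert (Hr1 : r0 <= r1 /\ 1 <= r1 /\ T / eps + 1 <= r1).
  { unfold r1. split; [|split]. eapply Rle_trans; [apply Rmax_l|apply Rmax_l]. eapply Rle_trans; [apply Rmax_r|apply Rmax_l]. apply Rmax_r. }
  destruct (zero_free_eventually r1) as [N0 HN0]. exists N0. intros N HN.
  destruct (radius_at N r1 (HN0 N HN)) as [r [Hr [ZF In_disc]]].
  destruct (cofactor_log f z Hf f0 Hz N r ltac:(lra) ZF) as [g [L [b [Hg [Ef [HL [b0 Eg]]]]]]].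
  assert (HA : forall x, Cmod x < r -> Re (L x) <= 1 + (2 * r) ^ K).
  { intros x Hx. assert (B : Cmod (g x) <= exp ((2 * r) ^ K) * (2 * r / (2 * r - Cmod x))).
    { apply (sup_in_disc g (3 * r) (2 * r)). apply entire_holo_on, Hg. lra. lra.
      intros t _. assert (Mc := Cmod_cir (2 * r) t ltac:(lra)). set (y := cir (2 * r) t) in *.
      assert (Lb : 1 ^ N <= Cmod (partial_prod (lin_factor z y) N)).
      { apply partial_prod_lower. lra. intros m Hm. unfold lin_factor. destruct (z m) as [w|] eqn:Em.
        - assert (Nw : w <> RtoC 0) by apply (zero_of_index f z f0 Hz m w Em).
          assert (Pw := proj1 (Cmod_gt_0 w) Nw).
          assert (Tr := Cmod_rev_triangle (y / w) 1). rewrite Cmod_1, Cmod_div, Mc in Tr by exact Nw.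
          rewrite (Cmod_minus_sym 1 (y / w)). assert (Bw := In_disc m w Hm Em).
          assert (2 <= 2 * r / Cmod w); [|lra]. apply Rmult_le_reg_r with (Cmod w). exact Pw.
          unfold Rdiv. rewrite Rmult_assoc, Rinv_l; lra.
        - rewrite Cmod_1. lra. }
      rewrite pow1 in Lb. apply Rle_trans with (Cmod (f y)).
      rewrite Ef, Cmod_mult. rewrite <- (Rmult_1_l (Cmod (g y))) at 1. apply Rmult_le_compat_r. apply Cmod_ge_0. exact Lb.
      apply HK; lra. }
    rewrite Eg, Cmod_Cexp in B by exact Hx.
    (* The loss factor is at most 2 <= e; it becomes the summand 1 in the bound for Re L. *)
    assert (D2 : 2 * r / (2 * r - Cmod x) <= exp 1).
    { apply Rle_trans with 2. 2: generalize (exp_ineq1_le 1); lra.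
      apply Rmult_le_reg_r with (2 * r - Cmod x). lra. unfold Rdiv. rewrite Rmult_assoc, Rinv_l; lra. }
    assert (B2 : exp (Re (L x)) <= exp (1 + (2 * r) ^ K)).
    { rewrite exp_plus, Rmult_comm. eapply Rle_trans. exact B. apply Rmult_le_compat_l. left; apply exp_pos. exact D2. }
    apply Rnot_lt_le. intros Lt. apply exp_increasing in Lt. lra. }
  assert (Cb := caratheodory r (r / 2) (1 + (2 * r) ^ K) L b n HL b0 HA ltac:(lra)).
  rewrite Cmod_minus_sym.
  rewrite (cofactor_log_coef f z f0 Hz G a f_expG G_series N r g L b n ltac:(lra) Ef HL b0 Eg).
  rewrite Cmod_opp, Cmod_mult, Cmod_RtoC_pos by lra.
  assert (Pk : 1 <= (2 * r) ^ K) by (apply pow_R1_Rle; lra).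
  assert (Pn : 0 < r ^ n) by (apply pow_lt; lra).
  assert (P2n : 0 < 2 ^ S n) by (apply pow_lt; lra).
  assert (P2K : 0 < 2 ^ K) by (apply pow_lt; lra).
  assert (Rk : r ^ K <= r ^ n) by (apply Rle_pow; [lra|exact Hn]).
  assert (F : Cmod (b (S n)) * r <= 4 * 2 ^ K * 2 ^ S n).
  { apply Rmult_le_reg_r with (r ^ n). exact Pn.
    unfold Rdiv in Cb. rewrite Rpow_mult_distr, pow_inv in Cb.
    apply Rmult_le_compat_r with (r := 2 ^ S n) in Cb; [|lra].
    replace (Cmod (b (S n)) * (r ^ S n * / 2 ^ S n) * 2 ^ S n) with (Cmod (b (S n)) * r * r ^ n) in Cb.
    2: { change (r ^ S n) with (r * r ^ n). field. lra. }
    eapply Rle_trans. exact Cb.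
    apply Rle_trans with (4 * (2 * r) ^ K * 2 ^ S n). apply Rmult_le_compat_r; [left; exact P2n | lra].
    rewrite Rpow_mult_distr.
    replace (4 * (2 ^ K * r ^ K) * 2 ^ S n) with (4 * 2 ^ K * 2 ^ S n * r ^ K) by ring.
    apply Rmult_le_compat_l; [|exact Rk]. apply Rmult_le_pos; [apply Rmult_le_pos|]; lra. }
  assert (F2 : INR (S n) * Cmod (b (S n)) * r <= T).
  { unfold T. replace (4 * INR (S n) * 2 ^ K * 2 ^ S n) with (INR (S n) * (4 * 2 ^ K * 2 ^ S n)) by ring.
    rewrite Rmult_assoc. apply Rmult_le_compat_l; lra. }
  assert (F3 : T < eps * r).
  { apply Rmult_lt_reg_r with (/ eps). apply Rinv_0_lt_compat, He. replace (eps * r * / eps) with r by (field; lra). unfold Rdiv in Hr1. lra. }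
  apply Rmult_lt_reg_r with r; lra.
Qed.

Lemma finite_growth_power_sums : finite_growth f -> exists n0, power_sum_identity z a n0.
Proof.
  intros [K [r0 HK]]. exists (2 * K)%nat. intros n Hn. split.
  - apply (finite_growth_summable K r0 HK). lia.
  - destruct n as [|n]; [lia|]. apply csums_is_series. apply (finite_growth_sum K r0 HK). lia.
Qed.
End Ordering.

(** * The Hadamard product *)

Lemma least_exists (P : nat -> Prop) : (exists n, P n) -> exists n, is_least P n.
Proof.
  intros [n Hn]. induction n as [n IH] using lt_wf_ind.
  destruct (classic (exists k, (k < n)%nat /\ P k)) as [[k [Hk Pk]]|N].
  - apply (IH k Hk Pk).
  - exists n. split. exact Hn. intros k Pk. apply Nat.le_ngt. intros K. apply N. eauto.
Qed.

Lemma psum_truncate (u : nat -> C) (p n : nat) :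
  (p <= n)%nat -> psum (fun k => if lt_dec k p then u k else RtoC 0) n = psum u p.
Proof.
  intros H. induction H as [|n H IH].
  - apply psum_ext. intros k Hk. destruct (lt_dec k p); [reflexivity|lia].
  - simpl. rewrite IH. destruct (lt_dec n p); [lia|ring].
Qed.

Lemma psum_stationary (u : nat -> C) (d n : nat) :
  (d <= n)%nat -> (forall k, (d <= k)%nat -> u k = RtoC 0) -> psum u n = psum u d.
Proof.
  intros H Z. induction H as [|n H IH]. reflexivity. simpl. rewrite IH, Z by lia. ring.
Qed.

Lemma Cmod_psum (u : nat -> C) (n : nat) : Cmod (psum u n) <= rsum (fun k => Cmod (u k)) n.
Proof.
  induction n; simpl. rewrite Cmod_0. lra. eapply Rle_trans. apply Cmod_triangle. lra.
Qed.

Lemma rsum_le (u v : nat -> R) (n : nat) : (forall k, (k < n)%nat -> u k <= v k) -> rsum u n <= rsum v n.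
Proof.
  induction n; intros H; simpl. lra. assert (u n <= v n) by (apply H; lia).
  assert (rsum u n <= rsum v n) by (apply IHn; intros; apply H; lia). lra.
Qed.

Lemma rsum_scal (c : R) (u : nat -> R) (n : nat) : rsum (fun k => c * u k) n = c * rsum u n.
Proof. induction n; simpl. ring. rewrite IHn. ring. Qed.

Lemma rsum_const (c : R) (n : nat) : rsum (fun _ => c) n = INR n * c.
Proof. induction n. simpl. ring. cbn [rsum]. rewrite IHn, S_INR. ring. Qed.

Definition log_weierstrass (u : C) (p : nat) : C := psum (fun k => u ^ S k / INR (S k))%C p.

Lemma weierstrass_factor_eq (u : C) (p : nat) :
  weierstrass_factor u p = ((1 - u) * Cexp (log_weierstrass u p))%C.
Proof.
  unfold weierstrass_factor. do 2 f_equal. induction p.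
  - apply (@sum_n_m_zero C_AbelianMonoid). lia.
  - rewrite sum_n_Sm by lia. rewrite IHp. reflexivity.
Qed.

(* For |u| <= rho with 2 rho >= 1 every power of |u| up to the p-th is at most (2 rho)^(p+1). *)
Lemma weierstrass_factor_bound (u : C) (p : nat) (rho : R) :
  Cmod u <= rho -> 1 <= 2 * rho ->
  Cmod (weierstrass_factor u p) <= exp (INR (S p) * (2 * rho) ^ (p + 1)).
Proof.
  intros Hu Hr. rewrite weierstrass_factor_eq, Cmod_mult, Cmod_Cexp.
  assert (Pu := Cmod_ge_0 u).
  assert (B : forall j, (j <= p)%nat -> Cmod u ^ S j <= (2 * rho) ^ (p + 1)).
  { intros j Hj. apply Rle_trans with ((2 * rho) ^ S j). apply pow_incr. lra. apply Rle_pow. exact Hr. lia. }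
  assert (B1 : Cmod (1 - u) <= exp (1 * (2 * rho) ^ (p + 1))).
  { eapply Rle_trans. apply Cmod_triangle_minus. rewrite Cmod_1.
    eapply Rle_trans. apply exp_ineq1_le. specialize (B 0%nat ltac:(lia)). rewrite pow_1 in B.
    rewrite Rmult_1_l. destruct B as [B|B]. left; apply exp_increasing, B. right; f_equal; exact B. }
  assert (B2 : exp (Re (log_weierstrass u p)) <= exp (INR p * (2 * rho) ^ (p + 1))).
  { assert (L : Re (log_weierstrass u p) <= INR p * (2 * rho) ^ (p + 1)).
    { eapply Rle_trans. apply RRle_abs. eapply Rle_trans. apply re_le_Cmod. eapply Rle_trans. apply Cmod_psum.
      rewrite <- rsum_const. apply rsum_le. intros k Hk.
      rewrite Cmod_div, Cmod_pow, Cmod_RtoC_pos by (apply INR_S_neq0 || apply pos_INR).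
      assert (I1 : 1 <= INR (S k)) by (rewrite S_INR; generalize (pos_INR k); lra).
      apply Rle_trans with (Cmod u ^ S k). 2: apply B; lia.
      apply Rmult_le_reg_r with (INR (S k)). lra. unfold Rdiv. rewrite Rmult_assoc, Rinv_l by lra.
      assert (0 <= Cmod u ^ S k) by (apply pow_le, Pu). nra. }
    destruct L as [L|L]. left; apply exp_increasing, L. right; f_equal; exact L. }
  rewrite S_INR. replace ((INR p + 1) * (2 * rho) ^ (p + 1)) with (1 * (2 * rho) ^ (p + 1) + INR p * (2 * rho) ^ (p + 1)) by ring.
  rewrite exp_plus. apply Rmult_le_compat; auto. apply Cmod_ge_0. left; apply exp_pos.
Qed.

Section Hadamard.
Context (f : C -> C) (z : nat -> option C) (Hf : entire f) (f0 : f (RtoC 0) = RtoC 1) (Hz : zero_ordering f z).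
Context (G : C -> C) (a : nat -> C)
  (f_expG : near (RtoC 0) (fun x : C => f x = Cexp (G x)))
  (G_series : near (RtoC 0) (fun x : C =>
     @is_series C_AbsRing C_NormedModule
       (fun n : nat =>
          Copp (Cmult (Cdiv (a (S n)) (RtoC (INR (S n)))) (Cpow x (S n))))
       (G x))).
Context (p : nat) (Hp : ex_series (fun m => Cmod (inv_pow z (p + 1) m))).

Lemma zero_free_disc : exists r, 0 < r /\ zero_free_from z 0 r.
Proof.
  destruct (z O) as [w|] eqn:E.
  - exists (Cmod w). split. apply Cmod_gt_0. apply (zero_of_index f z f0 Hz 0 w E).
    intros m v _ Em. apply (ordering_mono f z Hz 0 m w v); auto. lia.
  - exists 1. split. lra. intros m v _ Em. destruct (ordering_initial f z Hz 0 m v); auto. lia. congruence.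
Qed.

(** Reduces every exponent above p + 1 to p + 1 at the price of r^(-j), so that a single tail
    controls all power sums. *)
Lemma inv_pow_scale (N m j : nat) (r : R) :
  0 < r -> zero_free_from z N r -> (N <= m)%nat ->
  Cmod (inv_pow z (p + 1 + j) m) <= / r ^ j * Cmod (inv_pow z (p + 1) m).
Proof.
  intros Hr HN Hm. destruct (z m) as [w|] eqn:Em.
  - rewrite !(inv_pow_Some f z f0 Hz _ _ w Em). assert (B := HN m w Hm Em).
    rewrite pow_add, Rinv_mult, Rmult_comm. apply Rmult_le_compat_r.
    left. apply Rinv_0_lt_compat, pow_lt. lra.
    apply Rinv_le_contravar. apply pow_lt, Hr. apply pow_incr. lra.
  - rewrite !inv_pow_None by exact Em. rewrite Rmult_0_r. lra.
Qed.

Lemma inv_pow_summable (n : nat) : (p + 1 <= n)%nat -> ex_series (fun m => Cmod (inv_pow z n m)).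
Proof.
  intros Hn. destruct zero_free_disc as [r [Hr ZF]]. replace n with (p + 1 + (n - (p + 1)))%nat by lia.
  set (j := (n - (p + 1))%nat).
  apply (ex_series_le (V := R_CompleteNormedModule) _ (fun m => / r ^ j * Cmod (inv_pow z (p + 1) m))).
  - intros m. change (Rabs (Cmod (inv_pow z (p + 1 + j) m)) <= / r ^ j * Cmod (inv_pow z (p + 1) m)).
    rewrite Rabs_pos_eq by apply Cmod_ge_0. apply (inv_pow_scale 0 m j r Hr ZF). lia.
  - apply (ex_series_scal (/ r ^ j) (fun m => Cmod (inv_pow z (p + 1) m))). exact Hp.
Qed.

Definition power_sum (n : nat) : C := psumlim (inv_pow z n).

Lemma power_sum_correct (n : nat) : (p + 1 <= n)%nat -> csums (inv_pow z n) (power_sum n).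
Proof.
  intros Hn. assert (E : ex_series (V := C_CompleteNormedModule) (inv_pow z n)).
  { apply (ex_series_le _ (fun m => Cmod (inv_pow z n m))). intros m. apply Rle_refl. apply inv_pow_summable, Hn. }
  destruct E as [l Hl]. apply csums_is_series in Hl. apply (psumlim_correct _ l Hl).
Qed.

(* The Taylor coefficients at 0 of the exponent Q in f = exp(Q) prod_m E(x/z_m, p). *)
Definition hadamard_coef (n : nat) : C :=
  match n with
  | O => RtoC 0
  | S k => if lt_dec k p then (- (a n / INR n))%C else (- ((a n - power_sum n) / INR n))%C
  end.

(** Since [s] bounds the partial sums, [tail N] bounds the sum of |z_m|^(-(p+1)) over m >= N. *)
Context (s : R) (Hs : forall n, rsum (fun m => Cmod (inv_pow z (p + 1) m)) n <= s).
Let tail (N : nat) : R := s - rsum (fun m => Cmod (inv_pow z (p + 1) m)) N.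

Lemma power_sum_tail (N j : nat) (r : R) :
  0 < r -> zero_free_from z N r ->
  Cmod (power_sum (p + 1 + j) - psum (inv_pow z (p + 1 + j)) N) <= tail N * / r ^ j.
Proof.
  intros Hr HN. apply (Cto_closed (psum (inv_pow z (p + 1 + j)))). apply power_sum_correct; lia.
  exists N. intros M HM. eapply Rle_trans.
  apply (psum_dist _ (fun m => / r ^ j * rsum (fun m => Cmod (inv_pow z (p + 1) m)) m)). exact HM.
  - intros k Hk. eapply Rle_trans. apply (inv_pow_scale N k j r Hr HN). lia. simpl. lra.
  - cbv beta. rewrite <- Rmult_minus_distr_l, Rmult_comm. apply Rmult_le_compat_r.
    left. apply Rinv_0_lt_compat, pow_lt, Hr. unfold tail. specialize (Hs M). lra.
Qed.

Lemma tail_ge_0 (N : nat) : 0 <= tail N.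
Proof. unfold tail. specialize (Hs N). lra. Qed.

(** Exchanging two finite sums collects the exponents of the N Weierstrass factors by degree, where
    partial power sums appear. *)
Lemma prod_hadamard (x : C) (N : nat) :
  partial_prod (hadamard_factor z p x) N = (partial_prod (lin_factor z x) N *
    Cexp (psum (fun k => x ^ S k / INR (S k) * psum (inv_pow z (S k)) N) p))%C.
Proof.
  assert (E : psum (fun k => x ^ S k / INR (S k) * psum (inv_pow z (S k)) N)%C p =
     psum (fun m => match z m with Some w => log_weierstrass (x / w) p | None => RtoC 0 end) N).
  { transitivity (psum (fun k => psum (fun m => x ^ S k / INR (S k) * inv_pow z (S k) m)%C N) p).
    apply psum_ext. intros k _. rewrite psum_scal. reflexivity.
    rewrite psum_swap. apply psum_ext. intros m _. unfold inv_pow. destruct (z m) as [w|] eqn:Em.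
    - apply psum_ext. intros k _. assert (Nw : w <> RtoC 0) by apply (zero_of_index f z f0 Hz m w Em).
      unfold Cdiv. rewrite Cpow_mult_l, Cpow_inv by exact Nw. ring.
    - apply (psum_stationary _ 0 p). lia. intros k _. ring. }
  rewrite E, <- partial_prod_Cexp, <- partial_prod_mult. apply partial_prod_ext. intros m _.
  unfold hadamard_factor, lin_factor. destruct (z m) as [w|].
  - apply weierstrass_factor_eq.
  - rewrite Cexp_0. ring.
Qed.

(* The exponent D is the part sum_(n > p) x^n/n sum_(m >= N) z_m^(-n) missing from the product. *)
Lemma hadamard_remainder (N d : nat) (r : R) (x : C) :
  Cmod x < r -> zero_free_from z N r -> (forall k, (d < k)%nat -> hadamard_coef k = RtoC 0) ->
  exists D, f x = (Cexp (psum (pterm hadamard_coef x) (S d)) * partial_prod (hadamard_factor z p x) N * Cexp D)%C /\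
    Cmod D <= tail N * Cmod x ^ (p + 1) / (1 - Cmod x / r).
Proof.
  intros Hx ZF Hd. assert (Px := Cmod_ge_0 x). assert (Hr : 0 < r) by lra.
  destruct (cofactor_log f z Hf f0 Hz N r Hr ZF) as [g [L [b [Hg [Ef [HL [b0 Eg]]]]]]].
  set (Q := psum (pterm hadamard_coef x) (S d)).
  set (v := fun k => (x ^ S k / INR (S k) * psum (inv_pow z (S k)) N)%C).
  exists (L x - (Q + psum v p))%C. split.
  { rewrite prod_hadamard, Ef, Eg by exact Hx. fold v.
    replace (Cexp (L x)) with (Cexp Q * Cexp (psum v p) * Cexp (L x - (Q + psum v p)))%C.
    ring. rewrite <- !Cexp_plus. f_equal. ring. }
  set (t := Cmod x / r).
  assert (Ht : 0 <= t < 1).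
  { unfold t. split. apply Rdiv_le_0_compat; lra. apply Rmult_lt_reg_r with r. exact Hr.
    unfold Rdiv. rewrite Rmult_assoc, Rinv_l; lra. }
  (* [e k] is the part of degree k + 1 of the exponent D. For k < p the Weierstrass exponents cancel
     it; from p on it is a tail of a power sum and decays like (|x|/r)^k. *)
  set (e := fun k => (pterm b x (S k) - pterm hadamard_coef x (S k) - (if lt_dec k p then v k else RtoC 0))%C).
  assert (Eb : forall k, b (S k) = (- ((a (S k) - psum (inv_pow z (S k)) N) / INR (S k)))%C).
  { intros k. rewrite (cofactor_log_coef f z f0 Hz G a f_expG G_series N r g L b k Hr Ef HL b0 Eg).
    field. apply INR_S_neq0. }
  assert (E0 : forall k, (k < p)%nat -> e k = RtoC 0).
  { intros k Hk. unfold e, pterm, hadamard_coef. rewrite Eb. destruct (lt_dec k p); [|lia]. unfold v. field. apply INR_S_neq0. }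
  assert (Be : forall k, (p <= k)%nat -> Cmod (e k) <= (tail N * Cmod x * r ^ p) * t ^ k).
  { intros k Hk. unfold e, pterm, hadamard_coef. rewrite Eb. destruct (lt_dec k p); [lia|].
    replace (- ((a (S k) - psum (inv_pow z (S k)) N) / INR (S k)) * x ^ S k
      - - ((a (S k) - power_sum (S k)) / INR (S k)) * x ^ S k - 0)%C
      with (- ((power_sum (S k) - psum (inv_pow z (S k)) N) / INR (S k)) * x ^ S k)%C by (field; apply INR_S_neq0).
    rewrite Cmod_mult, Cmod_opp, Cmod_div, Cmod_pow, Cmod_RtoC_pos by (apply INR_S_neq0 || apply pos_INR).
    assert (T := power_sum_tail N (k - p) r Hr ZF). replace (p + 1 + (k - p))%nat with (S k) in T by lia.
    set (y := Cmod (power_sum (S k) - psum (inv_pow z (S k)) N)) in *.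
    assert (Py : 0 <= y) by apply Cmod_ge_0.
    assert (I1 : 1 <= INR (S k)) by (rewrite S_INR; generalize (pos_INR k); lra).
    assert (y / INR (S k) <= y).
    { apply Rmult_le_reg_r with (INR (S k)). lra. unfold Rdiv. rewrite Rmult_assoc, Rinv_l by lra. nra. }
    assert (Pr : 0 < r ^ k) by (apply pow_lt, Hr). assert (Prp : 0 < r ^ p) by (apply pow_lt, Hr).
    assert (Er : r ^ k = r ^ p * r ^ (k - p)) by (rewrite <- pow_add; f_equal; lia).
    assert (Prk : 0 < r ^ (k - p)) by (apply pow_lt, Hr).
    replace (tail N * Cmod x * r ^ p * t ^ k) with (tail N * / r ^ (k - p) * Cmod x ^ S k).
    apply Rmult_le_compat_r. apply pow_le, Px. lra.
    unfold t, Rdiv. rewrite Rpow_mult_distr, pow_inv, Er. change (Cmod x ^ S k) with (Cmod x * Cmod x ^ k). field. lra. }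
  assert (Ep : psum e p = RtoC 0).
  { rewrite (psum_ext e (fun _ => RtoC 0) p E0). apply (psum_stationary _ 0 p). lia. auto. }
  apply (Cto_closed (fun n => psum (pterm b x) (S n))).
  { apply (Cto_S (psum (pterm b x))), HL, Hx. }
  (* From here on the partial sums contain both finite sums, the one of length p and the polynomial
     of degree d. *)
  exists (p + d)%nat. intros M HM.
  assert (E1 : (psum (pterm b x) (S M) - (Q + psum v p) = psum e M)%C).
  { unfold e. rewrite !psum_minus, psum_truncate by lia. unfold Q. rewrite !psum_shift.
    rewrite (psum_stationary (fun k => pterm hadamard_coef x (S k)) d M).
    unfold pterm at 1 3, hadamard_coef at 1. rewrite b0. ring. lia.
    intros k Hk. unfold pterm. rewrite Hd by lia. ring. }
  rewrite E1. replace (psum e M) with (psum e M - psum e p)%C by (rewrite Ep; ring).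
  eapply Rle_trans. apply (psum_geom_bound e (tail N * Cmod x * r ^ p) t p M Ht).
  apply Rmult_le_pos. apply Rmult_le_pos. apply tail_ge_0. exact Px. apply pow_le. lra. lia. exact Be.
  right. unfold t, Rdiv. rewrite Rpow_mult_distr, pow_inv, Nat.add_1_r.
  change (Cmod x ^ S p) with (Cmod x * Cmod x ^ p). field.
  repeat split; try lra; apply pow_nonzero; lra.
Qed.

Context (Hs_lim : forall eps, 0 < eps -> exists N, forall n, (N <= n)%nat -> tail n < eps).

(** For fixed x the disc of radius |x| + 1 stays and only N grows, so the remainder D tends to 0
    with the tail. *)
Lemma hadamard_product (d : nat) (x : C) :
  (forall k, (d < k)%nat -> hadamard_coef k = RtoC 0) ->
  Cto eventually (partial_prod (hadamard_factor z p x)) (f x * Cexp (- psum (pterm hadamard_coef x) (S d)))%C.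
Proof.
  intros Hd eps He. set (Q := psum (pterm hadamard_coef x) (S d)).
  set (K := Cmod (f x * Cexp (- Q)) + 1). assert (HK : 0 < K) by (unfold K; generalize (Cmod_ge_0 (f x * Cexp (- Q))); lra).
  destruct (proj1 (nb_iff _ _) (Ccont_Cexp (RtoC 0) (eps / K) (Rdiv_lt_0_compat _ _ He HK))) as [del [Hdel B]].
  set (r := Cmod x + 1). assert (Px := Cmod_ge_0 x).
  set (T := Cmod x ^ (p + 1) / (1 - Cmod x / r) + 1).
  assert (Hq : Cmod x / r < 1).
  { apply Rmult_lt_reg_r with r. unfold r; lra. unfold Rdiv. rewrite Rmult_assoc, Rinv_l; unfold r; lra. }
  assert (HT : 0 < T).
  { unfold T. assert (0 <= Cmod x ^ (p + 1) / (1 - Cmod x / r)); [|lra]. apply Rdiv_le_0_compat. apply pow_le, Px. lra. }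
  destruct (Hs_lim (del / T) (Rdiv_lt_0_compat _ _ Hdel HT)) as [N1 HN1].
  destruct (zero_free_eventually f z Hf f0 Hz r) as [N2 HN2].
  exists (N1 + N2)%nat. intros N HN. specialize (HN1 N ltac:(lia)). specialize (HN2 N ltac:(lia)).
  destruct (hadamard_remainder N d r x ltac:(unfold r; lra) HN2 Hd) as [D [E BD]]. fold Q in E.
  assert (D1 : Cmod D < del).
  { eapply Rle_lt_trans. exact BD. apply Rmult_lt_compat_r with (r := T) in HN1; [|exact HT].
    replace (del / T * T) with del in HN1 by (field; lra). eapply Rle_lt_trans; [|exact HN1].
    unfold Rdiv at 1. rewrite Rmult_assoc. apply Rmult_le_compat_l. apply tail_ge_0. unfold T, Rdiv. lra. }
  specialize (B (- D)%C). rewrite Cexp_0 in B. replace (- D - 0)%C with (- D)%C in B by ring. rewrite Cmod_opp in B.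
  specialize (B D1).
  assert (EP : partial_prod (hadamard_factor z p x) N = (f x * Cexp (- Q) * Cexp (- D))%C).
  { rewrite E. rewrite !Cexp_opp. field. split; apply Cexp_neq0. }
  rewrite EP. replace (f x * Cexp (- Q) * Cexp (- D) - f x * Cexp (- Q))%C with ((f x * Cexp (- Q)) * (Cexp (- D) - 1))%C by ring.
  rewrite Cmod_mult. apply Rmult_lt_compat_l with (r := K) in B; [|exact HK].
  replace (K * (eps / K)) with eps in B by (field; lra). eapply Rle_lt_trans; [|exact B].
  apply Rmult_le_compat_r. apply Cmod_ge_0. unfold K. lra.
Qed.

Lemma Cmod_partial_prod_exp (u : nat -> C) (v : nat -> R) (n : nat) :
  (forall m, (m < n)%nat -> Cmod (u m) <= exp (v m)) -> Cmod (partial_prod u n) <= exp (rsum v n).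
Proof.
  induction n; intros H; simpl. rewrite Cmod_1, exp_0. lra.
  rewrite Cmod_mult, exp_plus. apply Rmult_le_compat; try apply Cmod_ge_0. apply IHn; intros; apply H; lia. apply H; lia.
Qed.

(** Here N moves with r. Up to a factor exp(D) with D = O(r^(p+1)), f is exp(Q) times N factors, and
    the product of these is bounded independently of N because the sum of |z_m|^(-(p+1)) is. *)
Lemma hadamard_growth (d : nat) :
  (forall k, (d < k)%nat -> hadamard_coef k = RtoC 0) -> finite_growth f.
Proof.
  intros Hd. assert (Ps : 0 <= s) by (specialize (Hs 0%nat); simpl in Hs; lra).
  set (A := rsum (fun k => Cmod (hadamard_coef k)) (S d)).
  assert (PA : 0 <= A).
  { unfold A. replace 0 with (rsum (fun _ => 0) (S d)) by (rewrite rsum_const; ring). apply rsum_le. intros; apply Cmod_ge_0. }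
  set (B := INR (S p) * 2 ^ (p + 1) * s).
  assert (PB : 0 <= B).
  { unfold B. apply Rmult_le_pos; [apply Rmult_le_pos|exact Ps]. apply pos_INR. apply pow_le; lra. }
  (* r^K dominates both r^d from Q and r^(p+1) from the factors and D; the constant c is absorbed by
     one more power of r, as r >= c. *)
  set (K := (d + p + 1)%nat). set (c := A + B + 2 * s + 1).
  exists (S K), c. intros r x Hr Hx.
  assert (Hr1 : 1 <= r) by (unfold c in Hr; lra).
  assert (Px := Cmod_ge_0 x).
  (* Radius 2r serves twice: the remaining zeroes give 1/(1 - |x|/(2r)) <= 2, and the removed ones
     satisfy 2r/|z_m| >= 1, as [weierstrass_factor_bound] requires. *)
  destruct (disc_cut f z Hf f0 Hz (2 * r)) as [N [HN ZF]].
  destruct (hadamard_remainder N d (2 * r) x ltac:(lra) ZF Hd) as [D [E BD]].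
  set (Q := psum (pterm hadamard_coef x) (S d)) in *.
  assert (PK : 1 <= r ^ K) by (apply pow_R1_Rle; exact Hr1).
  assert (BQ : Re Q <= A * r ^ K).
  { eapply Rle_trans. apply RRle_abs. eapply Rle_trans. apply re_le_Cmod. eapply Rle_trans. apply Cmod_psum.
    unfold A. rewrite (Rmult_comm _ (r ^ K)), <- rsum_scal. apply rsum_le. intros k Hk. rewrite Cmod_pterm, Rmult_comm.
    apply Rmult_le_compat_r. apply Cmod_ge_0. apply Rle_trans with (r ^ k). apply pow_incr. lra. apply Rle_pow. exact Hr1. unfold K; lia. }
  assert (Pp : r ^ (p + 1) <= r ^ K) by (apply Rle_pow; [exact Hr1 | unfold K; lia]).
  assert (Pp0 : 0 < r ^ (p + 1)) by (apply pow_lt; lra).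
  assert (BD2 : Re D <= 2 * s * r ^ K).
  { eapply Rle_trans. apply RRle_abs. eapply Rle_trans. apply re_le_Cmod. eapply Rle_trans. exact BD.
    assert (Hh : Cmod x / (2 * r) <= 1 / 2).
    { apply Rmult_le_reg_r with (2 * r). lra. unfold Rdiv. rewrite (Rmult_assoc (Cmod x)), Rinv_l; lra. }
    assert (Tl : tail N <= s).
    { unfold tail. assert (0 <= rsum (fun m => Cmod (inv_pow z (p + 1) m)) N); [|lra].
      replace 0 with (rsum (fun _ => 0) N) by (rewrite rsum_const; ring). apply rsum_le. intros; apply Cmod_ge_0. }
    assert (T0 := tail_ge_0 N).
    assert (X1 : Cmod x ^ (p + 1) <= r ^ K).
    { eapply Rle_trans. 2: exact Pp. apply pow_incr. lra. }
    assert (X0 : 0 <= Cmod x ^ (p + 1)) by (apply pow_le, Px).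
    apply Rmult_le_reg_r with (1 - Cmod x / (2 * r)). lra.
    unfold Rdiv at 1. rewrite Rmult_assoc, Rinv_l, Rmult_1_r by lra.
    apply Rle_trans with (s * r ^ K). apply Rmult_le_compat; lra.
    assert (0 <= s * r ^ K) by (apply Rmult_le_pos; lra). nra. }
  assert (BP : Cmod (partial_prod (hadamard_factor z p x) N) <= exp (B * r ^ K)).
  { eapply Rle_trans. apply (Cmod_partial_prod_exp _ (fun m => (INR (S p) * (2 * r) ^ (p + 1)) * Cmod (inv_pow z (p + 1) m))).
    - intros m Hm. apply HN in Hm. destruct Hm as [w [Em Hw]]. unfold hadamard_factor. rewrite Em.
      assert (Nw : w <> RtoC 0) by apply (zero_of_index f z f0 Hz m w Em). assert (Pw := proj1 (Cmod_gt_0 w) Nw).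
      eapply Rle_trans. apply (weierstrass_factor_bound _ p (r / Cmod w)).
      + rewrite Cmod_div by exact Nw. apply Rmult_le_compat_r. left. apply Rinv_0_lt_compat, Pw. exact Hx.
      + apply Rmult_le_reg_r with (Cmod w). exact Pw. unfold Rdiv. rewrite (Rmult_assoc 2), (Rmult_assoc r), Rinv_l; lra.
      + right. f_equal. rewrite (inv_pow_Some f z f0 Hz _ _ w Em). unfold Rdiv.
        rewrite <- Rmult_assoc, (Rpow_mult_distr (2 * r)), pow_inv. ring.
    - rewrite rsum_scal.
      assert (Y : INR (S p) * (2 * r) ^ (p + 1) * rsum (fun m => Cmod (inv_pow z (p + 1) m)) N <= B * r ^ K).
      { unfold B. rewrite Rpow_mult_distr.
        replace (INR (S p) * 2 ^ (p + 1) * s * r ^ K) with ((INR (S p) * (2 ^ (p + 1) * r ^ K)) * s) by ring.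
        assert (P2 : 0 < 2 ^ (p + 1)) by (apply pow_lt; lra). assert (PI' := pos_INR (S p)).
        apply Rmult_le_compat.
        - apply Rmult_le_pos. exact PI'. apply Rmult_le_pos; lra.
        - replace 0 with (rsum (fun _ => 0) N) by (rewrite rsum_const; ring). apply rsum_le. intros; apply Cmod_ge_0.
        - apply Rmult_le_compat_l. exact PI'. apply Rmult_le_compat_l; lra.
        - apply Hs. }
      destruct Y as [Y|Y]. left; apply exp_increasing, Y. right; f_equal; exact Y. }
  rewrite E, !Cmod_mult, !Cmod_Cexp.
  apply Rle_trans with (exp (Re Q) * exp (B * r ^ K) * exp (Re D)).
  { apply Rmult_le_compat_r. left; apply exp_pos. apply Rmult_le_compat_l. left; apply exp_pos. exact BP. }
  rewrite <- !exp_plus.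
  assert (Y : Re Q + B * r ^ K + Re D <= r ^ S K).
  { change (r ^ S K) with (r * r ^ K). apply Rle_trans with (c * r ^ K). unfold c. nra. apply Rmult_le_compat_r; lra. }
  destruct Y as [Y|Y]. left; apply exp_increasing, Y. right; f_equal; exact Y.
Qed.
End Hadamard.

(** * The least exponent and the genus *)

Theorem theorem2p4 (f G : C -> C) (a : nat -> C) (z : nat -> option C)
  (f_entire : entire f)
  (f0 : f (RtoC 0) = RtoC 1)
  (G_holo : near (RtoC 0) (holomorphic_at G))
  (G0 : G (RtoC 0) = RtoC 0)
  (f_expG : near (RtoC 0) (fun x : C => f x = Cexp (G x)))
  (G_series : near (RtoC 0) (fun x : C =>
     @is_series C_AbsRing C_NormedModule
       (fun n : nat =>
          Copp (Cmult (Cdiv (a (S n)) (RtoC (INR (S n)))) (Cpow x (S n))))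
       (G x)))
  (z_ordering : zero_ordering f z) :
  (forall r : R, 0 < r ->
     (forall w : C, f w = RtoC 0 -> Cmod w <> r) ->
     exists l : list nat,
       indices_in_disc z r l /\
       @is_domin nat R_AbsRing C_AbsRing R_NormedModule C_NormedModule
         eventually
         (fun n : nat => 1 / r ^ n)
         (fun n : nat => Cminus (a n) (sum_inv_pow z n l)))
  /\
  (is_finite (order f) <-> exists n0 : nat, power_sum_identity z a n0)
  /\
  (is_finite (order f) \/ (exists n0 : nat, power_sum_identity z a n0) ->
   exists n0 : nat,
     is_least (power_sum_identity z a) n0 /\ is_genus f (Some n0)).
Proof.
  assert (Had : forall n0, power_sum_identity z a n0 -> exists n1,
    is_least (power_sum_identity z a) n1 /\ finite_growth f /\
    exists p d, is_least (fun p' => ex_series (fun m => Cmod (inv_pow z (p' + 1) m))) p /\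
      n1 = Nat.max d p /\ (d = 0%nat \/ hadamard_coef z a p d <> RtoC 0) /\
      forall x, Cto eventually (partial_prod (hadamard_factor z p x))
        (f x * Cexp (- psum (pterm (hadamard_coef z a p) x) (S d)))%C).
  { intros n0 Hn0.
    destruct (least_exists (fun p' => ex_series (fun m => Cmod (inv_pow z (p' + 1) m)))) as [p [Hp Lp]].
    { exists n0. apply Hn0. lia. }
    set (q := hadamard_coef z a p).
    assert (Qz : forall k, (p <= k)%nat -> (q (S k) = RtoC 0 <-> power_sum z (S k) = a (S k))).
    { intros k Hk. unfold q, hadamard_coef. destruct (lt_dec k p); [lia|]. assert (Nk := INR_S_neq0 k). split; intros E.
      - replace (power_sum z (S k)) with (a (S k) + - ((a (S k) - power_sum z (S k)) / INR (S k)) * INR (S k))%C by (field; exact Nk).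
        rewrite E. ring.
      - rewrite E. field. exact Nk. }
    (* Absolute convergence for all n > k amounts to p <= k; the value a_n for all n > k then
       amounts to the vanishing of the coefficients of Q beyond k. *)
    assert (Ident : forall k, power_sum_identity z a k <-> (p <= k)%nat /\ forall n, (k < n)%nat -> q n = RtoC 0).
    { intros k. split.
      - intros H. assert (Hk : (p <= k)%nat) by (apply Lp, H; lia). split. exact Hk.
        intros [|n] Hn; [lia|]. apply Qz. lia. apply (csums_unique (inv_pow z (S n))).
        apply (power_sum_correct f z f0 z_ordering p Hp). lia. apply csums_is_series, H. lia.
      - intros [Hk H] n Hn. split. apply (inv_pow_summable f z f0 z_ordering p Hp). lia.
        destruct n as [|n]; [lia|]. apply csums_is_series.
        rewrite <- (proj1 (Qz n ltac:(lia))) by (apply H; lia).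
        apply (power_sum_correct f z f0 z_ordering p Hp). lia. }
    (* [d] is the degree of Q, with the value 0 when Q = 0. *)
    destruct (least_exists (fun d => forall k, (d < k)%nat -> q k = RtoC 0)) as [d [Hd Ld]].
    { exists n0. apply (Ident n0), Hn0. }
    destruct (rsum_tail (fun m => Cmod (inv_pow z (p + 1) m)) (fun m => Cmod_ge_0 _) Hp) as [s [Hs Hs_lim]].
    exists (Nat.max d p). split; [|split].
    - split.
      + apply Ident. split. lia. intros n Hn. apply Hd. lia.
      + intros k Hk. apply Ident in Hk. destruct Hk as [Hk1 Hk2]. specialize (Ld k Hk2). lia.
    - apply (hadamard_growth f z f_entire f0 z_ordering G a f_expG G_series p Hp s Hs d Hd).
    - exists p, d. split. split; assumption. split. reflexivity. split.
      + destruct d as [|d]; [left; reflexivity|right]. intros E.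
        assert (S d <= d)%nat; [|lia]. apply Ld. intros k Hk. destruct (Nat.eq_dec k (S d)). subst. exact E. apply Hd. lia.
      + intros x. apply (hadamard_product f z f_entire f0 z_ordering G a f_expG G_series p Hp s Hs Hs_lim d x Hd). }
  assert (Fwd : is_finite (order f) -> exists n0, power_sum_identity z a n0).
  { intros H. apply (finite_growth_power_sums f z f_entire f0 z_ordering G a f_expG G_series).
    apply order_finite_iff; assumption. }
  split; [|split].
  - intros r Hr Nr. apply (power_sums_asymptotic f z f_entire f0 z_ordering G a f_expG G_series r Hr Nr).
  - split. exact Fwd. intros [n0 Hn0]. apply order_finite_iff. exact f_entire.
    destruct (Had n0 Hn0) as [n1 [_ [Gr _]]]. exact Gr.
  - intros H. assert (E : exists n0, power_sum_identity z a n0) by (destruct H; auto).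
    destruct E as [n0 Hn0]. destruct (Had n0 Hn0) as [n1 [Least [Gr [p [d [Hp [En1 [Hd Prod]]]]]]]].
    exists n1. split. exact Least. split. apply order_finite_iff; assumption.
    set (q := hadamard_coef z a p) in *.
    exists z, p, (fun x => psum (pterm q x) (S d)), d. split. exact z_ordering. split. exact Hp. split; [|split; [|exact En1]].
    + exists q. split. exact Hd. intros x. apply psum_sum_n.
    + intros x. exists (f x * Cexp (- psum (pterm q x) (S d)))%C. split.
      * apply (Cto_filterlim eventually). apply Prod.
      * rewrite Cexp_opp. field. apply Cexp_neq0.
Qed.
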